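(* Let $P$ be a $d$-dimensional polytope with $d+4$ vertices. Then: (1) $\mathrm{xc}(P)=d+2$ if and only if $P$ has $d+2$ facets. (2) $\mathrm{xc}(P)=d+3$ if and only if: (2.1) $P$ has $d+3$ facets, or (2.2) $P=\pi(Q)$ for some affine projection $\pi$ and some polytope $Q$ combinatorially equivalent to $\mathrm{pyr}_{d-2}(\Delta_1\times\Delta_2)$. In case (2.2), either (2.2.1) $P=\mathrm{pyr}_k(H)$ is a $k$-fold pyramid (for some $k\ge 0$) over a Desarguian hexagon $H$, or (2.2.2) $P$ has a subset of $6$ vertices forming a triangular prism (i.e. whose convex hull is combinatorially equivalent to $\Delta_1\times\Delta_2$). (3) $\mathrm{xc}(P)=d+4$ otherwise.
   Context: The extension complexity $\mathrm{xc}(P)$ of a polytope $P$ is the minimal number of facets of a polytope (of any dimension) that can be linearly (affinely) projected onto $P$. $\Delta_n$ denotes an $n$-dimensional simplex, $\times$ the Cartesian product of polytopes, and $\mathrm{pyr}_k(R)$ the $k$-fold (iterated) pyramid over a polytope $R$ (with $\mathrm{pyr}_0(R)=R$). Two polytopes are combinatorially equivalent if their face lattices are isomorphic. A Desarguian hexagon is a hexagon $H$ (a convex polygon with exactly $6$ vertices) with $\mathrm{xc}(H)=5$; equivalently, for some cyclic labeling $p_0,\dots,p_5$ of its vertices the lines $p_0p_1$, $p_5p_2$ and $p_3p_4$ are concurrent.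
   Formalization: In (2), the condition is taken only for P without d+2 facets (not in case (1)); read literally, (2) fails for Δ_1×Δ_3 (d=4, 8 vertices, 6 facets), which satisfies (2.2) although xc(P)=d+2. *)

(* Defs.v *)
From mathcomp Require Import all_boot all_order all_algebra.
From mathcomp Require Import boolp classical_sets functions cardinality reals.

Set Implicit Arguments.
Unset Strict Implicit.
Unset Printing Implicit Defensive.

Import Order.TTheory GRing.Theory Num.Theory.
Local Open Scope classical_set_scope.
Local Open Scope card_scope.
Local Open Scope ring_scope.

Section Polytopes.
Variable R : realType.
Implicit Types m n k d : nat.

Definition affine_hull n (A : set 'rV[R]_n) : set 'rV[R]_n :=
  [set x | exists k (p : 'I_k -> 'rV[R]_n) (a : 'I_k -> R),
    [/\ forall i, A (p i), \sum_i a i = 1 & x = \sum_i a i *: p i]].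

Definition convex_hull n (A : set 'rV[R]_n) : set 'rV[R]_n :=
  [set x | exists k (p : 'I_k -> 'rV[R]_n) (a : 'I_k -> R),
    [/\ forall i, A (p i), forall i, 0 <= a i, \sum_i a i = 1
      & x = \sum_i a i *: p i]].

Definition polytope n (P : set 'rV[R]_n) : Prop :=
  exists2 A : set 'rV[R]_n, finite_set A & P = convex_hull A.

Definition affinely_independent n k (p : 'I_k -> 'rV[R]_n) : Prop :=
  forall a : 'I_k -> R,
    \sum_i a i = 0 -> \sum_i a i *: p i = 0 -> forall i, a i = 0.

(* The affine rank is the dimension plus one; it is used instead of the
   dimension so that the empty set (of dimension -1) needs no special case. *)
Definition affine_rank n (A : set 'rV[R]_n) k : Prop :=
  exists p : 'I_k -> 'rV[R]_n,
    [/\ forall i, A (p i), affinely_independent p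
      & A `<=` affine_hull (range p)].

Definition dimension n (A : set 'rV[R]_n) d : Prop := affine_rank A d.+1.

(* Both the empty face (c = 0, b = 1) and P itself (c = 0, b = 0) are faces. *)
Definition face n (P F : set 'rV[R]_n) : Prop :=
  exists (c : 'cV[R]_n) (b : R),
    (forall x, P x -> (x *m c) 0 0 <= b) /\
    F = P `&` [set x | (x *m c) 0 0 = b].

Definition faces n (P : set 'rV[R]_n) : set (set 'rV[R]_n) := [set F | face P F].

Definition vertices n (P : set 'rV[R]_n) : set 'rV[R]_n :=
  [set v | face P [set v]].

Definition facets n (P : set 'rV[R]_n) : set (set 'rV[R]_n) :=
  [set F | face P F /\ exists k, affine_rank F k /\ affine_rank P k.+1].

Definition affine_map m n (f : 'rV[R]_m -> 'rV[R]_n) : Prop :=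
  exists (M : 'M[R]_(m, n)) (t : 'rV[R]_n), forall x, f x = x *m M + t.

Definition affinely_equivalent m n (P : set 'rV[R]_m) (Q : set 'rV[R]_n) : Prop :=
  exists f : 'rV[R]_m -> 'rV[R]_n, affine_map f /\ set_bij P Q f.

(* An order isomorphism between face lattices is automatically a lattice
   isomorphism. *)
Definition combinatorially_equivalent m n
    (P : set 'rV[R]_m) (Q : set 'rV[R]_n) : Prop :=
  exists f : set 'rV[R]_m -> set 'rV[R]_n,
    set_bij (faces P) (faces Q) f /\
    (forall F G, faces P F -> faces P G -> (F `<=` G <-> f F `<=` f G)).

Definition has_extension n (P : set 'rV[R]_n) k : Prop :=
  exists m (Q : set 'rV[R]_m) (f : 'rV[R]_m -> 'rV[R]_n),
    [/\ polytope Q, affine_map f, f @` Q = P & facets Q #= `I_k].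

(* The default value 0 is never reached on a polytope, which is an extension
   of itself. *)
Definition xc n (P : set 'rV[R]_n) : nat :=
  xget 0%N
    [set k | has_extension P k /\ forall j, has_extension P j -> (k <= j)%N].

(* The standard n-simplex, with vertices the n + 1 unit vectors. *)
Definition simplex n : set 'rV[R]_n.+1 :=
  convex_hull (range (fun i : 'I_n.+1 => delta_mx 0 i)).
#[global] Arguments simplex n : clear implicits.

Definition product m n (P : set 'rV[R]_m) (Q : set 'rV[R]_n) : set 'rV[R]_(m + n) :=
  [set row_mx x y | x in P & y in Q].

(* The base is placed in the hyperplane where the new coordinate vanishes. *)
Definition pyr1 n (B : set 'rV[R]_n) : set 'rV[R]_(1 + n) :=
  convex_hull ([set row_mx 0 x | x in B] `|` [set row_mx (const_mx 1) 0]).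

Fixpoint pyr k n (B : set 'rV[R]_n) : set 'rV[R]_(k + n) :=
  match k return set 'rV[R]_(k + n) with
  | 0 => B
  | k'.+1 => pyr1 (@pyr k' n B)
  end.
#[global] Arguments pyr k {n} B.

Definition triangular_prism : set 'rV[R]_(2 + 3) :=
  product (simplex 1) (simplex 2).

Definition hexagon n (H : set 'rV[R]_n) : Prop :=
  [/\ polytope H, dimension H 2 & vertices H #= `I_6].

Definition desarguian_hexagon n (H : set 'rV[R]_n) : Prop :=
  hexagon H /\ xc H = 5%N.

(* The truncated subtraction is harmless: a polytope of dimension d with d + 4
   vertices has d >= 2. *)
Definition projection_of_pyramid_over_prism n d (P : set 'rV[R]_n) : Prop :=
  exists m (Q : set 'rV[R]_m) (f : 'rV[R]_m -> 'rV[R]_n),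
    [/\ polytope Q,
        combinatorially_equivalent Q (pyr (d - 2) triangular_prism),
        affine_map f & P = f @` Q].

(* Pyramids, whose apex is arbitrary, are defined up to affine equivalence. *)
Definition pyramid_over_desarguian_hexagon n (P : set 'rV[R]_n) : Prop :=
  exists k m (H : set 'rV[R]_m),
    desarguian_hexagon H /\ affinely_equivalent P (pyr k H).

Definition has_prism_on_vertices n (P : set 'rV[R]_n) : Prop :=
  exists S : set 'rV[R]_n,
    [/\ S `<=` vertices P, S #= `I_6
      & combinatorially_equivalent (convex_hull S) triangular_prism].

End Polytopes.

(* Main.v *)
(* In the slack coordinates of its k facets, a polytope Q of dimension e is the
   set of nonnegative points of an e-dimensional affine subspace of R^k.  For
   k = e + 1 it is a simplex; for k = e + 2 the cone over it is the part of the
   nonnegative orthant where a single linear form c vanishes.  Its extreme rays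
   are the unit vectors at the zeros of c and the combinations of a positive and
   a negative coordinate of c, so that it has z + ab vertices, if c has z zeros,
   a positive and b negative coefficients.  Counting vertices, an extension of P
   with at most d + 3 facets either is affinely equivalent to P, or has d + 3
   facets and dimension d + 1, and P is its projection along a line spanned by
   some u.

   In the latter case, Fourier-Motzkin elimination of u bounds the number of
   facets of P by the number of zeros of u plus the product of the numbers p and
   q of its positive and negative coordinates.  This is at most d + 3 when
   (p - 1)(q - 1) <= 1.  Otherwise at most one vertex is lost in the projection,
   and it lies on the two coordinates where u has the rarer sign.  Since P has
   d + 4 vertices, {a, b} is {2, 3}, and the extension is projectively a pyramid
   over a prism, or {2, 4}, and the cone over the vertices that are not lost is
   again of the kind {2, 3}.

   Conversely, numbers of facets and vertices and lengths of chains of faces are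
   combinatorial, so that a polytope combinatorially equivalent to the pyramid
   has the slack coordinates described above with {a, b} = {2, 3}.  The base
   prism is embedded in P unless u is parallel to it, and then P is a pyramid
   over the projection of the prism. *)
Require Import Defs.
From mathcomp Require Import all_boot all_order all_algebra.
From mathcomp Require Import boolp classical_sets functions cardinality reals.
From mathcomp Require Import fingroup perm lra ring zify.
Local Open Scope classical_set_scope.
Local Open Scope card_scope.

(** A slack cone determines a polytope only up to projective maps: the level [l] that cuts the
    polytope out of the cone is arbitrary, and permuting or positively rescaling the coordinates
    leaves of [c] only its sign pattern. This is why (2.2) asks for combinatorial equivalence. A
    [rep] keeps the extension and its projection in one datum, in which both [c] and the extension
    can be replaced while P stays fixed.

    The constants come from one equation. If z + a + b = d + 3, then N = z + ab means (a - 1)(b - 1)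
    = N - d - 2, which is 2 for N = d + 4 and 3 for N = d + 5.

    A ray is supported on one or two coordinates, and its image is a vertex as soon as [u] takes
    both signs outside the support. When (p - 1)(q - 1) >= 2, one sign occurs at least twice and the
    other at least three times, so a support can exhaust only the former, and only by being equal to
    it.

    In the converse, an isomorphism of face lattices is used only through inequalities (rank at
    least, facets and vertices at most); the d + 4 vertices of P turn them into equalities. *)

Section ExtensionComplexity.

Set Implicit Arguments.
Unset Strict Implicit.
Unset Printing Implicit Defensive.
Import Order.TTheory GRing.Theory Num.Theory.
Local Open Scope ring_scope.

(** * Finite cardinalities *)

Section Cardinality.
Variable X : Type.
Implicit Types A : set X.

Lemma card_setT_fin (T : finType) : [set: T] #= `I_#|T|.
Proof.
have inj : {in [set: T] &, injective (fun x : T => enum_rank x : nat)}.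
  by move=> x y _ _ /val_inj /enum_rank_inj.
suff <- : [set (enum_rank x : nat) | x in [set: T]] = `I_#|T|.
  by rewrite card_eq_sym; exact: inj_card_eq inj.
apply/seteqP; split=> [_ [x _ <-] | i /= lt_i]; first exact: ltn_ord.
by exists (enum_val (Ordinal lt_i)) => //; rewrite enum_valK.
Qed.

Lemma card_range (T : finType) (f : T -> X) : injective f -> range f #= `I_#|T|.
Proof.
move=> f_inj; apply: card_eq_trans (card_setT_fin T).
by apply: inj_card_eq => x y _ _ /f_inj.
Qed.

Lemma card_ordP A N : A #= `I_N -> exists2 f : 'I_N -> X, injective f & range f = A.
Proof.
move=> AN; have : [set: 'I_N] #= A.
  rewrite card_eq_sym in AN; apply: card_eq_trans AN.
  by have := card_setT_fin 'I_N; rewrite card_ord.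
case/card_bijP => f [g fK gK].
exists (fun i => set_val (f (SigSub (mem_setT i)))).
  by move=> i j /val_inj /(can_inj fK) /(congr1 val).
apply/seteqP; split=> [_ [i _ <-] | x Ax]; first exact: set_valP.
exists (set_val (g (SigSub (mem_set Ax)))) => //.
have -> : SigSub (mem_setT (set_val (g (SigSub (mem_set Ax))))) =
   g (SigSub (mem_set Ax)) by apply: val_inj.
by rewrite gK.
Qed.

Lemma card_unique A i j : A #= `I_i -> A #= `I_j -> i = j.
Proof. by rewrite card_eq_sym => Ai Aj; apply/card_eq_II/(card_eq_trans Ai Aj). Qed.

Lemma card_sub_range (T : finType) (f : T -> X) A :
  A `<=` range f -> exists2 k, (k <= #|T|)%N & A #= `I_k.
Proof.
move=> sub; have fin : finite_set A.
  by apply: sub_finite_set sub _; apply: finite_image; apply: finite_finset.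
case/finite_setP: fin => k Ak; exists k => //.
have [g g_inj gA] := card_ordP Ak.
have ex i : exists t, f t = g i.
  have [t _ <-] : range f (g i) by apply: sub; rewrite -gA; exists i.
  by exists t.
rewrite -[k]card_ord; apply: (@leq_card _ _ (fun i => projT1 (cid (ex i)))).
move=> i j eq_ij; apply: g_inj.
by rewrite -(projT2 (cid (ex i))) -(projT2 (cid (ex j))) eq_ij.
Qed.

Lemma card_sup_range (T : finType) (f : T -> X) A N :
  injective f -> range f `<=` A -> A #= `I_N -> (#|T| <= N)%N.
Proof.
move=> f_inj sub AN; rewrite -card_le_II.
rewrite -(card_le_eql (card_range f_inj)) -(card_le_eqr AN).
exact: subset_card_le.
Qed.

Lemma card_eq_range (T : finType) (f : T -> X) A :
  A `<=` range f -> A #= `I_#|T| -> injective f /\ range f = A.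
Proof.
move=> sub AN; have [g g_inj gA] := card_ordP AN.
have ex i : exists t, f t = g i.
  have [t _ <-] : range f (g i) by apply: sub; rewrite -gA; exists i.
  by exists t.
pose h i := projT1 (cid (ex i)).
have fh i : f (h i) = g i by exact: projT2 (cid (ex i)).
have h_inj : injective h by move=> i j eq_ij; apply: g_inj; rewrite -!fh eq_ij.
have h_bij : bijective h by apply: inj_card_bij => //; rewrite card_ord.
case: h_bij => h' hK h'K; split.
  by move=> s t; rewrite -(h'K s) -(h'K t) !fh => /g_inj->.
by rewrite -gA; apply/seteqP; split=> _ [t _ <-];
  [exists (h' t) => //; rewrite -fh h'K | exists (h t) => //; rewrite fh].
Qed.

End Cardinality.

(** * Linear functionals and the lemma of Farkas *)

Section NonnegativeCombinations.
Variable R : realType.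
Local Notation dot x g := ((x *m g) 0 0).

Section Dot.
Variable n : nat.
Implicit Types (x y : 'rV[R]_n) (g h : 'cV[R]_n) (a : R).

Lemma dotDl x y g : dot (x + y) g = dot x g + dot y g.
Proof. by rewrite mulmxDl [LHS]mxE. Qed.

Lemma dotBl x y g : dot (x - y) g = dot x g - dot y g.
Proof. by rewrite mulmxBl [LHS]mxE [X in _ + X]mxE. Qed.

Lemma dotNl x g : dot (- x) g = - dot x g.
Proof. by rewrite mulNmx [LHS]mxE. Qed.

Lemma dotZl a x g : dot (a *: x) g = a * dot x g.
Proof. by rewrite -scalemxAl [LHS]mxE. Qed.

Lemma dot0l g : dot (0 : 'rV_n) g = 0.
Proof. by rewrite mul0mx mxE. Qed.

Lemma dotDr x g h : dot x (g + h) = dot x g + dot x h.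
Proof. by rewrite mulmxDr [LHS]mxE. Qed.

Lemma dotBr x g h : dot x (g - h) = dot x g - dot x h.
Proof. by rewrite mulmxBr [LHS]mxE [X in _ + X]mxE. Qed.

Lemma dotNr x g : dot x (- g) = - dot x g.
Proof. by rewrite mulmxN [LHS]mxE. Qed.

Lemma dotZr a x g : dot x (a *: g) = a * dot x g.
Proof. by rewrite -scalemxAr [LHS]mxE. Qed.

Lemma dot0r x : dot x (0 : 'cV_n) = 0.
Proof. by rewrite mulmx0 mxE. Qed.

Lemma dot_suml I (r : seq I) (P : pred I) (v : I -> 'rV[R]_n) g :
  dot (\sum_(i <- r | P i) v i) g = \sum_(i <- r | P i) dot (v i) g.
Proof. by rewrite mulmx_suml summxE. Qed.

Lemma dotE x g : dot x g = \sum_i x 0 i * g i 0.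
Proof. by rewrite mxE. Qed.

End Dot.

(** The vector [x - x *m A *m pinvmx A] is killed by [A], hence by [B]. This is the tool by which
    maps descend along the kernel of a projection. *)
Lemma mx_factor p q s (A : 'M[R]_(p, q)) (B : 'M[R]_(p, s)) :
  (forall x : 'rV_p, x *m A = 0 -> x *m B = 0) -> exists C, B = A *m C.
Proof.
move=> kerAB; exists (pinvmx A *m B); apply/row_matrixP => i.
apply/eqP; rewrite -subr_eq0 -linearB /= rowE.
set x := delta_mx 0 i.
have := kerAB (x - x *m A *m pinvmx A).
rewrite mulmxBl mulmxKpV ?submxMl // subrr => /(_ erefl).
by rewrite mulmxBl !mulmxA mulmxBr !mulmxA => ->.
Qed.

(** Induction on N. If [g] separates x from the first N vectors but is negative on the last one, w,
    everything is projected along w to the kernel of [g]. A combination found there lifts with a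
    nonnegative weight on w, and a separating functional pulls back to one that vanishes on w. *)
Lemma Farkas m N (v : 'I_N -> 'rV[R]_m) (x : 'rV[R]_m) :
  (exists a : 'I_N -> R, (forall i, 0 <= a i) /\ x = \sum_i a i *: v i) \/
  (exists g : 'cV[R]_m, (forall i, 0 <= dot (v i) g) /\ dot x g < 0).
Proof.
elim: N v x => [|N IHN] v x.
  have [->|x0] := eqVneq x 0; [left | right].
    by exists (fun=> 0); split=> //; rewrite big_ord0.
  exists (- x^T); split=> [[]//|]; rewrite mulmxN mxE oppr_lt0 mxE.
  have [j xj] : exists j, x 0 j != 0.
    apply: contrapT => /forallNP h; move/eqP: x0; apply.
    by apply/rowP => j; rewrite mxE; apply: contrapT => /eqP; exact: h.
  rewrite (bigD1 j) //= mxE ltr_pwDl // -?expr2 ?exprn_even_gt0 //.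
  by apply: sumr_ge0 => k _; rewrite mxE -expr2 sqr_ge0.
case: (IHN (fun i => v (widen_ord (leqnSn N) i)) x) => [[a [a0 ->]]|[g [g0 gx]]].
  left; exists (fun i => if unlift ord_max i is Some j then a j else 0).
  split=> [i|]; first by case: unliftP.
  rewrite big_ord_recr /= unlift_none scale0r addr0; apply: eq_bigr => i _.
  by rewrite (_ : widen_ord _ i = lift ord_max i) ?liftK //; apply: val_inj;
     rewrite /= /bump leqNgt ltn_ord.
have [gN|gN] := leP 0 ((v ord_max *m g) 0 0).
  right; exists g; split=> // i.
  case: (unliftP ord_max i) => [j|] -> //.
  rewrite (_ : lift _ j = widen_ord (leqnSn N) j) //; apply: val_inj.
  by rewrite /= /bump leqNgt ltn_ord.
set w := v ord_max in gN *; set gw := (w *m g) 0 0 in gN.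
have gw0 : gw != 0 by rewrite lt_eqF.
(* The projection along [w] onto the kernel of [g]; below, [h'] is [h] composed with it. *)
pose p (y : 'rV[R]_m) := y - ((y *m g) 0 0 / gw) *: w.
case: (IHN (fun i => p (v (widen_ord (leqnSn N) i))) (p x)) => [[a [a0 xa]]|[h [h0 hx]]].
  left; pose gv i := (v (widen_ord (leqnSn N) i) *m g) 0 0.
  exists (fun i => if unlift ord_max i is Some j then a j else
     (x *m g) 0 0 / gw - \sum_j a j * (gv j / gw)).
  split=> [i|].
    case: unliftP => // _; rewrite subr_ge0; apply: (@le_trans _ _ 0).
      apply: sumr_le0 => j _; rewrite mulr_ge0_le0 //.
      by rewrite mulr_ge0_le0 ?g0 // invr_le0 ltW.
    by rewrite mulr_le0 ?invr_le0 // ltW.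
  rewrite big_ord_recr /= unlift_none.
  transitivity (\sum_i a i *: p (v (widen_ord (leqnSn N) i)) + ((x *m g) 0 0 / gw) *: w).
    by rewrite -xa /p subrK.
  rewrite scalerBl [RHS]addrCA [LHS]addrC; congr (_ + _).
  rewrite scaler_suml -sumrB; apply: eq_bigr => i _.
  rewrite (_ : widen_ord _ i = lift ord_max i) ?liftK; last first.
    by apply: val_inj; rewrite /= /bump leqNgt ltn_ord.
  by rewrite /p scalerBr scalerA /gv (_ : widen_ord _ i = lift ord_max i) //;
     apply: val_inj; rewrite /= /bump leqNgt ltn_ord.
right; pose h' := h - ((w *m h) 0 0 / gw) *: g.
have h'E y : (y *m h') 0 0 = (p y *m h) 0 0.
  by rewrite /h' /p dotBr dotBl dotZr dotZl mulrC mulrA mulrAC.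
exists h'; split=> [i|]; last by rewrite h'E.
rewrite h'E; case: (unliftP ord_max i) => [j|] ->.
  rewrite (_ : lift _ j = widen_ord (leqnSn N) j) //; apply: val_inj.
  by rewrite /= /bump leqNgt ltn_ord.
by rewrite /p -/w -/gw divff // scale1r subrr mul0mx mxE.
Qed.

End NonnegativeCombinations.

(** * Homogenization, affine rank, hulls and vertices *)

Section AffineRankAndVertices.
Variable R : realType.
Local Notation dot x g := ((x *m g) 0 0).

Section Homogenization.
Variable n : nat.
Implicit Types (x y z : 'rV[R]_n) (A P F G : set 'rV[R]_n).

(** In homogeneous coordinates affine ranks are matrix ranks, an affine inequality is a single
    column, and a polytope becomes a cone. *)
Definition hmg x : 'rV[R]_(1 + n) := row_mx 1%:M x.

Definition hmg0 : 'cV[R]_(1 + n) := col_mx 1%:M 0.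

Lemma hmg_dot0 x : dot (hmg x) hmg0 = 1.
Proof. by rewrite /hmg /hmg0 mul_row_col mulmx1 mulmx0 addr0 mxE. Qed.

Lemma hmgK x : rsubmx (hmg x) = x.
Proof. exact: row_mxKr. Qed.

Lemma hmg_inj : injective hmg.
Proof. by move=> x y /(congr1 rsubmx); rewrite !hmgK. Qed.

Lemma hmg_rsubmx (w : 'rV[R]_(1 + n)) : dot w hmg0 = 1 -> hmg (rsubmx w) = w.
Proof.
rewrite -{1 3}[w]hsubmxK /hmg0 mul_row_col mulmx1 mulmx0 addr0 => w0.
by rewrite /hmg; congr row_mx; apply/matrixP => i j; rewrite !ord1 w0 mxE.
Qed.

Lemma hmg_sum (T : finType) (a : T -> R) (v : T -> 'rV[R]_n) :
  \sum_t a t = 1 -> hmg (\sum_t a t *: v t) = \sum_t a t *: hmg (v t).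
Proof.
move=> a1; rewrite -[RHS]hmg_rsubmx ?linear_sum /=; last first.
  by rewrite dot_suml -a1; apply: eq_bigr => t _; rewrite dotZl hmg_dot0 mulr1.
congr hmg; apply: eq_bigr => t _; rewrite linearZ /=; congr (_ *: _).
by rewrite hmgK.
Qed.

Lemma dot_hmg x (b : R) (c : 'cV[R]_n) :
  dot (hmg x) (col_mx b%:M (- c)) = b - dot x c.
Proof. by rewrite mul_row_col mul1mx mulmxN [LHS]mxE [X in _ + X]mxE mxE eqxx. Qed.

Lemma faceP P F :
  face P F <-> exists2 g : 'cV[R]_(1 + n), (forall x, P x -> 0 <= dot (hmg x) g) &
    F = P `&` [set x | dot (hmg x) g = 0].
Proof.
split=> [[c [b [le_b ->]]]|[g g0 ->]].
  exists (col_mx b%:M (- c)) => [x /le_b|]; first by rewrite dot_hmg subr_ge0.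
  apply/seteqP; split=> x [Px /= xE]; split=> //=; move: xE; rewrite dot_hmg.
    by move=> ->; rewrite subrr.
  by move/eqP; rewrite subr_eq0 => /eqP->.
have gE : g = col_mx (usubmx g 0 0)%:M (- - dsubmx g).
  by rewrite -[LHS]vsubmxK opprK; congr col_mx; apply/matrixP => i j;
     rewrite !ord1 [RHS]mxE eqxx.
have dE x : dot (hmg x) g = usubmx g 0 0 - dot x (- dsubmx g).
  by rewrite {1}gE dot_hmg.
exists (- dsubmx g), (usubmx g 0 0); split=> [x /g0|]; first by rewrite dE subr_ge0.
apply/seteqP; split=> x [Px /= xE]; split=> //=; move: xE; rewrite dE.
  by move/eqP; rewrite subr_eq0 => /eqP->.
by move=> ->; rewrite subrr.
Qed.

Lemma face_sub P F : face P F -> F `<=` P.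
Proof. by case/faceP => g _ -> x []. Qed.

Lemma face_self P : face P P.
Proof.
apply/faceP; exists 0 => [x _|]; first by rewrite dot0r.
by apply/seteqP; split=> [x Px|x []//]; split=> //=; rewrite dot0r.
Qed.

Definition hmg_mx k (p : 'I_k -> 'rV[R]_n) : 'M[R]_(k, 1 + n) :=
  \matrix_i hmg (p i).

Lemma affinely_independentP k (p : 'I_k -> 'rV[R]_n) :
  affinely_independent p <-> row_free (hmg_mx p).
Proof.
have sumE (a : 'rV[R]_k) : a *m hmg_mx p = row_mx (\sum_i a 0 i)%:M (\sum_i a 0 i *: p i).
  rewrite mulmx_sum_row (eq_bigr (fun i => row_mx (a 0 i)%:M (a 0 i *: p i))); last first.
    by move=> i _; rewrite rowK /hmg scale_row_mx scale_scalar_mx mulr1.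
  rewrite -[LHS]hsubmxK !linear_sum /=; congr row_mx; last first.
    by apply: eq_bigr => i _; rewrite row_mxKr.
  by rewrite raddf_sum; apply: eq_bigr => i _; rewrite row_mxKl.
split=> [indep | free a a0 ap i].
  apply/inj_row_free => a; rewrite sumE => /eqP; rewrite row_mx_eq0 => /andP[/eqP a0 /eqP ap].
  apply/rowP => i; rewrite mxE; apply: (indep (fun i => a 0 i)) => //.
  by have /matrixP/(_ 0 0) := a0; rewrite !mxE eqxx.
have := sumE (\row_i a i); rewrite (eq_bigr a) => [|j _]; last by rewrite mxE.
rewrite (eq_bigr (fun i => a i *: p i)) => [|j _]; last by rewrite mxE.
rewrite a0 ap raddf0 row_mx0 => /(congr1 (mulmx^~ (pinvmx (hmg_mx p)))).
by rewrite mulmxKp // mul0mx => /rowP/(_ i); rewrite !mxE.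
Qed.

Lemma affine_hull_range k (p : 'I_k -> 'rV[R]_n) x :
  affine_hull (range p) x <-> (hmg x <= hmg_mx p)%MS.
Proof.
split=> [[l [q [a [qp a1 ->]]]]|/submxP[a xE]].
  rewrite hmg_sum //; apply: summx_sub => i _; apply: scalemx_sub.
  have [j _ <-] := qp i; rewrite -[hmg (p j)](rowK (fun i => hmg (p i))).
  exact: row_sub.
exists k, p, (fun i => a 0 i).
have hE : hmg x = \sum_i a 0 i *: hmg (p i).
  by rewrite xE mulmx_sum_row; apply: eq_bigr => i _; rewrite rowK.
have a1 : \sum_i a 0 i = 1.
  rewrite -(hmg_dot0 x) hE dot_suml; apply: eq_bigr => i _.
  by rewrite dotZl hmg_dot0 mulr1.
split=> //.
by apply: hmg_inj; rewrite hmg_sum.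
Qed.

Lemma affine_rankP A k : affine_rank A k <-> exists p : 'I_k -> 'rV[R]_n,
  [/\ forall i, A (p i), row_free (hmg_mx p) & forall x, A x -> (hmg x <= hmg_mx p)%MS].
Proof.
split=> -[p [Ap indep hull]]; exists p; split=> //.
- exact/affinely_independentP.
- by move=> x /hull /affine_hull_range.
- exact/affinely_independentP.
- by move=> x /hull /affine_hull_range.
Qed.

Lemma affine_rank_sub A B i j : A `<=` B -> affine_rank A i -> affine_rank B j -> (i <= j)%N.
Proof.
move=> AB /affine_rankP[p [Ap /eqP rp _]] /affine_rankP[q [_ /eqP rq Bq]].
rewrite -rp -rq.
by apply: mxrankS; apply/row_subP => l; rewrite rowK; apply/Bq/AB.
Qed.

Lemma affine_rank_unique A i j : affine_rank A i -> affine_rank A j -> i = j.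
Proof.
by move=> Ai Aj; apply/eqP; rewrite eqn_leq !(@affine_rank_sub A A).
Qed.

Lemma affine_rank_exists A : exists k, affine_rank A k.
Proof.
pose free_family k := exists p : 'I_k -> 'rV[R]_n, (forall i, A (p i)) /\ row_free (hmg_mx p).
have ex : exists k, `[< free_family k >].
  exists 0%N; apply/asboolP; exists (fun=> 0); split=> [[]//|].
  by rewrite /row_free -leqn0 rank_leq_row.
have ub k : `[< free_family k >] -> (k <= 1 + n)%N.
  by case/asboolP => p [_ /eqP <-]; exact: rank_leq_col.
case: (ex_maxnP ex ub) => k /asboolP[p [Ap free]] maxk.
exists k; apply/affine_rankP; exists p; split=> // x Ax; apply: contrapT => /negP notx.
suff /maxk : `[< free_family k.+1 >] by rewrite ltnn.
apply/asboolP; exists (fun i => if unlift ord_max i is Some j then p j else x).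
split=> [i|]; first by case: unliftP.
apply/inj_row_free => a; rewrite mulmx_sum_row big_ord_recr /= !rowK unlift_none => aE.
have wE i : widen_ord (leqnSn k) i = lift ord_max i.
  by apply: val_inj; rewrite /= /bump leqNgt ltn_ord.
have sumE : \sum_(i < k) a 0 (widen_ord (leqnSn k) i) *: row (widen_ord (leqnSn k) i)
    (hmg_mx (fun i => if unlift ord_max i is Some j then p j else x)) =
    (\row_i a 0 (lift ord_max i)) *m hmg_mx p.
  rewrite mulmx_sum_row; apply: eq_bigr => i _; rewrite mxE !rowK wE liftK //.
rewrite sumE in aE.
have amax : a 0 ord_max = 0.
  apply: contrapT => /eqP a0; case/negP: notx.
  have -> : hmg x = - (a 0 ord_max)^-1 *: (\row_i a 0 (lift ord_max i) *m hmg_mx p).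
    move/eqP: aE; rewrite addrC addr_eq0 => /eqP aE.
    by rewrite scaleNr -scalerN -aE scalerA mulVf // scale1r.
  by apply: scalemx_sub; exact: submxMl.
move: aE; rewrite amax scale0r addr0 => /(congr1 (mulmx^~ (pinvmx (hmg_mx p)))).
rewrite mulmxKp // mul0mx => /rowP arow.
apply/rowP => i; rewrite [RHS]mxE; case: (unliftP ord_max i) => [j|] -> //.
by have := arow j; rewrite !mxE.
Qed.

(** The second hypothesis says dually that [U] lies in the span of A: a linear condition satisfied
    by all points of A holds on [U]. No spanning family in A has to be exhibited. *)
Lemma affine_rank_span A (k : nat) (U : 'M[R]_(k, 1 + n)) :
  (forall x, A x -> (hmg x <= U)%MS) ->
  (forall l (V : 'M[R]_(1 + n, l)), (forall x, A x -> hmg x *m V = 0) -> U *m V = 0) ->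
  affine_rank A (\rank U).
Proof.
move=> AU UA; have [r Ar] := affine_rank_exists A.
have /affine_rankP[p [Ap /eqP rp Ahull]] := Ar.
suff -> : \rank U = r by [].
rewrite -rp; apply/eqP; rewrite eqn_leq !mxrankS //.
  by apply/row_subP => i; rewrite rowK; apply/AU.
rewrite submxE; apply/eqP/UA => x /Ahull; rewrite submxE => /eqP; exact.
Qed.

(** If the ranks were equal, G would lie in the span of F, where the functional that exposes F
    vanishes. *)
Lemma face_rank_lt P F G i j : face P F -> F `<=` G -> G `<=` P -> F <> G ->
  affine_rank F i -> affine_rank G j -> (i < j)%N.
Proof.
case/faceP => g g0 FE FG GP neqFG.
move=> /affine_rankP[p [Fp /eqP rp _]] /affine_rankP[q [Gq /eqP rq Gspan]].
rewrite -rp -rq.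
have sub : (hmg_mx p <= hmg_mx q)%MS.
  by apply/row_subP => l; rewrite rowK; apply/Gspan/FG.
rewrite ltn_neqAle mxrankS // andbT; apply/negP => /eqP eqrk.
apply: neqFG; apply/seteqP; split=> // x Gx.
have : (hmg_mx q <= hmg_mx p)%MS by rewrite -(geq_leqif (mxrank_leqif_sup sub)) eqrk.
move=> /(submx_trans (Gspan x Gx)) /submxP[a aE].
rewrite FE; split; first exact: GP.
rewrite /= aE -mulmxA; suff -> : hmg_mx p *m g = 0 by rewrite mulmx0 mxE.
apply/row_matrixP => l; rewrite row_mul rowK row0.
have := Fp l; rewrite FE => -[_ /= gl]; apply/matrixP => s t.
by rewrite !ord1 gl mxE.
Qed.

End Homogenization.

Section Hull.
Variable n : nat.
Implicit Types (P F G : set 'rV[R]_n).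

(** The weights sum to 1 automatically, by the first homogeneous coordinate. *)
Definition hull (T : finType) (v : T -> 'rV[R]_n) : set 'rV[R]_n :=
  [set x | exists2 a : T -> R, (forall t, 0 <= a t) & hmg x = \sum_t a t *: hmg (v t)].

Lemma hull_mem (T : finType) (v : T -> 'rV[R]_n) t : hull v (v t).
Proof.
exists (fun s => (s == t)%:R) => [s|]; first exact: ler0n.
rewrite (bigD1 t) //= eqxx scale1r big1 ?addr0 // => s /negPf->.
by rewrite scale0r.
Qed.

Lemma hull_weights (T : finType) (v : T -> 'rV[R]_n) x (a : T -> R) :
  hmg x = \sum_t a t *: hmg (v t) -> \sum_t a t = 1 /\ x = \sum_t a t *: v t.
Proof.
move=> xE; have a1 : \sum_t a t = 1.
  by rewrite -(hmg_dot0 x) xE dot_suml; apply: eq_bigr => t _; rewrite dotZl hmg_dot0 mulr1.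
by split=> //; apply: hmg_inj; rewrite hmg_sum.
Qed.

Lemma convex_hull_range (T : finType) (v : T -> 'rV[R]_n) : convex_hull (range v) = hull v.
Proof.
apply/seteqP; split=> x.
  case=> k [p [a [pv a0 a1 ->]]].
  have ex i : exists t, v t = p i by have [t _ <-] := pv i; exists t.
  pose h i := projT1 (cid (ex i)).
  have vh i : v (h i) = p i by exact: projT2 (cid (ex i)).
  exists (fun t => \sum_(i | h i == t) a i); first by move=> t; apply: sumr_ge0.
  rewrite hmg_sum // (partition_big h predT) //=; apply: eq_bigr => t _.
  by rewrite scaler_suml; apply: eq_bigr => i /eqP <-; rewrite vh.
case=> a a0 /hull_weights[a1 ->].
exists #|T|, (fun i => v (enum_val i)), (fun i => a (enum_val i)); split=> //.
- by rewrite -a1 [RHS](reindex _ (onW_bij _ (@enum_val_bij T))).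
- by rewrite [LHS](reindex _ (onW_bij _ (@enum_val_bij T))).
Qed.

Lemma polytope_hull (T : finType) (v : T -> 'rV[R]_n) : polytope (hull v).
Proof.
exists (range v); last by rewrite convex_hull_range.
by apply: finite_image; apply: finite_finset.
Qed.

Lemma polytopeP P : polytope P -> exists N (v : 'I_N -> 'rV[R]_n), P = hull v.
Proof.
case=> A /finite_setP[N AN] ->; have [f _ fA] := card_ordP AN.
by exists N, f; rewrite -convex_hull_range fA.
Qed.

Lemma hull_dot_ge0 (T : finType) (v : T -> 'rV[R]_n) (g : 'cV[R]_(1 + n)) :
  (forall t, 0 <= dot (hmg (v t)) g) -> forall x, hull v x -> 0 <= dot (hmg x) g.
Proof.
move=> g0 x [a a0 ->]; rewrite dot_suml; apply: sumr_ge0 => t _.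
by rewrite dotZl mulr_ge0.
Qed.

Lemma hull_dot_eq0 (T : finType) (v : T -> 'rV[R]_n) (g : 'cV[R]_(1 + n)) x :
  (forall t, 0 <= dot (hmg (v t)) g) -> hull v x -> dot (hmg x) g = 0 ->
  exists t, dot (hmg (v t)) g = 0.
Proof.
move=> g0 [a a0 xE] xg; apply: contrapT => /forallNP gN.
have [a1 _] := hull_weights xE.
have : \sum_t a t * dot (hmg (v t)) g = 0.
  transitivity (dot (hmg x) g) => //; rewrite xE dot_suml.
  by apply: eq_bigr => t _; rewrite dotZl.
move/eqP; rewrite psumr_eq0 => [/allP ag|t _]; last by rewrite mulr_ge0.
have : \sum_t a t = 0.
  apply: big1 => t _; have := ag t (mem_index_enum _).
  by rewrite mulf_eq0 => /orP[/eqP//|/eqP/gN].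
by rewrite a1 => /eqP; rewrite oner_eq0.
Qed.

Lemma hull_face_mem (T : finType) (v : T -> 'rV[R]_n) F :
  face (hull v) F -> F !=set0 -> exists t, F (v t).
Proof.
case/faceP => g g0 FE [x]; rewrite FE => -[xv /= xg].
have [t tg] := hull_dot_eq0 (fun t => g0 _ (hull_mem v t)) xv xg.
by exists t; split=> //; exact: hull_mem.
Qed.

Lemma vertices_hull (T : finType) (v : T -> 'rV[R]_n) : vertices (hull v) `<=` range v.
Proof.
move=> x xV; have [t <-] := hull_face_mem xV (ex_intro _ x erefl).
by exists t.
Qed.

(** In a generating family of minimal size no point lies in the hull of the others, so Farkas
    separates it from them and it is a vertex. *)
Lemma hull_vertices P N :
  polytope P -> vertices P #= `I_N ->
  exists v : 'I_N -> 'rV[R]_n, [/\ injective v, range v = vertices P & P = hull v].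
Proof.
move=> /polytopeP exP VN.
pose gen N := `[< exists v : 'I_N -> 'rV[R]_n, P = hull v >].
have ex : exists N, gen N by case: exP => M vP; exists M; apply/asboolP.
case: (ex_minnP ex) => M /asboolP[v PE] minM.
have notothers (M' : nat) (eM : M = M'.+1) (w : 'I_M'.+1 -> 'rV[R]_n) (wP : P = hull w) (t : 'I_M'.+1) :
    ~ hull (fun j => w (lift t j)) (w t).
  move=> [a a0 aE]; suff /minM : gen M' by rewrite eM ltnn.
  apply/asboolP; exists (fun j => w (lift t j)); rewrite wP.
  apply/seteqP; split=> x [b b0 xE]; last first.
    exists (fun i => if unlift t i is Some j then b j else 0).
      by move=> i; case: unliftP.
    rewrite xE (bigD1_ord t) //= unlift_none scale0r add0r.
    by apply: eq_bigr => j _; rewrite liftK.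
  exists (fun j => b (lift t j) + b t * a j).
    by move=> j; rewrite addr_ge0 // mulr_ge0.
  rewrite xE (bigD1_ord t) //= aE scaler_sumr -big_split /=.
  by apply: eq_bigr => j _; rewrite addrC scalerDl scalerA.
have v_vert t : vertices P (v t).
  case: M v PE minM notothers t => [|M] v PE minM notothers t; first by case: t.
  have [[a [a0 aE]]|[g [g0 gt]]] := Farkas (fun j => hmg (v (lift t j))) (hmg (v t)).
    by case: (notothers _ erefl v PE t); exists a.
  (* Subtracting the constant value at [v t] makes the separating functional vanish at [v t] and
     stay positive at the other generators. *)
  pose h := g - dot (hmg (v t)) g *: hmg0 n.
  have hE x : dot (hmg x) h = dot (hmg x) g - dot (hmg (v t)) g.
    by rewrite dotBr dotZr hmg_dot0 mulr1.
  have h_ge0 i : 0 <= dot (hmg (v i)) h.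
    rewrite hE subr_ge0; case: (unliftP t i) => [j|] -> //.
    by apply: le_trans (g0 j); apply: ltW.
  apply/faceP; exists h => [x|]; first by rewrite PE; exact: hull_dot_ge0.
  apply/seteqP; split=> [x ->|x []].
    by split; [rewrite PE; exact: hull_mem | rewrite /= hE subrr].
  rewrite PE => -[a a0 xE] /= xh.
  have : \sum_i a i * dot (hmg (v i)) h = 0.
    transitivity (dot (hmg x) h) => //; rewrite xE dot_suml.
    by apply: eq_bigr => i _; rewrite dotZl.
  move/eqP; rewrite psumr_eq0 => [/allP ah|i _]; last by rewrite mulr_ge0.
  have a_eq0 j : a (lift t j) = 0.
    have := ah (lift t j) (mem_index_enum _).
    rewrite mulf_eq0 => /orP[/eqP//|]; rewrite hE gt_eqF // subr_gt0.
    by apply: lt_le_trans (g0 j).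
  have xE' : hmg x = a t *: hmg (v t).
    by rewrite xE (bigD1_ord t) //= big1 ?addr0 // => j _; rewrite a_eq0 scale0r.
  have at1 : a t = 1 by rewrite -(hmg_dot0 x) xE' dotZl hmg_dot0 mulr1.
  by apply: hmg_inj; rewrite xE' at1 scale1r.
have v_inj : injective v.
  case: M v PE minM notothers v_vert => [|M] v PE minM notothers v_vert; first by case.
  move=> s t eqst; apply: contrapT => /eqP; rewrite eq_sym => neq_st.
  case: (unliftP s t) neq_st => [j tE _|->]; last by rewrite eqxx.
  case: (notothers _ erefl v PE s); rewrite eqst tE.
  exact: (hull_mem (fun j => v (lift s j))).
have rangeE : range v = vertices P.
  apply/seteqP; split=> [_ [t _ <-]|]; first exact: v_vert.
  by rewrite PE; exact: vertices_hull.
have MN : M = N.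
  by have := card_range v_inj; rewrite card_ord rangeE => VM; apply: card_unique VM VN.
by case: N / MN VN => _; exists v.
Qed.

End Hull.

Section AffineMaps.
Variables m n : nat.
Implicit Types (f : 'rV[R]_m -> 'rV[R]_n).

Lemma affine_map_hmg f : affine_map f ->
  exists A : 'M[R]_(1 + m, 1 + n), forall x, hmg (f x) = hmg x *m A.
Proof.
case=> M [t fE]; exists (block_mx 1%:M t 0 M) => x.
by rewrite /hmg mul_row_block !mul1mx mulmx0 addr0 fE addrC.
Qed.

End AffineMaps.

End AffineRankAndVertices.

(** * Projective equivalence, and polytopes cut out by their facets *)

Section ProjectiveEquivalenceAndSlackForm.
Variable R : realType.
Local Notation dot x g := ((x *m g) 0 0).

Lemma affine_rank_le m n (F : set 'rV[R]_m) (G : set 'rV[R]_n) (B : 'M[R]_(1 + n, 1 + m)) i j :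
  (forall x, F x -> exists (y : 'rV[R]_n) (a : R), G y /\ hmg x = a *: (hmg y *m B)) ->
  affine_rank F i -> affine_rank G j -> (i <= j)%N.
Proof.
move=> FG /affine_rankP[p [Fp /eqP rp _]] /affine_rankP[q [_ _ Gq]].
rewrite -rp; apply: leq_trans (rank_leq_row (hmg_mx q)).
apply: (@leq_trans (\rank (hmg_mx q *m B))); last exact: mxrankM_maxl.
apply: mxrankS; apply/row_subP => l; rewrite rowK.
have [y [a [Gy ->]]] := FG _ (Fp l); apply: scalemx_sub.
exact: submxMr (Gq y Gy).
Qed.

(** A projective map and an inverse on the points concerned. The ambient dimensions may differ, so
    neither matrix need be invertible. Positivity of the factor keeps the points on one side of the
    hyperplane sent to infinity, and so preserves inequalities. *)
Definition proj_rel m n (A : 'M[R]_(1 + m, 1 + n)) (B : 'M[R]_(1 + n, 1 + m))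
    (x : 'rV[R]_m) (y : 'rV[R]_n) : Prop :=
  exists2 a : R, 0 < a & hmg x *m A = a *: hmg y /\ hmg y *m B = a^-1 *: hmg x.

Definition proj_equiv_by m n (A : 'M[R]_(1 + m, 1 + n)) (B : 'M[R]_(1 + n, 1 + m))
    (Q : set 'rV[R]_m) (P : set 'rV[R]_n) : Prop :=
  (forall x, Q x -> exists2 y, P y & proj_rel A B x y) /\
  (forall y, P y -> exists2 x, Q x & proj_rel A B x y).

Definition proj_equiv m n (Q : set 'rV[R]_m) (P : set 'rV[R]_n) : Prop :=
  exists A B, @proj_equiv_by m n A B Q P.

Definition proj_image m n (A : 'M[R]_(1 + m, 1 + n)) B (P : set 'rV[R]_n) (F : set 'rV[R]_m) :
  set 'rV[R]_n := [set y | P y /\ exists2 x, F x & proj_rel A B x y].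

Lemma proj_rel_sym m n (A : 'M[R]_(1 + m, 1 + n)) B x y :
  proj_rel A B x y -> proj_rel B A y x.
Proof. by case=> a a0 [xy yx]; exists a^-1; rewrite ?invr_gt0 // invrK. Qed.

Lemma proj_equiv_by_sym m n (A : 'M[R]_(1 + m, 1 + n)) B Q P :
  proj_equiv_by A B Q P -> proj_equiv_by B A P Q.
Proof.
case=> QP PQ; split=> [y /PQ[x Qx]|x /QP[y Py]] /proj_rel_sym.
  by exists x.
by exists y.
Qed.

Lemma proj_rel_fun m n (A : 'M[R]_(1 + m, 1 + n)) B x y y' :
  proj_rel A B x y -> proj_rel A B x y' -> y = y'.
Proof.
case=> a a0 [xy _] [b b0 [xy' _]]; rewrite xy in xy'.
have ab : a = b by have := congr1 (fun z => dot z (hmg0 R n)) xy'; rewrite !dotZl !hmg_dot0 !mulr1.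
by apply: hmg_inj; apply: (scalerI (lt0r_neq0 b0)); rewrite -xy' ab.
Qed.

Lemma proj_image_face m n (A : 'M[R]_(1 + m, 1 + n)) B Q P F :
  proj_equiv_by A B Q P -> face Q F -> face P (proj_image A B P F).
Proof.
case=> _ PQ /faceP[g g0 FE].
have dE x y a : hmg y *m B = a^-1 *: hmg x -> dot (hmg y) (B *m g) = a^-1 * dot (hmg x) g.
  by move=> yx; rewrite mulmxA yx dotZl.
apply/faceP; exists (B *m g) => [y /PQ[x Qx [a a0 [xy yx]]]|].
  by rewrite (dE _ _ _ yx) mulr_ge0 ?g0 // invr_ge0 ltW.
apply/seteqP; split=> y [Py].
  case=> x; rewrite FE => -[Qx /= xg] [a a0 [xy yx]]; split=> //=.
  by rewrite (dE _ _ _ yx) xg mulr0.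
have [x Qx [a a0 [xy yx]]] := PQ y Py.
rewrite /= (dE _ _ _ yx) => /eqP; rewrite mulf_eq0 invr_eq0 gt_eqF //= => /eqP xg.
by split=> //; exists x; [rewrite FE | exists a].
Qed.

Lemma proj_imageK m n (A : 'M[R]_(1 + m, 1 + n)) B Q P F :
  proj_equiv_by A B Q P -> F `<=` Q -> proj_image B A Q (proj_image A B P F) = F.
Proof.
move=> [QP PQ] FQ; apply/seteqP; split=> x.
  case=> Qx [y [Py [x' Fx' x'y]] /proj_rel_sym xy].
  by rewrite (proj_rel_fun (proj_rel_sym xy) (proj_rel_sym x'y)).
move=> Fx; have [y Py xy] := QP x (FQ x Fx); split; first exact: FQ.
by exists y; [split=> //; exists x | exact: proj_rel_sym].
Qed.

Lemma proj_image_mono m n (A : 'M[R]_(1 + m, 1 + n)) B P F G :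
  F `<=` G -> proj_image A B P F `<=` proj_image A B P G.
Proof. by move=> FG y [Py [x /FG Gx xy]]; split=> //; exists x. Qed.

Lemma proj_image_self m n (A : 'M[R]_(1 + m, 1 + n)) B Q P :
  proj_equiv_by A B Q P -> proj_image A B P Q = P.
Proof.
by case=> _ PQ; apply/seteqP; split=> [y []//|y Py]; split=> //; exact: PQ.
Qed.

Lemma proj_image_rank m n (A : 'M[R]_(1 + m, 1 + n)) B Q P F k :
  proj_equiv_by A B Q P -> F `<=` Q -> affine_rank F k ->
  affine_rank (proj_image A B P F) k.
Proof.
move=> QP FQ Fk; have [i Fi] := affine_rank_exists (proj_image A B P F).
suff -> : k = i by [].
apply/eqP; rewrite eqn_leq; apply/andP; split.
  apply: (affine_rank_le (B := B)) Fk Fi => x Fx.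
  have [y Py xy] := QP.1 x (FQ x Fx); have [a a0 [_ yx]] := xy.
  exists y, a; split; first by split=> //; exists x.
  by rewrite yx scalerA divff ?scale1r // gt_eqF.
apply: (affine_rank_le (B := A)) Fi Fk => y [Py [x Fx [a a0 [xy yx]]]].
by exists x, a^-1; split=> //; rewrite xy scalerA mulVf ?scale1r // gt_eqF.
Qed.

Lemma proj_equiv_rank m n (Q : set 'rV[R]_m) (P : set 'rV[R]_n) k :
  proj_equiv Q P -> affine_rank Q k -> affine_rank P k.
Proof.
case=> A [B QP] /(proj_image_rank QP (@subset_refl _ Q)).
by rewrite (proj_image_self QP).
Qed.

Lemma proj_equiv_comb m n (Q : set 'rV[R]_m) (P : set 'rV[R]_n) :
  proj_equiv Q P -> combinatorially_equivalent Q P.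
Proof.
case=> A [B QP]; have PQ := proj_equiv_by_sym QP.
exists (proj_image A B P); split; first split.
- by move=> F QF; exact: proj_image_face QP QF.
- move=> F G /set_mem /face_sub QF /set_mem /face_sub QG eqFG.
  by rewrite -(proj_imageK QP QF) eqFG (proj_imageK QP QG).
- move=> F PF; exists (proj_image B A Q F); first exact: proj_image_face PQ PF.
  exact: proj_imageK PQ (face_sub PF).
move=> F G /face_sub QF /face_sub QG; split; first exact: proj_image_mono.
move/(@proj_image_mono _ _ B A Q).
by rewrite (proj_imageK QP QF) (proj_imageK QP QG).
Qed.

Lemma proj_equiv_facets m n (Q : set 'rV[R]_m) (P : set 'rV[R]_n) :
  proj_equiv Q P -> facets P #= facets Q.
Proof.
case=> A [B QP]; have PQ := proj_equiv_by_sym QP.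
have facetI m' n' (A' : 'M[R]_(1 + m', 1 + n')) B' Q' P' F :
    proj_equiv_by A' B' Q' P' -> facets Q' F -> facets P' (proj_image A' B' P' F).
  move=> QP' [QF [k [Fk Qk]]]; split; first exact: proj_image_face QP' QF.
  exists k; split; first exact: proj_image_rank QP' (face_sub QF) Fk.
  by apply: proj_equiv_rank Qk; exists A', B'.
have -> : facets P = proj_image A B P @` facets Q.
  apply/seteqP; split=> [F PF|_ [F QF <-]]; last exact: facetI QP QF.
  exists (proj_image B A Q F); first exact: facetI PQ PF.
  exact: proj_imageK PQ (face_sub PF.1).
apply: inj_card_eq => F G /set_mem [/face_sub QF _] /set_mem [/face_sub QG _] eqFG.
by rewrite -(proj_imageK QP QF) eqFG (proj_imageK QP QG).
Qed.

Lemma affine_image_rank_le m n (Q : set 'rV[R]_m) (P : set 'rV[R]_n) f i j :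
  affine_map f -> f @` Q = P -> affine_rank P i -> affine_rank Q j -> (i <= j)%N.
Proof.
case/affine_map_hmg => A fA <-; apply: (@affine_rank_le _ _ _ _ A).
by move=> _ [x Qx <-]; exists x, 1; rewrite scale1r -fA.
Qed.

(** Equal ranks make [f] injective on the span of Q, and a pseudo-inverse provides the map back. *)
Lemma affine_image_proj_equiv m n (Q : set 'rV[R]_m) (P : set 'rV[R]_n) f r :
  affine_map f -> f @` Q = P -> affine_rank P r -> affine_rank Q r -> proj_equiv Q P.
Proof.
case/affine_map_hmg => A fA fQ /affine_rankP[p [Pp /eqP rp _]] /affine_rankP[q [Qq rq Qspan]].
have free : row_free (hmg_mx q *m A).
  rewrite /row_free eqn_leq rank_leq_row -[X in (X <= _)%N]rp; apply: mxrankS.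
  apply/row_subP => i; rewrite rowK; have := Pp i; rewrite -fQ => -[x Qx <-].
  by rewrite fA submxMr // Qspan.
pose B := pinvmx (hmg_mx q *m A) *m hmg_mx q.
have fB x : Q x -> proj_rel A B x (f x).
  move=> Qx; exists 1 => //; rewrite invr1 !scale1r -fA; split=> //.
  have /submxP[a aE] := Qspan x Qx.
  by rewrite fA aE /B mulmxA -(mulmxA a (hmg_mx q) A) mulmxKp.
exists A, B; split=> [x Qx|y]; first by exists (f x); [rewrite -fQ; exists x | exact: fB].
by rewrite -fQ => -[x Qx <-]; exists x => //; exact: fB.
Qed.

Lemma mulmx_col_dot k l (z : 'rV[R]_k) (S : 'M[R]_(k, l)) i : (z *m S) 0 i = dot z (col i S).
Proof. by rewrite [LHS]mxE [RHS]mxE; apply: eq_bigr => j _; rewrite [in RHS]mxE. Qed.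

(* A functional [g] separating [z] from the cone over [Q] is tilted about its
   zero set until this zero set becomes a facet. *)
Lemma facet_separation m (Q : set 'rV[R]_m) r (z : 'rV[R]_(1 + m)) (g : 'cV[R]_(1 + m))
    (p : 'I_r -> 'rV[R]_m) :
  polytope Q -> (forall i, Q (p i)) -> row_free (hmg_mx p) ->
  (forall x, Q x -> (hmg x <= hmg_mx p)%MS) -> (z <= hmg_mx p)%MS ->
  (forall x, Q x -> 0 <= dot (hmg x) g) -> dot z g < 0 ->
  exists2 F, facets Q F & forall h : 'cV[R]_(1 + m),
    (forall x, Q x -> 0 <= dot (hmg x) h) -> F = Q `&` [set x | dot (hmg x) h = 0] ->
    dot z h < 0.
Proof.
move=> Qpoly Qp free Qspan zp.
have Qr : affine_rank Q r by apply/affine_rankP; exists p.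
have kill l (V : 'M[R]_(1 + m, l)) : (forall x, Q x -> hmg x *m V = 0) -> hmg_mx p *m V = 0.
  by move=> V0; apply/row_matrixP => i; rewrite row_mul rowK row0 V0.
(* Induction on the corank of the zero set. The default of [xget] is not reached, since every set
   has an affine rank. *)
move: {2}_.+1 (ltnSn (r - xget 0%N [set j | affine_rank (Q `&` [set x | dot (hmg x) g = 0]) j])).
move=> N; elim: N g => // N IHN g; set F := Q `&` _.
have [j Fj] := affine_rank_exists F.
have -> : xget 0%N [set j | affine_rank F j] = j.
  by apply: xget_unique => // j' /affine_rank_unique; apply.
move=> ltN g0 zg.
have QF : face Q F by apply/faceP; exists g.
have FneqQ : F <> Q.
  move=> FQ; have := kill _ g; case/submxP: zp => a aE; rewrite aE in zg.
  move=> kg; move: zg; rewrite -mulmxA kg ?mulmx0 ?mxE ?ltxx // => x.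
  by rewrite -FQ => -[_ /= xg]; apply/matrixP => s t; rewrite !ord1 xg mxE.
have lt_jr : (j < r)%N by apply: face_rank_lt QF (face_sub QF) (@subset_refl _ Q) FneqQ Fj Qr.
have [q [Fq rq Fspan]] := (affine_rankP F j).1 Fj.
have [eq_jr|neq_jr] := eqVneq j.+1 r.
  exists F; first by split=> //; exists j; rewrite eq_jr.
  move=> h h0 FE.
  have [x0 Qx0 Fx0] : exists2 x, Q x & ~ F x.
    apply: contrapT => noF; apply: FneqQ; apply/seteqP; split=> [x []//|x Qx].
    by apply: contrapT => notF; apply: noF; exists x.
  have kerF (f : 'cV[R]_(1 + m)) : F = Q `&` [set x | dot (hmg x) f = 0] -> hmg_mx q *m f = 0.
    move=> Ff; apply/row_matrixP => i; rewrite row_mul rowK row0.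
    have := Fq i; rewrite Ff => -[_ /= qf]; apply/matrixP => s t.
    by rewrite !ord1 qf mxE.
  have pos (f : 'cV[R]_(1 + m)) : (forall x, Q x -> 0 <= dot (hmg x) f) ->
      F = Q `&` [set x | dot (hmg x) f = 0] -> 0 < dot (hmg x0) f.
    move=> f0 Ff; rewrite lt_neqAle f0 // andbT eq_sym; apply/eqP => xf.
    by apply: Fx0; rewrite Ff.
  have x0q : ~~ (hmg x0 <= hmg_mx q)%MS.
    apply/negP => /submxP[a aE]; have := pos g g0 erefl.
    by rewrite aE -mulmxA kerF // mulmx0 mxE ltxx.
  have span : (hmg_mx p <= hmg_mx q + hmg x0)%MS.
    have sub : (hmg_mx q + hmg x0 <= hmg_mx p)%MS.
      rewrite addsmx_sub Qspan // andbT; apply/row_subP => i; rewrite rowK.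
      by apply: Qspan; have [] := Fq i.
    rewrite -(geq_leqif (mxrank_leqif_sup sub)) (eqP free) -eq_jr.
    suff : (\rank (hmg_mx q) < \rank (hmg_mx q + hmg x0)%MS)%N by rewrite (eqP rq).
    apply: rank_ltmx; rewrite ltmxE addsmxSl /=.
    by apply: contra x0q; apply: submx_trans; exact: addsmxSr.
  have /sub_addsmxP[[a b] /= zE] := submx_trans zp span.
  (* Q is spanned by F and [x0], so every functional that exposes F takes at z the value [b] times
     its positive value at [x0]: the sign at z is the same for all of them. *)
  have zf (f : 'cV[R]_(1 + m)) : F = Q `&` [set x | dot (hmg x) f = 0] ->
      dot z f = b 0 0 * dot (hmg x0) f.
    move=> Ff; rewrite zE dotDl -mulmxA kerF // mulmx0 mxE add0r.
    by rewrite -mulmxA [LHS]mxE big_ord1.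
  rewrite zf // pmulr_llt0 ?pos //.
  by move: zg; rewrite zf // pmulr_llt0 // pos.
have lt_r : (j.+1 < r)%N by rewrite ltn_neqAle neq_jr.
(* Its rank is at most j + 1 < r, which leaves a functional that vanishes on F and at z but not on
   Q: tilting by it keeps the value at z. *)
pose V := (hmg_mx q + z)%MS.
have rV : (\rank V < r)%N.
  apply: leq_ltn_trans lt_r; apply: leq_trans (mxrank_adds_leqif _ _).1 _.
  by rewrite (eqP rq) -[in X in (_ <= X)%N]addn1 leq_add2l rank_leq_row.
have [h [Vh ph]] : exists h : 'cV[R]_(1 + m), V *m h = 0 /\ hmg_mx p *m h <> 0.
  apply: contrapT => /forallNP noh.
  suff /mxrankS : (hmg_mx p <= V)%MS by rewrite (eqP free) leqNgt rV.
  rewrite submxE; apply/eqP; move: (cokermx V) (mulmx_coker V) => K VK; apply/matrixP => s t.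
  have := noh (col t K); rewrite colE !mulmxA VK mul0mx -colE => /not_andP[[]//|].
  by move/contrapT => /matrixP /(_ s 0); rewrite !mxE.
have qh : hmg_mx q *m h = 0.
  by have /submxP[D ->] := addsmxSl (hmg_mx q) z; rewrite -mulmxA Vh mulmx0.
have zh : dot z h = 0.
  by have /submxP[D ->] := addsmxSr (hmg_mx q) z; rewrite -mulmxA Vh mulmx0 mxE.
have {ph} [h' [qh' zh' [x0 Qx0 x0h']]] : exists h' : 'cV[R]_(1 + m),
    [/\ hmg_mx q *m h' = 0, dot z h' = 0 & exists2 x, Q x & dot (hmg x) h' < 0].
  have [x Qx xh] : exists2 x, Q x & dot (hmg x) h != 0.
    apply: contrapT => nox; apply: ph; apply: kill => x Qx.
    apply/matrixP => s t; rewrite !ord1 [RHS]mxE; apply: contrapT => /eqP xh.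
    by apply: nox; exists x.
  have [lt0|gt0|/eqP] := ltgtP (dot (hmg x) h) 0; last by rewrite (negPf xh).
    by exists h; split=> //; exists x.
  exists (- h); split; first by rewrite mulmxN qh oppr0.
    by rewrite dotNr zh oppr0.
  by exists x => //; rewrite dotNr oppr_lt0.
have [M [v QE]] := polytopeP Qpoly.
have Qv i : Q (v i) by rewrite QE; exact: hull_mem.
have [i0 i0h'] : exists i, dot (hmg (v i)) h' < 0.
  apply: contrapT => /forallNP noi; move: x0h'; apply/negP; rewrite -leNgt.
  move: Qx0; rewrite QE; apply: hull_dot_ge0 => i; rewrite leNgt; exact/negP.
(* The least ratio is the largest multiple of [h'] that can be added to [g] with all generators
   staying nonnegative. The generator [v i1] that attains it joins the zero set. *)
pose ratio i := dot (hmg (v i)) g / - dot (hmg (v i)) h'.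
case: (@Order.TotalTheory.arg_minP _ _ _ i0 (fun i => dot (hmg (v i)) h' < 0) ratio i0h') => i1 i1h' i1min.
pose g' := g + ratio i1 *: h'.
have g'E (x : 'rV_(1 + m)) : dot x g' = dot x g + ratio i1 * dot x h'.
  by rewrite /g' dotDr dotZr.
have r0 : 0 <= ratio i1 by rewrite divr_ge0 ?g0 // oppr_ge0 ltW.
have g'0 x : Q x -> 0 <= dot (hmg x) g'.
  rewrite QE; apply: hull_dot_ge0 => i; rewrite g'E.
  have [h0|hneg] := leP 0 (dot (hmg (v i)) h').
    by rewrite addr_ge0 ?g0 // mulr_ge0.
  rewrite -[_ * _]opprK -mulrN subr_ge0 -ler_pdivlMr ?oppr_gt0 //; exact: i1min.
have FF' : F `<=` Q `&` [set x | dot (hmg x) g' = 0].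
  move=> x Fx; have [Qx /= xg] := Fx; split=> //=; rewrite g'E xg add0r.
  by have /submxP[a ->] := Fspan x Fx; rewrite -mulmxA qh' mulmx0 mxE mulr0.
have F'i1 : (Q `&` [set x | dot (hmg x) g' = 0]) (v i1).
  split=> //=; rewrite g'E /ratio invrN mulrN mulNr divfK ?subrr // lt_eqF //.
apply: (IHN g') => //; last by rewrite g'E zh' mulr0 addr0.
have [j' F'j'] := affine_rank_exists (Q `&` [set x | dot (hmg x) g' = 0]).
rewrite (_ : xget _ _ = j'); last first.
  by apply: xget_unique => // j'' /affine_rank_unique; apply.
have lt_jj' : (j < j')%N.
  apply: face_rank_lt QF FF' _ _ Fj F'j'; first by move=> x [].
  move=> eqF; move: F'i1; rewrite -eqF => /Fspan /submxP[a aE].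
  by move: i1h'; rewrite aE -mulmxA qh' mulmx0 mxE ltxx.
by move: ltN lt_jj' lt_jr; clear; lia.
Qed.

(** [U] spans the cone over Q and [S] evaluates functionals that expose the facets. A vector of the
    span outside the cone is separated by Farkas, hence violates a facet inequality by
    [facet_separation]. *)
Lemma slack_form m (Q : set 'rV[R]_m) k r :
  polytope Q -> Q !=set0 -> facets Q #= `I_k -> affine_rank Q r ->
  exists (U : 'M[R]_(r, 1 + m)) (S : 'M[R]_(1 + m, k)),
  [/\ forall x, Q x -> (hmg x <= U)%MS,
      forall x i, Q x -> 0 <= (hmg x *m S) 0 i,
      forall z : 'rV[R]_(1 + m), (z <= U)%MS -> (forall i, 0 <= (z *m S) 0 i) ->
        exists (t : R) x, [/\ 0 <= t, Q x & z = t *: hmg x],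
      forall i, exists2 x, Q x & 0 < (hmg x *m S) 0 i
    & row_free U].
Proof.
move=> Qpoly [x0 Qx0] Qk Qr.
have [p [Qp free Qspan]] := (affine_rankP Q r).1 Qr.
have [e e_inj eQ] := card_ordP Qk.
have facet_e i : facets Q (e i) by rewrite -eQ; exists i.
have ex i : exists g : 'cV[R]_(1 + m), (forall x, Q x -> 0 <= dot (hmg x) g) /\
    e i = Q `&` [set x | dot (hmg x) g = 0].
  by have [/faceP[g g0 gE] _] := facet_e i; exists g.
pose g i := projT1 (cid (ex i)).
have g0 i x : Q x -> 0 <= dot (hmg x) (g i) by exact: (projT2 (cid (ex i))).1.
have gE i : e i = Q `&` [set x | dot (hmg x) (g i) = 0] by exact: (projT2 (cid (ex i))).2.
pose S := \matrix_(l, i) g i l 0 : 'M[R]_(1 + m, k).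
have SE (z : 'rV[R]_(1 + m)) i : (z *m S) 0 i = dot z (g i).
  by rewrite mulmx_col_dot; congr (fun_of_matrix (_ *m _) _ _); apply/colP => l; rewrite !mxE.
exists (hmg_mx p), S; split=> //.
- by move=> x i Qx; rewrite SE g0.
- move=> z zp z0; have [M [v QE]] := polytopeP Qpoly.
  have Qv i : Q (v i) by rewrite QE; exact: hull_mem.
  case: (Farkas (fun i => hmg (v i)) z) => [[a [a0 zE]]|[h [h0 zh]]].
    have [s0|s_neq0] := eqVneq (\sum_i a i) 0.
      (* Nonnegative weights of sum 0 all vanish, so [z] is 0 and any point of Q serves. *)
      exists 0, x0; split=> //; rewrite scale0r zE big1 // => i _.
      move/eqP: s0; rewrite psumr_eq0 => // /allP /(_ i (mem_index_enum _)) /eqP ->.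
      by rewrite scale0r.
    have s_gt0 : 0 < \sum_i a i by rewrite lt_neqAle eq_sym s_neq0 sumr_ge0.
    exists (\sum_i a i), (\sum_i (a i / \sum_i a i) *: v i); split; first exact: ltW.
      rewrite QE; exists (fun i => a i / \sum_i a i) => [i|].
        by rewrite divr_ge0 // ltW.
      by rewrite hmg_sum // -mulr_suml divff.
    rewrite hmg_sum -?mulr_suml ?divff // zE scaler_sumr; apply: eq_bigr => i _.
    by rewrite scalerA mulrCA divff // mulr1.
  have Qh x : Q x -> 0 <= dot (hmg x) h by rewrite QE; exact: hull_dot_ge0.
  have [F QF Fneg] := facet_separation Qpoly Qp free Qspan zp Qh zh.
  have [i _ eF] : range e F by rewrite eQ.
  by have := Fneg (g i) (g0 i); rewrite -gE => /(_ (esym eF)); rewrite -SE ltNge z0.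
(* A facet inequality that is tight on all of Q would make the facet equal to Q, against its
   rank. *)
- move=> i; apply: contrapT => noi.
  have eQi : e i = Q.
    rewrite gE; apply/seteqP; split=> [x []//|x Qx]; split=> //=.
    apply/eqP; rewrite eq_le g0 // andbT leNgt; apply/negP => gt0.
    by apply: noi; exists x; rewrite ?SE.
  have [_ [j [ej Qj]]] := facet_e i; rewrite eQi in ej.
  by have := affine_rank_unique ej Qj => /eqP; rewrite eqn_leq ltnn andbF.
Qed.

End ProjectiveEquivalenceAndSlackForm.

(** * Cones cut from the orthant by one equation, and their extreme rays *)

Section SlackCones.
Variable R : realType.
Local Notation dot x g := ((x *m g) 0 0).

Section Slack.
Variable k : nat.
Implicit Types (c l g : 'cV[R]_k) (y u : 'rV[R]_k).

Definition nneg y : Prop := forall i, 0 <= y 0 i.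

Definition slack_set c l : set 'rV[R]_k :=
  [set y | [/\ nneg y, dot y c = 0 & dot y l = 1]].

(* The first condition makes the section by [l = 1] bounded, and the last one
   makes every coordinate define a proper face. *)
Definition rep c l n (M : 'M[R]_(k, n)) (P : set 'rV[R]_n) : Prop :=
  [/\ forall y, nneg y -> dot y c = 0 -> y != 0 -> 0 < dot y l,
      P = [set y *m M | y in slack_set c l]
    & exists y, (forall i, 0 < y 0 i) /\ dot y c = 0].

Lemma nnegZ a y : 0 <= a -> nneg y -> nneg (a *: y).
Proof. by move=> a0 y0 i; rewrite mxE mulr_ge0. Qed.

Lemma row_neq0 y : y != 0 -> exists i, y 0 i != 0.
Proof.
move=> /eqP y0; apply: contrapT => /forallNP h; apply: y0.
by apply/rowP => i; rewrite mxE; apply: contrapT => /eqP; exact: h.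
Qed.

Lemma hmg_row_mx n (M : 'M[R]_(k, n)) l y : dot y l = 1 -> hmg (y *m M) = y *m row_mx l M.
Proof.
move=> yl; rewrite mul_mx_row /hmg; congr row_mx.
by apply/matrixP => i j; rewrite !ord1 yl mxE.
Qed.

Lemma dot_hmg0_row_mx n (M : 'M[R]_(k, n)) l y : dot (y *m row_mx l M) (hmg0 R n) = dot y l.
Proof. by rewrite mul_mx_row mul_row_col mulmx1 mulmx0 addr0. Qed.

(* The extreme rays of the cone over [slack_set c l] are indexed by the zeros
   of [c], as diagonal pairs, and by the pairs of a positive and a negative
   coordinate of [c]. *)
Definition ray_index c : {set 'I_k * 'I_k} :=
  [set p | (c p.1 0 == 0) && (p.1 == p.2) || (0 < c p.1 0) && (c p.2 0 < 0)].

Definition ray c (p : 'I_k * 'I_k) : 'rV[R]_k :=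
  if c p.1 0 == 0 then delta_mx 0 p.1
  else - c p.2 0 *: delta_mx 0 p.1 + c p.1 0 *: delta_mx 0 p.2.

Lemma rayE c p i : ray c p 0 i =
  if c p.1 0 == 0 then (i == p.1)%:R else - c p.2 0 * (i == p.1)%:R + c p.1 0 * (i == p.2)%:R.
Proof. by rewrite /ray; case: ifP => _; rewrite !mxE. Qed.

Lemma dot_delta i g : dot (delta_mx 0 i : 'rV_k) g = g i 0.
Proof. by rewrite -rowE mxE. Qed.

Lemma ray_nneg c p : p \in ray_index c -> nneg (ray c p).
Proof.
rewrite inE => /orP[/andP[c0 _]|/andP[c1 c2]] i; rewrite rayE.
  by rewrite c0 ler0n.
by rewrite gt_eqF // addr_ge0 // mulr_ge0 ?ler0n // ?oppr_ge0 ltW.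
Qed.

Lemma ray_supp c p i : p \in ray_index c -> (0 < ray c p 0 i) = (i == p.1) || (i == p.2).
Proof.
rewrite inE => /orP[/andP[c0 /eqP <-]|/andP[c1 c2]]; rewrite rayE.
  by rewrite c0 orbb; case: eqP; rewrite ?ltr01 ?ltxx.
rewrite gt_eqF //; have [->|ne1] := eqVneq i p.1; have [e2|ne2] := eqVneq _ p.2 => //=.
- by move: c1 c2; rewrite e2 => c1 /lt_trans /(_ c1); rewrite ltxx.
- by rewrite mulr1 mulr0 addr0 oppr_gt0.
- by rewrite mulr0 mulr1 add0r.
- by rewrite !mulr0 addr0 ltxx.
Qed.

Lemma ray_eq0 c p i : p \in ray_index c -> (ray c p 0 i == 0) = (i != p.1) && (i != p.2).
Proof.
move=> pI; rewrite -negb_or -(ray_supp _ pI).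
by rewrite lt_neqAle (ray_nneg pI) andbT negbK eq_sym.
Qed.

Lemma ray_dot c p : p \in ray_index c -> dot (ray c p) c = 0.
Proof.
rewrite inE /ray => /orP[/andP[c0 _]|/andP[c1 c2]].
  by rewrite c0 dot_delta (eqP c0).
by rewrite gt_eqF // dotDl !dotZl !dot_delta mulNr mulrC addNr.
Qed.

Lemma ray_neq0 c p : p \in ray_index c -> ray c p != 0.
Proof.
move=> pI; apply/eqP => /rowP /(_ p.1); rewrite [RHS]mxE => /eqP.
by rewrite ray_eq0 // eqxx.
Qed.

(** The supports of distinct rays are incomparable: each is a single zero of [c], or one positive
    and one negative coordinate. *)
Lemma ray_inj c p q : p \in ray_index c -> q \in ray_index c ->
  (forall i, ray c p 0 i = 0 -> ray c q 0 i = 0) -> p = q.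
Proof.
move=> pI qI sub.
have q1 : (q.1 == p.1) || (q.1 == p.2).
  apply: contraT; rewrite negb_or -(ray_eq0 _ pI) => /eqP /sub /eqP.
  by rewrite ray_eq0 // eqxx.
have q2 : (q.2 == p.1) || (q.2 == p.2).
  apply: contraT; rewrite negb_or -(ray_eq0 _ pI) => /eqP /sub /eqP.
  by rewrite ray_eq0 // eqxx andbF.
move: pI qI q1 q2; case: p q {sub} => [p1 p2] [q1 q2]; rewrite !inE /=.
case/orP=> [/andP[c0 /eqP <-]|/andP[cp cn]].
  rewrite !orbb => /orP[/andP[_ /eqP <-] /eqP <- //|/andP[cp _] /eqP q1E].
  by rewrite q1E (eqP c0) ltxx in cp.
case/orP=> [/andP[c0 /eqP <-]|/andP[cp' cn']].
  by case/orP=> /eqP q1E; rewrite q1E in c0; [rewrite gt_eqF in c0 | rewrite lt_eqF in c0].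
move=> /orP[/eqP ->|/eqP q1E]; last by rewrite q1E ltNge ltW in cp'.
by move=> /orP[/eqP q2E|/eqP -> //]; rewrite q2E ltNge ltW in cn'.
Qed.

(** Extremality of the ray: on its support the equation [c] leaves a single degree of freedom. *)
Lemma ray_multiple c p y : p \in ray_index c -> dot y c = 0 ->
  (forall i, ray c p 0 i = 0 -> y 0 i = 0) -> exists t, y = t *: ray c p.
Proof.
move=> pI yc y0.
exists (y 0 p.1 / ray c p 0 p.1).
have r1 : ray c p 0 p.1 != 0 by rewrite ray_eq0 // eqxx.
set z := y - (y 0 p.1 / ray c p 0 p.1) *: ray c p.
suff /eqP : z = 0 by rewrite subr_eq0 => /eqP.
have zE i : z 0 i = y 0 i - y 0 p.1 / ray c p 0 p.1 * ray c p 0 i by rewrite 3!mxE.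
have z1 : z 0 p.1 = 0 by rewrite zE divfK // subrr.
have zc : dot z c = 0 by rewrite dotBl dotZl yc ray_dot // mulr0 subrr.
have z0 i : i != p.2 -> z 0 i = 0.
  move=> ne2; have [->//|ne1] := eqVneq i p.1.
  have /eqP r0 : ray c p 0 i == 0 by rewrite ray_eq0 // ne1.
  by rewrite zE r0 y0 // mulr0 subrr.
have z2 : z 0 p.2 = 0.
  have [<-//|ne12] := eqVneq p.1 p.2.
  move: zc; rewrite dotE (bigD1 p.2) //= big1 => [/eqP|i /z0 ->]; last by rewrite mul0r.
  rewrite addr0 mulf_eq0 => /orP[/eqP//|/eqP c2]; move: pI.
  by rewrite inE c2 ltxx andbF orbF (negPf ne12) andbF.
by apply/rowP => i; rewrite [RHS]mxE; have [->//|/z0] := eqVneq i p.2.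
Qed.

Lemma sum_ray_index c (V : nmodType) (F : 'I_k * 'I_k -> V) :
  \sum_(p in ray_index c) F p =
  \sum_(i | c i 0 == 0) F (i, i) + \sum_(i | 0 < c i 0) \sum_(j | c j 0 < 0) F (i, j).
Proof.
transitivity (\sum_i \sum_(j | (i, j) \in ray_index c) F (i, j)).
  by rewrite pair_big_dep /=; apply: eq_big => [[i j]|[i j] _] //=.
rewrite [X in X + _]big_mkcond [X in _ + X]big_mkcond -big_split /=.
apply: eq_bigr => i _; case: ifP => ci.
  rewrite (eqP ci) ltxx addr0 (big_pred1 i) // => j.
  by rewrite inE /= ci (eqP ci) ltxx orbF eq_sym.
rewrite add0r; case: ifP => ci'; last by rewrite big_pred0 // => j; rewrite inE /= ci ci'.
by apply: eq_bigl => j; rewrite inE /= ci ci'.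
Qed.

Definition zset c : {set 'I_k} := [set i | c i 0 == 0].
Definition pset c : {set 'I_k} := [set i | 0 < c i 0].
Definition nset c : {set 'I_k} := [set i | c i 0 < 0].

Lemma card_ray_index c : #|ray_index c| = (#|zset c| + #|pset c| * #|nset c|)%N.
Proof.
rewrite -sum1_card sum_ray_index; congr addn.
  by rewrite sum1_card cardsE.
transitivity (\sum_(i in pset c) #|nset c|)%N.
  by apply: eq_big => [i|i _]; rewrite ?inE // sum1_card cardsE.
by rewrite sum_nat_const.
Qed.

Lemma card_signs c :
  (#|zset c| + #|pset c| + #|nset c| = k)%N.
Proof.
rewrite -[RHS]card_ord -[RHS]sum1_card -!sum1_card.
rewrite [X in (X + _ + _)%N]big_mkcond [X in (_ + X + _)%N]big_mkcond [X in (_ + X)%N]big_mkcond -!big_split /=.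
by apply: eq_bigr => i _; rewrite !inE; case: ltgtP.
Qed.

(** The equation says that the positive and the negative part of [c] have the same mass [s] on y.
    The product weights [y i * y j / s] form a transport plan between these two parts. *)
Lemma ray_decomposition c y : nneg y -> dot y c = 0 ->
  exists2 a : 'I_k * 'I_k -> R, (forall p, 0 <= a p) & y = \sum_(p in ray_index c) a p *: ray c p.
Proof.
move=> y0 yc; pose s := \sum_(i | 0 < c i 0) c i 0 * y 0 i.
have sE : s = \sum_(j | c j 0 < 0) - c j 0 * y 0 j.
  move/eqP: yc; rewrite dotE (bigID (fun i => 0 < c i 0)) /= addr_eq0 => /eqP yc.
  rewrite /s (eq_bigr (fun i => y 0 i * c i 0)) => [|i _]; last exact: mulrC.
  rewrite yc -sumrN (bigID (fun i => c i 0 < 0)) /= [X in _ + X]big1 ?addr0.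
    apply: eq_big => [i|i _]; last by rewrite mulrC mulNr.
    by rewrite -leNgt; apply/andb_idl; exact: ltW.
  by move=> i; rewrite -!leNgt -eq_le => /eqP->; rewrite mulr0 oppr0.
have s0 : 0 <= s by apply: sumr_ge0 => i /ltW ci; rewrite mulr_ge0.
pose a (p : 'I_k * 'I_k) := if c p.1 0 == 0 then y 0 p.1 else y 0 p.1 * y 0 p.2 / s.
exists a => [p|]; first by rewrite /a; case: ifP => _; rewrite ?mulr_ge0 ?invr_ge0.
apply/rowP => m; rewrite summxE sum_ray_index.
have aray i j : 0 < c i 0 -> c j 0 < 0 -> (a (i, j) *: ray c (i, j)) 0 m =
    y 0 i * y 0 j / s * (- c j 0 * (m == i)%:R + c i 0 * (m == j)%:R).
  by move=> ci cj; rewrite mxE rayE /a /= gt_eqF.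
have aray0 i : c i 0 == 0 -> (a (i, i) *: ray c (i, i)) 0 m = y 0 i * (m == i)%:R.
  by move=> ci; rewrite mxE rayE /a /= ci.
rewrite (eq_bigr _ (fun i ci => aray0 i ci)).
rewrite [X in _ + X](eq_bigr (fun i => \sum_(j | c j 0 < 0) y 0 i * y 0 j / s *
    (- c j 0 * (m == i)%:R + c i 0 * (m == j)%:R))) => [|i ci]; last first.
  by apply: eq_bigr => j cj; exact: aray.
(* For s = 0 the quotients are 0 by convention, which is the right value because y then vanishes
   outside the zeros of [c]. *)
have ssum0 i : s = 0 -> c i 0 != 0 -> y 0 i = 0.
  move=> s_eq0; case: ltgtP => // [ci|ci] _.
    move/eqP: s_eq0; rewrite sE psumr_eq0 => [|j /ltW cj]; last by rewrite mulr_ge0 // oppr_ge0.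
    move=> /allP /(_ i (mem_index_enum _)); rewrite ci /= mulf_eq0 oppr_eq0 (lt_eqF ci) /=.
    by move/eqP.
  move/eqP: s_eq0; rewrite psumr_eq0 => [|j /ltW cj]; last by rewrite mulr_ge0.
  move=> /allP /(_ i (mem_index_enum _)); rewrite ci /= mulf_eq0 (gt_eqF ci) /=.
  by move/eqP.
have [cm|cm|cm] := ltgtP (c m 0) 0.
- rewrite big1 ?add0r => [|i /eqP ci]; last first.
    by rewrite (_ : m == i = false) ?mulr0 //; apply: contraTF cm => /eqP->; rewrite ci ltxx.
  rewrite (eq_bigr (fun i => c i 0 * y 0 i * (y 0 m / s))) => [|i ci].
    rewrite -mulr_suml -/s; have [s_eq0|sn0] := eqVneq s 0; last by rewrite mulrCA divff ?mulr1.
    by rewrite s_eq0 mul0r ssum0 // lt_eqF.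
  rewrite (bigD1 m) //= eqxx big1 => [|j /andP[cj jm]].
    rewrite (_ : m == i = false) ?mulr0 ?mulr1 ?add0r ?addr0; first by ring.
    by apply: contraTF cm => /eqP->; rewrite -leNgt ltW.
  rewrite [m == j]eq_sym (negPf jm) (_ : m == i = false) ?mulr0 ?add0r ?mulr0 //.
  by apply: contraTF cm => /eqP->; rewrite -leNgt ltW.
- rewrite big1 ?add0r => [|i /eqP ci]; last first.
    by rewrite (_ : m == i = false) ?mulr0 //; apply: contraTF cm => /eqP->; rewrite ci ltxx.
  rewrite (bigD1 m) //= [X in _ + X]big1 ?addr0 => [|i /andP[ci im]]; last first.
    apply: big1 => j cj; rewrite [m == i]eq_sym (negPf im) (_ : m == j = false) ?mulr0 ?addr0 ?mulr0 //.
    by apply: contraTF cm => /eqP->; rewrite -leNgt ltW.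
  rewrite (eq_bigr (fun j => - c j 0 * y 0 j * (y 0 m / s))) => [|j cj].
    rewrite -mulr_suml -sE; have [s_eq0|sn0] := eqVneq s 0; last by rewrite mulrCA divff ?mulr1.
    by rewrite s_eq0 mul0r ssum0 // gt_eqF.
  rewrite eqxx (_ : m == j = false) ?mulr0 ?addr0 ?mulr1; first by ring.
  by apply: contraTF cm => /eqP->; rewrite -leNgt ltW.
- rewrite (bigD1 m) /= ?cm ?eqxx // mulr1 big1 ?addr0 => [|i /andP[_ im]]; last first.
    by rewrite eq_sym (negPf im) mulr0.
  rewrite big1 ?addr0 // => i ci; apply: big1 => j cj.
  have -> : (m == i) = false by apply: contraTF ci => /eqP<-; rewrite cm ltxx.
  have -> : (m == j) = false by apply: contraTF cj => /eqP<-; rewrite cm ltxx.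
  by rewrite !mulr0 addr0 mulr0.
Qed.

(** Used to move into the interior of the orthant. The multiple exceeds every [|y i| / y0 i]; a
    quotient by 0 counts as 0. *)
Lemma positive_shift (y0 y : 'rV[R]_k) : nneg y0 -> (forall i, y0 0 i = 0 -> 0 < y 0 i) ->
  exists t : R, forall i, 0 < (y + t *: y0) 0 i.
Proof.
move=> y0n yp; exists (1 + \sum_i `|y 0 i| / y0 0 i) => i; rewrite 2!mxE.
have [y0i|y0i] := eqVneq (y0 0 i) 0; first by rewrite y0i mulr0 addr0 yp.
have y0p : 0 < y0 0 i by rewrite lt_neqAle eq_sym y0i y0n.
have : - y 0 i < (1 + \sum_j `|y 0 j| / y0 0 j) * y0 0 i; last by rewrite -subr_gt0 opprK addrC.
rewrite -ltr_pdivrMr // (bigD1 i) //= addrCA ltr_pwDr //.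
  by rewrite ltr_pwDl ?ltr01 ?sumr_ge0 // => j _; rewrite divr_ge0.
by rewrite ler_pM2r ?invr_gt0 // -normrN ler_norm.
Qed.

Definition ray_type c := {p : 'I_k * 'I_k | p \in ray_index c}.

Lemma card_ray_type c : #|{: ray_type c}| = #|ray_index c|.
Proof. by rewrite card_sig; apply: eq_card => p; rewrite !inE. Qed.

Section Rep.
Variables (c l : 'cV[R]_k) (n : nat) (M : 'M[R]_(k, n)) (P : set 'rV[R]_n).
Hypothesis P_rep : rep c l M P.

Definition nray (p : ray_type c) : 'rV[R]_k := (dot (ray c (val p)) l)^-1 *: ray c (val p).

Lemma ray_l_gt0 (p : ray_type c) : 0 < dot (ray c (val p)) l.
Proof.
have [pos _ _] := P_rep; apply: pos.
- exact: ray_nneg (valP p).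
- exact: ray_dot (valP p).
- exact: ray_neq0 (valP p).
Qed.

Lemma nray_slack p : slack_set c l (nray p).
Proof.
split.
- by apply: nnegZ; [rewrite invr_ge0 ltW ?ray_l_gt0 | exact: ray_nneg (valP p)].
- by rewrite dotZl ray_dot ?mulr0 // (valP p).
- by rewrite dotZl mulVf // gt_eqF // ray_l_gt0.
Qed.

Lemma nray_eq0 p i : (nray p 0 i == 0) = (ray c (val p) 0 i == 0).
Proof. by rewrite mxE mulf_eq0 invr_eq0 gt_eqF ?ray_l_gt0. Qed.

Lemma slack_nray y : slack_set c l y -> exists2 a : ray_type c -> R,
  (forall p, 0 <= a p) & \sum_p a p = 1 /\ y = \sum_p a p *: nray p.
Proof.
move=> [y0 yc yl]; have [a a0 yE] := ray_decomposition y0 yc.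
pose b (p : ray_type c) := a (val p) * dot (ray c (val p)) l.
have yb : y = \sum_p b p *: nray p.
  rewrite {1}yE (reindex_omap (val : ray_type c -> _) insub) /= => [|p pI]; last first.
    by rewrite insubT.
  apply: eq_big => [p|p _]; first by rewrite (valP p) valK eqxx.
  by rewrite /nray scalerA mulfK // gt_eqF // ray_l_gt0.
exists b => [p|]; first by rewrite mulr_ge0 // ltW // ray_l_gt0.
split=> //; rewrite -yl {1}yb dot_suml; apply: eq_bigr => p _.
by have [_ _ pl] := nray_slack p; rewrite dotZl pl mulr1.
Qed.

Lemma rep_hull : P = hull (fun p => nray p *m M).
Proof.
have [_ -> _] := P_rep; apply/seteqP; split=> [_ [y yS <-]|x [a a0 xE]].
  have [a a0 [a1 yE]] := slack_nray yS; exists a => //.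
  rewrite -hmg_sum //; congr hmg; rewrite yE mulmx_suml.
  by apply: eq_bigr => p _; rewrite -scalemxAl.
have [a1 xE'] := hull_weights xE.
exists (\sum_p a p *: nray p); last first.
  by rewrite xE' mulmx_suml; apply: eq_bigr => p _; rewrite -scalemxAl.
split.
- move=> i; rewrite summxE; apply: sumr_ge0 => p _; have [p0 _ _] := nray_slack p.
  by rewrite mxE mulr_ge0.
- rewrite dot_suml big1 // => p _; have [_ pc _] := nray_slack p.
  by rewrite dotZl pc mulr0.
- rewrite dot_suml -[RHS]a1; apply: eq_bigr => p _; have [_ _ pl] := nray_slack p.
  by rewrite dotZl pl mulr1.
Qed.

Lemma rep_polytope : polytope P.
Proof. by rewrite rep_hull; exact: polytope_hull. Qed.

Lemma rep_vertices : vertices P `<=` range (fun p => nray p *m M).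
Proof. by rewrite [X in vertices X]rep_hull; exact: vertices_hull. Qed.

Lemma rep_card_vertices N : vertices P #= `I_N -> (N <= #|ray_index c|)%N.
Proof.
move=> PN; have [j le_j Pj] := card_sub_range rep_vertices.
by rewrite (card_unique PN Pj) -card_ray_type.
Qed.

(** Adding a large multiple of the positive point makes any vector of the kernel of [c] nonnegative,
    so the cone spans the whole kernel. *)
Lemma rep_rank : affine_rank P (\rank (kermx c *m row_mx l M)).
Proof.
have [pos PE [y0 [y0p y0c]]] := P_rep; apply: affine_rank_span => [x|q V V0].
  rewrite PE => -[y [_ yc yl] <-]; rewrite (hmg_row_mx M yl); apply: submxMr.
  by apply/sub_kermxP; apply/matrixP => i j; rewrite !ord1 yc mxE.
have nnegV y : nneg y -> dot y c = 0 -> y *m row_mx l M *m V = 0.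
  move=> yn yc; have [->|yneq0] := eqVneq y 0; first by rewrite !mul0mx.
  have yl := pos y yn yc yneq0.
  have yl1 : dot ((dot y l)^-1 *: y) l = 1 by rewrite dotZl mulVf // gt_eqF.
  have /V0 : P (((dot y l)^-1 *: y) *m M).
    rewrite PE; exists ((dot y l)^-1 *: y) => //; split=> //; last by rewrite dotZl yc mulr0.
    by apply: nnegZ => //; rewrite invr_ge0 ltW.
  rewrite (hmg_row_mx M yl1) -!scalemxAl => /eqP.
  by rewrite scaler_eq0 invr_eq0 gt_eqF //= => /eqP.
apply/row_matrixP => i; rewrite -mulmxA row_mul row0 mulmxA.
set y := row i _.
have yc : dot y c = 0.
  by have /sub_kermxP -> := row_sub i (kermx c); rewrite mxE.
have [||t yt] := @positive_shift y0 y; [by move=> j; apply: ltW | by move=> j yj0; have := y0p j; rewrite yj0 ltxx |].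
have -> : y = (y + t *: y0) - t *: y0 by rewrite addrK.
rewrite !mulmxBl nnegV => [||]; first 1 last.
- by move=> j; apply: ltW.
- by rewrite dotDl dotZl yc y0c mulr0 addr0.
by rewrite -!scalemxAl nnegV ?scaler0 ?subr0 // => j; apply: ltW.
Qed.

End Rep.
End Slack.

End SlackCones.

(** * Representations: existence, change of coordinates, and faces of the projection *)

Section SlackRepresentations.
Variable R : realType.
Local Notation dot x g := ((x *m g) 0 0).

Lemma dot_delta_r k (y : 'rV[R]_k) i : dot y (delta_mx i 0 : 'cV_k) = y 0 i.
Proof. by rewrite -colE mxE. Qed.

Lemma sub_kermx_dot k (c : 'cV[R]_k) (y : 'rV[R]_k) : (y <= kermx c)%MS <-> dot y c = 0.
Proof.
split=> [/sub_kermxP ->|yc]; first by rewrite mxE.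
by apply/sub_kermxP/matrixP => i j; rewrite !ord1 yc mxE.
Qed.

(** Codimension 0 is covered by c = 0, the case of a simplex. *)
Lemma hyperplane_functional r k (W : 'M[R]_(r, k)) : row_free W -> (k <= r.+1)%N ->
  exists c : 'cV[R]_k, (W :=: kermx c)%MS.
Proof.
move=> free lekr; have [C0|C0] := eqVneq (cokermx W) 0.
  exists 0; apply/eqmxP/andP; split; first by apply/sub_kermxP; rewrite mulmx0.
  by rewrite submxE C0 mulmx0.
move: (cokermx W) (mulmx_coker W) C0 => K WK K0.
have [j Kj] : exists j, col j K != 0.
  apply: contrapT => /forallNP noj; move/eqP: K0; apply.
  apply/matrixP => s t; have /negP := noj t; rewrite negbK => /eqP /colP /(_ s).
  by rewrite !mxE.
exists (col j K).
have sub : (W <= kermx (col j K))%MS.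
  by apply/sub_kermxP; rewrite colE mulmxA WK mul0mx.
apply/eqmxP; rewrite sub /= -(geq_leqif (mxrank_leqif_sup sub)) (eqP free) mxrank_ker.
by rewrite leq_subLR (leq_trans lekr) // -add1n leq_add2r lt0n mxrank_eq0.
Qed.

(** The slack map turns the cone over Q into the nonnegative part of the row space of [U *m S], of
    rank r, which one equation describes when k <= r + 1. The matrix [T] inverts the slack map;
    level and projection are read off from it. *)
Lemma rep_exists m (Q : set 'rV[R]_m) k r :
  polytope Q -> Q !=set0 -> facets Q #= `I_k -> affine_rank Q r ->
  (r <= k)%N /\ ((k <= r.+1)%N -> exists (c l : 'cV[R]_k) (M : 'M[R]_(k, m)),
    rep c l M Q /\ \rank (kermx c) = r).
Proof.
move=> Qpoly Q0 Qk Qr; have [U [S [QU S0 SU Spos Ufree]]] := slack_form Qpoly Q0 Qk Qr.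
(* If all slacks of [a *m U] vanish, it and its opposite both lie in the cone over Q, where the
   first homogeneous coordinate is nonnegative. *)
have inj (a : 'rV_r) : a *m (U *m S) = 0 -> a *m U = 0.
  rewrite mulmxA => aUS.
  have [|i|t [x [t0 Qx zE]]] := SU (a *m U); first exact: submxMl.
    by rewrite aUS mxE.
  have [||t' [x' [t'0 Qx' z'E]]] := SU (- (a *m U)); first by rewrite eqmx_opp submxMl.
    by move=> i; rewrite mulNmx aUS oppr0 mxE.
  have := congr1 (fun z => dot z (hmg0 R m)) z'E.
  rewrite dotNl zE !dotZl !hmg_dot0 !mulr1 => tt'.
  have -> : t = 0 by apply/eqP; rewrite eq_le t0 andbT -oppr_ge0 tt'.
  by rewrite scale0r.
have Wfree : row_free (U *m S).
  apply/inj_row_free => a /inj /(congr1 (mulmx^~ (pinvmx U))).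
  by rewrite mulmxKp // mul0mx.
split; first by rewrite -(eqP Wfree) rank_leq_col.
move=> lekr; have [c WE] := hyperplane_functional Wfree lekr.
have [T UE] : exists T, U = U *m S *m T by apply: mx_factor.
exists c, (T *m hmg0 R m), (rsubmx T); split; last by rewrite -WE (eqP Wfree).
have cone y : nneg y -> dot y c = 0 -> exists (t : R) x,
    [/\ 0 <= t, Q x, y *m T = t *: hmg x & y = t *: (hmg x *m S)].
  move=> y0 /sub_kermx_dot; rewrite -WE => /submxP[a yE].
  have yT : y *m T = a *m U by rewrite yE -mulmxA -UE.
  have yTS : y *m T *m S = y by rewrite yT -mulmxA yE.
  have [||t [x [t0 Qx zE]]] := SU (y *m T); first by rewrite yT submxMl.
    by move=> i; rewrite yTS.
  by exists t, x; split=> //; rewrite -{1}yTS zE -scalemxAl.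
have slackQ x : Q x -> dot (hmg x *m S) c = 0 /\ hmg x *m S *m T = hmg x.
  move=> Qx; have /submxP[a ->] := QU x Qx.
  split; last by rewrite -!mulmxA (mulmxA U) -UE.
  by apply/sub_kermx_dot; rewrite -WE -mulmxA submxMl.
have lE y t x : y *m T = t *: hmg x -> dot y (T *m hmg0 R m) = t.
  by move=> yT; rewrite mulmxA yT dotZl hmg_dot0 mulr1.
split.
- move=> y y0 yc yneq0; have [t [x [t0 Qx yT yE]]] := cone y y0 yc.
  rewrite (lE _ _ _ yT) lt_neqAle t0 andbT eq_sym.
  by apply: contraNneq yneq0 => t_eq0; rewrite yE t_eq0 scale0r.
- apply/seteqP; split=> [x Qx|_ [y [y0 yc yl] <-]].
    have [xc xT] := slackQ x Qx; exists (hmg x *m S).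
      split=> // [i|]; first exact: S0.
      by rewrite (lE _ 1 x) // scale1r.
    by rewrite mulmx_rsub xT hmgK.
  have [t [x [t0 Qx yT yE]]] := cone y y0 yc.
  move: yl; rewrite (lE _ _ _ yT) => t1.
  by rewrite mulmx_rsub yT t1 scale1r hmgK.
have ex i : exists x, Q x /\ 0 < (hmg x *m S) 0 i by have [x] := Spos i; exists x.
pose q i := projT1 (cid (ex i)).
have Qq i : Q (q i) by exact: (projT2 (cid (ex i))).1.
have qp i : 0 < (hmg (q i) *m S) 0 i by exact: (projT2 (cid (ex i))).2.
exists (\sum_i hmg (q i) *m S); split=> [i|].
  rewrite summxE (bigD1 i) //= ltr_pwDl // sumr_ge0 // => j _; exact: S0.
by rewrite dot_suml big1 // => i _; have [] := slackQ _ (Qq i).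
Qed.

(** At level 1 of [l] a translation by [t] is the linear map [l *m t]. *)
Lemma rep_affine k (c l : 'cV[R]_k) m n (M : 'M[R]_(k, m)) (Q : set 'rV[R]_m)
    (f : 'rV[R]_m -> 'rV[R]_n) :
  rep c l M Q -> affine_map f -> exists M', rep c l M' (f @` Q) /\
    forall y : 'rV[R]_k, dot y l = 1 -> y *m M' = f (y *m M).
Proof.
move=> [pos QE pt] [N [t fE]]; exists (M *m N + l *m t).
have ME (y : 'rV[R]_k) : dot y l = 1 -> y *m (M *m N + l *m t) = f (y *m M).
  move=> yl; rewrite fE mulmxDr !mulmxA; congr (_ + _).
  by rewrite (_ : y *m l = 1%:M) ?mul1mx //; apply/matrixP => i j; rewrite !ord1 yl mxE.
split=> //; split=> //; rewrite QE; apply/seteqP; split.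
  by move=> _ [_ [y yS <-] <-]; exists y => //; have [_ _ /ME ->] := yS.
move=> _ [y yS <-]; exists (y *m M); first by exists y.
by have [_ _ /ME ->] := yS.
Qed.

(** Surjectivity of [E] is asked only after [row_mx l M]: the new cone may miss points of the old
    one whose images in P are reached otherwise. [rep_lost_ray] relies on this. *)
Lemma rep_change k k' (c l : 'cV[R]_k) (c' : 'cV[R]_k') n (M : 'M[R]_(k, n)) P
    (E : 'M[R]_(k', k)) :
  rep c l M P ->
  (forall y : 'rV[R]_k', nneg y -> dot y c' = 0 -> [/\ nneg (y *m E), dot (y *m E) c = 0 & y != 0 -> y *m E != 0]) ->
  (forall y, slack_set c l y -> exists y', [/\ nneg y', dot y' c' = 0 &
    y' *m E *m row_mx l M = y *m row_mx l M]) ->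
  (exists y : 'rV[R]_k', (forall i, 0 < y 0 i) /\ dot y c' = 0) ->
  rep c' (E *m l) (E *m M) P.
Proof.
move=> [pos PE _] Econe Esurj pt; split=> //.
  move=> y y0 yc' yneq0; have [yE0 yEc yEneq0] := Econe y y0 yc'.
  by rewrite mulmxA; apply: pos => //; apply: yEneq0.
rewrite PE; apply/seteqP; split=> _ [y yS <-].
  have [y0 yc yl] := yS; have [y' [y'0 y'c']] := Esurj y yS.
  rewrite !mul_mx_row => /eq_row_mx[y'l y'M]; exists y'; last by rewrite mulmxA.
  by split=> //; rewrite mulmxA y'l.
have [y0 yc yl] := yS; have [yE0 yEc _] := Econe y y0 yc.
by exists (y *m E); rewrite ?mulmxA //; split=> //; rewrite -mulmxA.
Qed.

Lemma rep_opp k (c l : 'cV[R]_k) n (M : 'M[R]_(k, n)) P : rep c l M P -> rep (- c) l M P.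
Proof.
have oppE (y : 'rV[R]_k) : dot y (- c) = 0 <-> dot y c = 0.
  by rewrite dotNr; split=> [/eqP|->]; rewrite ?oppr0 // oppr_eq0 => /eqP.
case=> pos PE [y0 [y0p y0c]]; split.
- by move=> y yn /oppE yc; apply: pos.
- by rewrite PE; apply/seteqP; split=> _ [y [yn yc yl] <-]; exists y => //; split=> //; apply/oppE.
- by exists y0; split=> //; apply/oppE.
Qed.

Section Kernel.
Variables (k : nat) (c l : 'cV[R]_k) (n : nat) (M : 'M[R]_(k, n)) (P : set 'rV[R]_n).
Hypothesis P_rep : rep c l M P.

(** The kernel of the projection on the hyperplane c = 0 is spanned by [u]. The value u = 0 is
    allowed, so that an injective projection is treated together with a projection along a line. *)
Definition rep_kernel (u : 'rV[R]_k) : Prop :=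
  [/\ dot u c = 0, u *m row_mx l M = 0 &
    forall y, dot y c = 0 -> y *m row_mx l M = 0 -> exists t, y = t *: u].

Lemma rep_kernel0 r : \rank (kermx c) = r -> affine_rank P r -> rep_kernel 0.
Proof.
move=> cr Pr; split; rewrite ?dot0l ?mul0mx // => y yc yM; exists 0; rewrite scaler0.
have := affine_rank_unique Pr (rep_rank P_rep); rewrite -cr => rk.
have := mxrank_mul_ker (kermx c) (row_mx l M); rewrite -rk => /eqP.
rewrite -[X in _ == X]addn0 eqn_add2l mxrank_eq0 => /eqP cap0.
by apply/eqP; rewrite -submx0 -cap0 sub_capmx; apply/andP; split;
  [exact/sub_kermx_dot | exact/sub_kermxP].
Qed.

Lemma rep_kernel1 r : \rank (kermx c) = r.+1 -> affine_rank P r ->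
  exists2 u, u != 0 & rep_kernel u.
Proof.
move=> cr Pr.
have := affine_rank_unique Pr (rep_rank P_rep) => rk.
have := mxrank_mul_ker (kermx c) (row_mx l M); rewrite -rk cr => /eqP.
rewrite -[X in _ == X]addn1 eqn_add2l; set X := (_ :&: _)%MS => /eqP X1.
have X0 : X != 0 by rewrite -mxrank_eq0 X1.
exists (nz_row X); first by rewrite nz_row_eq0.
have := nz_row_sub X; rewrite {2}/X sub_capmx => /andP[/sub_kermx_dot uc /sub_kermxP uM].
split=> // y yc yM.
have yX : (y <= X)%MS by rewrite sub_capmx; apply/andP; split; [exact/sub_kermx_dot | exact/sub_kermxP].
have : (X <= nz_row X)%MS.
  rewrite -(geq_leqif (mxrank_leqif_sup (nz_row_sub X))) X1 lt0n mxrank_eq0 nz_row_eq0 //.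
by move/(submx_trans yX)/sub_rVP.
Qed.

Variable u : 'rV[R]_k.
Hypothesis u_kernel : rep_kernel u.

Lemma rep_kernel_l : dot u l = 0.
Proof. by have [_ uM _] := u_kernel; rewrite -(dot_hmg0_row_mx M) uM dot0l. Qed.

(** Otherwise [u] or its opposite would be a nonzero point of the cone at level 0. *)
Lemma rep_kernel_signs : u != 0 -> (exists i, 0 < u 0 i) /\ (exists i, u 0 i < 0).
Proof.
have [pos _ _] := P_rep; have [uc _ _] := u_kernel; move=> u0.
split; apply: contrapT => /forallNP no.
  have := pos (- u); rewrite oppr_eq0 !dotNl uc rep_kernel_l oppr0 ltxx => H.
  suff : false by []; apply: H => // i; rewrite mxE oppr_ge0 leNgt; exact/negP.
have := pos u; rewrite uc rep_kernel_l ltxx => H.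
suff : false by []; apply: H => // i; rewrite leNgt; exact/negP.
Qed.

(** Functionals that vanish on [u] are those that descend to P. *)
Lemma rep_functional (g : 'cV[R]_k) : dot u g = 0 ->
  exists h : 'cV[R]_(1 + n), forall y : 'rV[R]_k, dot y c = 0 -> dot y g = dot (y *m row_mx l M) h.
Proof.
move=> ug; have [uc uM uall] := u_kernel.
have [|h hE] := @mx_factor _ _ _ _ (kermx c *m row_mx l M) (kermx c *m g).
  move=> a; rewrite (mulmxA a (kermx c) (row_mx l M)) (mulmxA a (kermx c) g) => /uall [|t ->].
    by rewrite -mulmxA mulmx_ker mulmx0 mxE.
  by rewrite -scalemxAl; apply/matrixP => i j; rewrite !ord1 mxE ug mulr0 mxE.
exists h => y /sub_kermx_dot /submxP[a ->].
by rewrite -(mulmxA a) hE -!mulmxA.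
Qed.

Lemma rep_face (g : 'cV[R]_k) : dot u g = 0 ->
  (forall y, slack_set c l y -> 0 <= dot y g) ->
  face P [set y *m M | y in [set y | slack_set c l y /\ dot y g = 0]].
Proof.
move=> /rep_functional[h hE] g0; have [_ PE _] := P_rep.
have dE y : slack_set c l y -> dot (hmg (y *m M)) h = dot y g.
  by move=> [_ yc yl]; rewrite (hmg_row_mx M yl) -hE.
apply/faceP; exists h => [x|]; first by rewrite PE => -[y yS <-]; rewrite dE // g0.
apply/seteqP; split=> [_ [y [yS yg] <-]|x []].
  by split; [rewrite PE; exists y | rewrite /= dE].
rewrite PE => -[y yS <-] /=; rewrite dE // => yg.
by exists y.
Qed.

Lemma face_rep (F : set 'rV[R]_n) : face P F -> exists g : 'cV[R]_k,
  [/\ dot u g = 0, forall y, slack_set c l y -> 0 <= dot y g &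
    F = [set y *m M | y in [set y | slack_set c l y /\ dot y g = 0]]].
Proof.
have [_ PE _] := P_rep; case/faceP => h h0 FE; exists (row_mx l M *m h).
have dE y : slack_set c l y -> dot y (row_mx l M *m h) = dot (hmg (y *m M)) h.
  by move=> [_ _ yl]; rewrite mulmxA (hmg_row_mx M yl).
split.
- by have [_ uM _] := u_kernel; rewrite mulmxA uM dot0l.
- by move=> y yS; rewrite dE // h0 // PE; exists y.
rewrite FE PE; apply/seteqP; split=> [x [[y yS <-]] /= yh|_ [y [yS yh] <-]].
  by exists y => //; split=> //; rewrite dE.
by split; [exists y | rewrite /= -dE].
Qed.

(* The weights of a functional that vanishes exactly on the coordinates of the
   ray [p] are adjusted so that it descends along [u]. *)
Lemma ray_functional (p : ray_type c) :
  u = 0 \/ (exists2 i, 0 < u 0 i & ray c (val p) 0 i = 0) /\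
           (exists2 i, u 0 i < 0 & ray c (val p) 0 i = 0) ->
  exists g : 'cV[R]_k, [/\ dot u g = 0,
    forall i, ray c (val p) 0 i = 0 -> 0 < g i 0 &
    forall i, ray c (val p) 0 i != 0 -> g i 0 = 0].
Proof.
case=> [->|[[i ui ri] [j uj rj]]].
  exists (\col_i (ray c (val p) 0 i == 0)%:R); split; first by rewrite dot0l.
    by move=> i /eqP; rewrite mxE => ->; rewrite ltr01.
  by move=> i /negPf; rewrite mxE => ->.
pose w m : R := (ray c (val p) 0 m == 0)%:R.
have w0 m : 0 <= w m by rewrite ler0n.
pose s := \sum_m u 0 m * w m.
have base (m : 'I_k) (t : R) : 0 <= t -> ray c (val p) 0 m = 0 -> t * u 0 m = - s ->
  exists g : 'cV[R]_k, [/\ dot u g = 0,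
    forall i, ray c (val p) 0 i = 0 -> 0 < g i 0 &
    forall i, ray c (val p) 0 i != 0 -> g i 0 = 0].
  move=> t0 rm tu; exists (\col_q w q + t *: delta_mx m 0); split.
  - rewrite dotDr dotZr dot_delta_r tu dotE -/s.
    by rewrite (eq_bigr (fun m => u 0 m * w m)) ?subrr // => q _; rewrite mxE.
  - move=> q rq; rewrite !mxE /w rq !eqxx andbT ltr_pwDl ?ltr01 //.
    by rewrite mulr_ge0 ?ler0n.
  - move=> q rq; rewrite !mxE /w (negPf rq) add0r andbT.
    by have [qm|] := eqVneq q m; rewrite ?mulr0 //; rewrite qm rm eqxx in rq.
have [s0|s0] := leP 0 s.
  apply: (base j (s / - u 0 j)) => //; first by rewrite divr_ge0 // oppr_ge0 ltW.
  by rewrite invrN mulrN mulNr divfK // lt_eqF.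
apply: (base i (- s / u 0 i)) => //; first by rewrite divr_ge0 ?oppr_ge0 ?ltW.
by rewrite divfK // gt_eqF.
Qed.

(** The functional of [ray_functional] is zero, on the cone, only along the ray [p]; as it descends
    to P, it exposes the image of that ray. The second conclusion excludes that two rays are
    identified in P. *)
Lemma ray_vertex (p : ray_type c) :
  u = 0 \/ (exists2 i, 0 < u 0 i & ray c (val p) 0 i = 0) /\
           (exists2 i, u 0 i < 0 & ray c (val p) 0 i = 0) ->
  vertices P (nray l p *m M) /\ forall q : ray_type c, nray l q *m M = nray l p *m M -> q = p.
Proof.
move=> cond; have [g [ug gpos g0]] := ray_functional cond.
have pS := nray_slack P_rep p.
have terms y : nneg y -> forall i, 0 <= y 0 i * g i 0.
  move=> yn i; apply: mulr_ge0 => //.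
  by have [ri|ri] := eqVneq (ray c (val p) 0 i) 0; [rewrite ltW ?gpos | rewrite g0].
have gE y : nneg y -> dot y g = 0 -> forall i, ray c (val p) 0 i = 0 -> y 0 i = 0.
  move=> yn; rewrite dotE => /eqP; rewrite psumr_eq0 => [/allP yg i ri|i _]; last exact: terms.
  have := yg i (mem_index_enum _); rewrite mulf_eq0 (gt_eqF (gpos i ri)) orbF.
  by move/eqP.
have pg : dot (nray l p) g = 0.
  rewrite dotE big1 // => i _; have [ri|ri] := eqVneq (ray c (val p) 0 i) 0.
    by have /eqP -> : nray l p 0 i == 0; [rewrite (nray_eq0 P_rep) ri | rewrite mul0r].
  by rewrite g0 // mulr0.
split.
  have := rep_face ug; set F := [set _ | _ in _]; move=> faceF.
  suff FE : F = [set nray l p *m M].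
    rewrite /vertices /= -FE; apply: faceF => y [yn _ _].
    by rewrite dotE sumr_ge0 // => i _; exact: terms.
  apply/seteqP; split=> [_ [y [[yn yc yl] yg] <-]|_ ->]; last by exists (nray l p).
  have [t yE] := ray_multiple (valP p) yc (gE y yn yg).
  have t1 : t * dot (ray c (val p)) l = 1 by rewrite -dotZl -yE.
  have l0 := ray_l_gt0 P_rep p.
  congr (_ *m M); rewrite yE /nray; congr (_ *: _).
  by rewrite -[LHS](mulfK (lt0r_neq0 l0)) t1 mul1r.
move=> q qp; have [h hE] := rep_functional ug.
have [qn qc ql] := nray_slack P_rep q.
have qg : dot (nray l q) g = 0.
  have [_ pc pl] := pS.
  by rewrite hE // -(hmg_row_mx M ql) qp (hmg_row_mx M pl) -hE.
apply/esym/val_inj/ray_inj; [exact: valP | exact: valP | move=> i ri].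
by apply/eqP; rewrite -(nray_eq0 P_rep); apply/eqP; exact: gE.
Qed.

(* The facets of the projection along [u] come from the coordinates that are
   constant along [u], and from the elimination of [u] between a coordinate
   that increases and one that decreases along it. *)
Definition facet_index := ({i : 'I_k | u 0 i == 0} + {i : 'I_k | 0 < u 0 i} * {i : 'I_k | u 0 i < 0})%type.

Definition facet_functional (j : facet_index) : 'cV[R]_k :=
  match j with
  | inl i => delta_mx (val i) 0
  | inr (p, q) => (u 0 (val p))^-1 *: delta_mx (val p) 0 - (u 0 (val q))^-1 *: delta_mx (val q) 0
  end.

Definition index_face (j : facet_index) : set 'rV[R]_n :=
  [set y *m M | y in [set y | slack_set c l y /\ dot y (facet_functional j) = 0]].

Lemma facet_functional_u j : dot u (facet_functional j) = 0.
Proof.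
case: j => [[i ui]|[[p up] [q uq]]] /=; first by rewrite dot_delta_r (eqP ui).
have pn : u 0 p != 0 by rewrite gt_eqF.
have qn : u 0 q != 0 by rewrite lt_eqF.
by rewrite dotBr !dotZr !dot_delta_r !mulVf ?subrr.
Qed.

Lemma facet_functional_ge0 j (y : 'rV[R]_k) : nneg y -> 0 <= dot y (facet_functional j).
Proof.
move=> yn; case: j => [[i ui]|[[p up] [q uq]]] /=; first by rewrite dot_delta_r.
rewrite dotBr !dotZr !dot_delta_r subr_ge0; apply: (@le_trans _ _ 0).
  by rewrite mulr_le0_ge0 // invr_le0 ltW.
by rewrite mulr_ge0 // invr_ge0 ltW.
Qed.

Lemma facet_functional_gt0 j (y : 'rV[R]_k) : (forall i, 0 < y 0 i) -> 0 < dot y (facet_functional j).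
Proof.
move=> yp; case: j => [[i ui]|[[p up] [q uq]]] /=; first by rewrite dot_delta_r.
rewrite dotBr !dotZr !dot_delta_r subr_gt0; apply: (@lt_trans _ _ 0).
  by rewrite pmulr_llt0 ?invr_lt0.
by rewrite mulr_gt0 ?invr_gt0.
Qed.

Lemma index_face_face j : face P (index_face j).
Proof.
apply: rep_face; first exact: facet_functional_u.
by move=> y [yn _ _]; exact: facet_functional_ge0.
Qed.

Lemma slack_positive : P !=set0 -> exists2 y, slack_set c l y & forall i, 0 < y 0 i.
Proof.
have [pos PE [y0 [y0p y0c]]] := P_rep; rewrite PE => -[_ [y [yn yc yl] _]].
have y00 : y0 != 0.
  apply/negP => /eqP y00; move: yl; have -> : y = 0; last by rewrite dot0l => /esym/eqP; rewrite oner_eq0.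
  apply/rowP => i; have := y0p i; by rewrite y00 mxE ltxx.
have l0 : 0 < dot y0 l by apply: pos => // i; exact: ltW.
exists ((dot y0 l)^-1 *: y0) => [|i]; last by rewrite mxE mulr_gt0 // invr_gt0.
split; first by apply: nnegZ => [|i]; rewrite ?invr_ge0 ltW.
  by rewrite dotZl y0c mulr0.
by rewrite dotZl mulVf // gt_eqF.
Qed.

Lemma index_face_proper j : P !=set0 -> index_face j <> P.
Proof.
move=> /slack_positive[y yS yp] jP; have [_ PE _] := P_rep.
have : index_face j (y *m M) by rewrite jP PE; exists y.
move=> [y' [y'S y'j] eqM].
have [h hE] := rep_functional (facet_functional_u j).
have [_ yc yl] := yS; have [_ y'c y'l] := y'S.
have := facet_functional_gt0 j yp; rewrite hE // -(hmg_row_mx M yl) -eqM (hmg_row_mx M y'l) -hE //.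
by rewrite y'j ltxx.
Qed.

(** Consider the coordinates that vanish on the lift of F. A zero of [u] among them, or two on which
    [u] has opposite signs, gives the index. Otherwise [u] or [- u] is positive on all of them and
    leads from F into the interior of the cone without changing [g], so F is P. *)
Lemma face_sub_index_face F : face P F -> F !=set0 -> F <> P -> exists j, F `<=` index_face j.
Proof.
move=> PF [x0 Fx0] FP; have [_ PE _] := P_rep; have [uc _ _] := u_kernel.
have [g [ug g0 FE]] := face_rep PF.
pose Ft y := slack_set c l y /\ dot y g = 0.
have [y1 Fy1] : exists y, Ft y by move: Fx0; rewrite FE => -[y Fy _]; exists y.
pose zero i := forall y, Ft y -> y 0 i = 0.
have sub j : (forall y, Ft y -> dot y (facet_functional j) = 0) -> F `<=` index_face j.
  move=> Fj x; rewrite FE => -[y [yS yg] <-]; exists y => //; split=> //; exact: Fj.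
have g0' y : nneg y -> dot y c = 0 -> 0 <= dot y g.
  move=> yn yc; have [->|yneq0] := eqVneq y 0; first by rewrite dot0l.
  have [pos _ _] := P_rep; have yl := pos y yn yc yneq0.
  have := g0 ((dot y l)^-1 *: y); rewrite dotZl pmulr_rge0 ?invr_gt0 //; apply.
  split; [by apply: nnegZ; rewrite ?invr_ge0 // ltW | by rewrite dotZl yc mulr0 |].
  by rewrite dotZl mulVf // gt_eqF.
(* Adding a multiple of a generic point of the lift of F to [v] gives a point [V] with positive
   coordinates and g = 0. For every y in the slack set, [- y + t *: V] is in the cone for some t,
   whence g <= 0 at y. *)
have positive_face (v : 'rV[R]_k) : dot v c = 0 -> dot v g = 0 -> (forall i, zero i -> 0 < v 0 i) -> F = P.
  move=> vc vg vpos.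
  have ex i : exists y, Ft y /\ (zero i \/ 0 < y 0 i).
    have [zi|nzi] := pselect (zero i); first by exists y1; split=> //; left.
    apply: contrapT => /forallNP noy; apply: nzi => y Fy.
    have [[yn _ _] _] := Fy; apply/eqP; rewrite eq_le yn andbT leNgt.
    by apply/negP => yi; apply: (noy y); split=> //; right.
  pose w i := projT1 (cid (ex i)).
  have wF i : Ft (w i) by exact: (projT2 (cid (ex i))).1.
  have wz i : zero i \/ 0 < w i 0 i by exact: (projT2 (cid (ex i))).2.
  have wn i : nneg (w i) by have [[]] := wF i.
  pose Y := \sum_i w i.
  have [||s sp] := @positive_shift _ _ Y v.
  - by move=> i; rewrite summxE sumr_ge0 // => j _; exact: wn.
  - move=> i Yi; apply: vpos; have [//|wi] := wz i; move: Yi.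
    rewrite summxE => /eqP; rewrite psumr_eq0 => [/allP /(_ i (mem_index_enum _))|j _]; last exact: wn.
    by rewrite gt_eqF.
  have Yc : dot Y c = 0 by rewrite dot_suml big1 // => i _; have [[]] := wF i.
  have Yg : dot Y g = 0 by rewrite dot_suml big1 // => i _; have [_] := wF i.
  set V := v + s *: Y in sp.
  have Vc : dot V c = 0 by rewrite dotDl dotZl vc Yc mulr0 addr0.
  have Vg : dot V g = 0 by rewrite dotDl dotZl vg Yg mulr0 addr0.
  rewrite PE FE; apply/seteqP; split=> _ [y yS <-]; first by exists y; case: yS.
  exists y => //; split=> //; apply/eqP; rewrite eq_le g0 // andbT.
  have [||t tp] := @positive_shift _ _ V (- y).
  - by move=> i; exact: ltW.
  - by move=> i Vi; have := sp i; rewrite Vi ltxx.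
  have [_ yc _] := yS.
  have := g0' (- y + t *: V); rewrite !dotDl !dotZl !dotNl yc Vc Vg mulr0 oppr0 !addr0 oppr_ge0.
  by apply=> // i; exact: ltW.
have [[i [ui zi]]|/forallNP no0] := pselect (exists i, u 0 i == 0 /\ zero i).
  exists (inl (exist _ i ui)); apply: sub => y Fy /=.
  by rewrite dot_delta_r zi.
have [[p [up zp]]|/forallNP nop] := pselect (exists p, 0 < u 0 p /\ zero p);
have [[q [uq zq]]|/forallNP noq] := pselect (exists q, u 0 q < 0 /\ zero q).
  exists (inr (exist _ p up, exist _ q uq)); apply: sub => y Fy /=.
  by rewrite dotBr !dotZr !dot_delta_r (zp y Fy) (zq y Fy) !mulr0 subrr.
all: exfalso; apply: FP.
  apply: (positive_face u) => // i zi; rewrite ltNge; apply/negP => ui.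
  have [ui'|ui'] := eqVneq (u 0 i) 0; first by case: (no0 i); rewrite ui'.
  by case: (noq i); split=> //; rewrite lt_neqAle ui'.
all: apply: (positive_face (- u)); rewrite ?dotNl ?ug ?uc ?oppr0 //.
all: move=> i zi; rewrite mxE oppr_gt0 ltNge; apply/negP => ui.
all: have [ui'|ui'] := eqVneq (u 0 i) 0; first by case: (no0 i); rewrite ui'.
all: by case: (nop i); split=> //; rewrite lt_neqAle eq_sym ui'.
Qed.

End Kernel.

End SlackRepresentations.

(** * Counting facets, bounds on extensions, and combinatorial invariants *)

Section FacetsAndExtensions.
Variable R : realType.
Local Notation dot x g := ((x *m g) 0 0).

Section FacetCount.
Variable n : nat.
Implicit Types (P F G : set 'rV[R]_n).

Lemma affine_rank_neq0 P r : (0 < r)%N -> affine_rank P r -> P !=set0.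
Proof. by case: r => // r _ [p [Pp _ _]]; exists (p ord0). Qed.

Lemma facet_maximal P F G : facets P F -> face P G -> F `<=` G -> G <> P -> F = G.
Proof.
move=> [PF [k [Fk Pk]]] PG FG GP; apply: contrapT => FneqG.
have [i Gi] := affine_rank_exists G.
have lt1 := face_rank_lt PF FG (face_sub PG) FneqG Fk Gi.
have := face_rank_lt PG (face_sub PG) (@subset_refl _ P) GP Gi Pk.
by rewrite ltnS leqNgt lt1.
Qed.

Lemma facet_proper P F r : affine_rank P r -> (2 <= r)%N -> facets P F -> F <> P /\ F !=set0.
Proof.
move=> Pr r2 [PF [k [Fk Pk]]]; have rk := affine_rank_unique Pr Pk; split.
  by move=> FP; move: Fk; rewrite FP => /(affine_rank_unique Pk) /eqP; rewrite eqn_leq ltnn.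
by apply: affine_rank_neq0 Fk; move: r2; rewrite rk.
Qed.

(** Each facet lies in an [index_face], which is proper, and equals it by maximality; it remains to
    count the indices. *)
Lemma rep_facets k (c l : 'cV[R]_k) (M : 'M[R]_(k, n)) P u r :
  rep c l M P -> rep_kernel c l M u -> affine_rank P r -> (2 <= r)%N ->
  exists2 j, (j <= #|zset u^T| + #|pset u^T| * #|nset u^T|)%N & facets P #= `I_j.
Proof.
move=> P_rep u_ker Pr r2.
have sub : facets P `<=` range (@index_face _ _ c l _ M u).
  move=> F PF; have [FP F0] := facet_proper Pr r2 PF.
  have [j Fj] := face_sub_index_face P_rep u_ker PF.1 F0 FP.
  exists j => //; apply/esym/(facet_maximal PF _ Fj).
    exact: (index_face_face P_rep u_ker).
  by apply: (index_face_proper P_rep u_ker); apply: affine_rank_neq0 Pr; apply: leq_trans r2.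
have [j le_j Pj] := card_sub_range sub; exists j => //; apply: leq_trans le_j _.
rewrite card_sum card_prod !card_sig.
by apply/eq_leq; congr (_ + _ * _)%N; rewrite -cardsE; apply: eq_card => i; rewrite !inE mxE.
Qed.

Lemma card_signs0 k : (#|zset (0 : 'cV[R]_k)| = k) /\ #|pset (0 : 'cV[R]_k)| = 0%N /\ #|nset (0 : 'cV[R]_k)| = 0%N.
Proof.
split; last split; rewrite -?[RHS](card_ord k) -?[RHS](@cards0 'I_k).
- by apply: eq_card => i; rewrite !inE mxE eqxx.
- by apply: eq_card => i; rewrite !inE mxE ltxx.
- by apply: eq_card => i; rewrite !inE mxE ltxx.
Qed.

End FacetCount.

Lemma has_extension_self n (P : set 'rV[R]_n) k :
  polytope P -> facets P #= `I_k -> has_extension P k.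
Proof.
move=> Ppoly Pk; exists n, P, id; split=> //; last by rewrite image_id.
by exists 1%:M, 0 => x; rewrite mulmx1 addr0.
Qed.

Lemma xcP n (P : set 'rV[R]_n) k : has_extension P k ->
  has_extension P (xc P) /\ forall j, has_extension P j -> (xc P <= j)%N.
Proof.
move=> Pk; have ex : exists k, `[< has_extension P k >] by exists k; apply/asboolP.
case: (ex_minnP ex) => i /asboolP Pi mini; rewrite /xc.
apply: (@xgetPex _ 0%N [set k | has_extension P k /\ forall j, has_extension P j -> (k <= j)%N]).
by exists i; split=> // j Pj; apply: mini; apply/asboolP.
Qed.

(** With kernel 0, this applies the results on projections to the extension itself. *)
Lemma rep_slack_set k (c l : 'cV[R]_k) n (M : 'M[R]_(k, n)) P :
  rep c l M P -> rep c l 1%:M (slack_set c l).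
Proof.
case=> pos _ pt; split=> //; apply/seteqP; split=> [y yS|_ [y yS <-]].
  by exists y; rewrite ?mulmx1.
by rewrite mulmx1.
Qed.

Lemma slack_set_kernel k (c l : 'cV[R]_k) : rep_kernel c l 1%:M 0.
Proof.
split; rewrite ?dot0l ?mul0mx // => y _; rewrite mul_mx_row mulmx1.
by rewrite -[X in _ = X]row_mx0 => /eq_row_mx[_ ->]; exists 0; rewrite scaler0.
Qed.

Lemma slack_set_rank k (c l : 'cV[R]_k) n (M : 'M[R]_(k, n)) P :
  rep c l M P -> affine_rank (slack_set c l) (\rank (kermx c)).
Proof.
move=> /rep_slack_set Q_rep; have := rep_rank Q_rep.
rewrite mxrankMfree //; apply/inj_row_free => y; rewrite mul_mx_row mulmx1.
by rewrite -[X in _ = X]row_mx0 => /eq_row_mx[_ ->].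
Qed.

Lemma slack_set_facets k (c l : 'cV[R]_k) n (M : 'M[R]_(k, n)) P :
  rep c l M P -> (2 <= \rank (kermx c))%N ->
  exists2 j, (j <= k)%N & facets (slack_set c l) #= `I_j.
Proof.
move=> P_rep r2; have := rep_facets (rep_slack_set P_rep) (slack_set_kernel c l) (slack_set_rank P_rep) r2.
by rewrite trmx0; have [-> [-> ->]] := card_signs0 k; rewrite muln0 addn0.
Qed.

Lemma rep_extension k (c l : 'cV[R]_k) n (M : 'M[R]_(k, n)) P :
  rep c l M P -> (2 <= \rank (kermx c))%N -> exists2 j, (j <= k)%N & has_extension P j.
Proof.
move=> P_rep r2; have [j le_jk Qj] := slack_set_facets P_rep r2.
exists j => //; exists k, (slack_set c l), (mulmx^~ M); split=> //.
- exact: rep_polytope (rep_slack_set P_rep).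
- by exists M, 0 => y; rewrite addr0.
- by case: P_rep.
Qed.

(** The simplex on the vertices is the slack set of c = 0 with the coordinate sum as level. *)
Lemma simplex_extension n (P : set 'rV[R]_n) N :
  polytope P -> vertices P #= `I_N -> (2 <= N)%N -> exists2 j, (j <= N)%N & has_extension P j.
Proof.
move=> Ppoly PN N2; have [v [_ _ PE]] := hull_vertices Ppoly PN.
pose M : 'M[R]_(N, n) := \matrix_i v i.
have dot1 (y : 'rV[R]_N) : dot y (const_mx 1 : 'cV_N) = \sum_i y 0 i.
  by rewrite dotE; apply: eq_bigr => i _; rewrite mxE mulr1.
have yME (y : 'rV[R]_N) : y *m M = \sum_i y 0 i *: v i.
  by rewrite mulmx_sum_row; apply: eq_bigr => i _; rewrite rowK.
apply: (@rep_extension _ 0 (const_mx 1) _ M); last by rewrite mxrank_ker mxrank0 subn0.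
split.
- move=> y yn _ /row_neq0[i yi]; rewrite dot1 (bigD1 i) //= ltr_pwDl ?sumr_ge0 //.
  by rewrite lt_neqAle eq_sym yi yn.
- rewrite PE; apply/seteqP; split=> [x [a a0 xE]|_ [y [yn _ yl] <-]].
    have [a1 ->] := hull_weights xE; exists (\row_i a i).
      split=> [i||]; [by rewrite mxE | by rewrite dot0r |].
      by rewrite dot1 -[RHS]a1; apply: eq_bigr => i _; rewrite mxE.
    by rewrite yME; apply: eq_bigr => i _; rewrite mxE.
  exists (fun i => y 0 i) => //; rewrite yME hmg_sum //.
  by rewrite -dot1.
- by exists (const_mx 1); split=> [i|]; rewrite ?dot0r ?mxE ?ltr01.
Qed.

Lemma rank_kermx_full k (c : 'cV[R]_k) : \rank (kermx c) = k -> c = 0.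
Proof.
case: k c => [|k] c; first by move=> _; apply/matrixP; case.
rewrite mxrank_ker => /eqP; case: (\rank c) (mxrank_eq0 c) => [|r].
  by rewrite eqxx => /esym/eqP.
move=> _; rewrite eqn_leq => /andP[_]; rewrite leqNgt.
by rewrite subSS ltnS leq_subr.
Qed.

Lemma card_ray_index0 k : #|ray_index (0 : 'cV[R]_k)| = k.
Proof. by rewrite card_ray_index; have [-> [-> ->]] := card_signs0 k; rewrite addn0. Qed.

(** If the extension has the dimension of P, it is an injective affine image away from P and has the
    same number of facets; otherwise d + 1 < r < k <= d + 3 fixes both r and k. *)
Lemma extension_cases n (P : set 'rV[R]_n) d k :
  dimension P d -> vertices P #= `I_(d + 4) -> has_extension P k -> (k <= d + 3)%N ->
  (d + 2 <= k)%N /\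
  (facets P #= `I_k \/ k = (d + 3)%N /\ exists (c l : 'cV[R]_k) (M : 'M[R]_(k, n)),
    rep c l M P /\ \rank (kermx c) = (d + 2)%N).
Proof.
move=> Pd PV [m [Q [f [Qpoly f_aff fQ Qk]]]] lek.
have [x Px] := affine_rank_neq0 (ltn0Sn d) Pd.
have Q0 : Q !=set0 by move: Px; rewrite -fQ => -[y Qy _]; exists y.
have [r Qr] := affine_rank_exists Q.
have le_dr := affine_image_rank_le f_aff fQ Pd Qr.
have [le_rk rep_ex] := rep_exists Qpoly Q0 Qk Qr.
(* If r = k then c = 0 and there are only k <= d + 3 rays, too few for the d + 4 vertices of P. *)
have lt_rk : (r < k)%N.
  rewrite ltn_neqAle le_rk andbT; apply/negP => /eqP rk.
  have [|c [l [M [Q_rep cr]]]] := rep_ex; first by rewrite rk leqnSn.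
  have [M' [P_rep _]] := rep_affine Q_rep f_aff; rewrite fQ in P_rep.
  have c0 : c = 0 by apply: rank_kermx_full; rewrite cr.
  have := rep_card_vertices P_rep PV; rewrite c0 card_ray_index0.
  by move: lek; clear; lia.
split; first by move: le_dr lt_rk; clear; lia.
have [rd|rd] := eqVneq r d.+1.
  left; have QP : proj_equiv Q P by apply: affine_image_proj_equiv f_aff fQ Pd _; rewrite -rd.
  exact: card_eq_trans (proj_equiv_facets QP) Qk.
right; have kd : k = (d + 3)%N by move: rd lek le_dr lt_rk; clear; lia.
have rd2 : r = (d + 2)%N by move: rd lek le_dr lt_rk; clear; lia.
split=> //; have [|c [l [M [Q_rep cr]]]] := rep_ex.
  by rewrite kd rd2; clear; lia.
have [M' [P_rep _]] := rep_affine Q_rep f_aff; rewrite fQ in P_rep.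
by exists c, l, M'; rewrite cr rd2.
Qed.

Lemma face_set0 n (P : set 'rV[R]_n) : face P set0.
Proof.
apply/faceP; exists (hmg0 R n) => [x _|]; first by rewrite hmg_dot0 ler01.
by apply/seteqP; split=> // x [_ /=]; rewrite hmg_dot0 => /eqP; rewrite oner_eq0.
Qed.

(** * What an isomorphism of face lattices preserves *)

Section Invariants.
Variables (m n : nat) (Q : set 'rV[R]_m) (S : set 'rV[R]_n) (Phi : set 'rV[R]_m -> set 'rV[R]_n).
Hypothesis Phi_bij : set_bij (faces Q) (faces S) Phi.
Hypothesis Phi_mono : forall F G, faces Q F -> faces Q G -> (F `<=` G <-> Phi F `<=` Phi G).

Let Phi_face F : face Q F -> face S (Phi F).
Proof. by have [Phi_fun _ _] := Phi_bij; exact: Phi_fun. Qed.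

Let Phi_surj G : face S G -> exists2 F, face Q F & Phi F = G.
Proof. by have [_ _ Phi_surj] := Phi_bij => /Phi_surj[F QF <-]; exists F. Qed.

Let Phi_inj F G : face Q F -> face Q G -> Phi F = Phi G -> F = G.
Proof.
have [_ inj _] := Phi_bij => QF QG; apply: inj; exact: mem_set.
Qed.

Lemma comb_equiv_top : Phi Q = S.
Proof.
have [F QF FS] := Phi_surj (face_self S).
apply/seteqP; split; first exact: face_sub (Phi_face (face_self Q)).
by rewrite -[X in X `<=` _]FS; apply: (Phi_mono QF (face_self Q)).1; exact: face_sub.
Qed.

Lemma comb_equiv_nonempty F : face Q F -> F !=set0 -> Phi F !=set0.
Proof.
move=> QF /set0P F0; apply/set0P; apply: contraNneq F0 => PhiF0.
have := (Phi_mono QF (face_set0 Q)).2; rewrite PhiF0 => H.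
by apply/eqP/seteqP; split=> //; apply: H.
Qed.

(** The image of a facet is a proper face of S, hence lies in an [index_face], whose preimage
    contains the facet and must be equal to it. The upper bound is enough for the counting in
    [projection_extension]. *)
Lemma comb_equiv_facets k (c l : 'cV[R]_k) (M : 'M[R]_(k, n)) r :
  rep c l M S -> rep_kernel c l M 0 -> affine_rank Q r -> (2 <= r)%N ->
  exists2 j, (j <= k)%N & facets Q #= `I_j.
Proof.
move=> S_rep u_ker Qr r2.
have S0 : S !=set0.
  rewrite -comb_equiv_top; apply: comb_equiv_nonempty (face_self Q) _.
  by apply: affine_rank_neq0 Qr; apply: leq_trans r2.
have ex j : exists G, face Q G /\ Phi G = @index_face _ _ c l _ M 0 j.
  by have [G QG GE] := Phi_surj (index_face_face S_rep u_ker j); exists G.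
pose h j := projT1 (cid (ex j)).
have [Qh Phih] : (forall j, face Q (h j)) /\ forall j, Phi (h j) = index_face c l M j.
  by split=> j; have [] := projT2 (cid (ex j)).
have sub : facets Q `<=` range h.
  move=> F QF; have [FQ F0] := facet_proper Qr r2 QF.
  have PhiF0 := comb_equiv_nonempty QF.1 F0.
  have PhiFS : Phi F <> S.
    by rewrite -comb_equiv_top => /(Phi_inj QF.1 (face_self Q)).
  have [j Fj] := face_sub_index_face S_rep u_ker (Phi_face QF.1) PhiF0 PhiFS.
  exists j => //; apply/esym/(facet_maximal QF (Qh j)).
    by apply/(Phi_mono QF.1 (Qh j)); rewrite Phih.
  move=> hQ; have := Phih j; rewrite hQ comb_equiv_top => /esym.
  exact: (index_face_proper S_rep u_ker S0).
have [j le_j Qj] := card_sub_range sub; exists j => //; apply: leq_trans le_j _.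
rewrite card_sum card_prod !card_sig.
have -> : #|[pred i | (0 : 'rV[R]_k) 0 i == 0]| = k.
  by rewrite -[RHS]card_ord; apply: eq_card => i; rewrite !inE mxE eqxx.
have -> : #|[pred i | 0 < (0 : 'rV[R]_k) 0 i]| = 0%N.
  by apply: eq_card0 => i; rewrite !inE mxE ltxx.
by rewrite addn0.
Qed.

(** The image of a vertex is a nonempty face, so it contains a generator of S, which is a vertex.
    The preimage of the latter is a nonempty face inside the given vertex. *)
Lemma comb_equiv_vertices k (c l : 'cV[R]_k) (M : 'M[R]_(k, n)) :
  rep c l M S -> rep_kernel c l M 0 ->
  exists2 j, (j <= #|ray_index c|)%N & vertices Q #= `I_j.
Proof.
move=> S_rep u_ker.
pose h (p : ray_type c) : 'rV[R]_m := xget 0 [set v | vertices Q v /\ Phi [set v] = [set nray l p *m M]].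
have sub : vertices Q `<=` range h.
  move=> v Qv; have := comb_equiv_nonempty Qv (ex_intro _ v erefl).
  have := Phi_face Qv; rewrite {1}(rep_hull S_rep) => /hull_face_mem H /H[p Phip].
  have [pS _] := ray_vertex S_rep u_ker (or_introl erefl : _ \/ (exists2 i, _ & ray c (val p) 0 i = 0) /\ _).
  have [G QG GE] := Phi_surj pS.
  have Gv : G `<=` [set v] by apply/(Phi_mono QG Qv); rewrite GE => _ ->.
  have {}Gv : G = [set v].
    apply/seteqP; split=> // _ ->; have [g Gg] : G !=set0.
      (* An empty [G] would be mapped below every face of S, hence to the empty face, although its
         image is a vertex. *)
      apply: contrapT => /set0P/negP; rewrite negbK => /eqP G0.
      have /(Phi_mono QG (face_set0 Q)) : G `<=` set0 by rewrite G0.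
      rewrite GE => H'; have [F QF F0] := Phi_surj (face_set0 S).
      have : Phi set0 `<=` Phi F by apply/(Phi_mono (face_set0 Q) QF).
      by rewrite F0 => H''; have := H'' _ (H' _ erefl).
    by have := Gv g Gg => /= <-.
  exists p => //; rewrite /h; apply: xget_unique; first by split=> //; rewrite -Gv.
  move=> w [Qw Phiw]; have : [set w] = G by apply: Phi_inj => //; rewrite Phiw GE.
  by rewrite Gv => /seteqP[/(_ w erefl)].
have [j le_j Qj] := card_sub_range sub; exists j => //.
by rewrite -card_ray_type.
Qed.

(** A strict chain of faces pulls back to a strict chain, along which the affine rank grows by at
    least 1 at each step. *)
Lemma comb_equiv_rank (F : nat -> set 'rV[R]_n) t r :
  (forall i, (i <= t)%N -> face S (F i)) ->
  (forall i, (i < t)%N -> F i `<=` F i.+1 /\ F i <> F i.+1) ->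
  affine_rank Q r -> (t <= r)%N.
Proof.
move=> F_face F_lt Qr.
have ex i : exists G, (i <= t)%N -> face Q G /\ Phi G = F i.
  case: (leqP i t) => [/F_face/Phi_surj[G QG GE]|_]; first by exists G.
  by exists set0.
pose G i := projT1 (cid (ex i)).
have QG i : (i <= t)%N -> face Q (G i) by move=> it; have [] := projT2 (cid (ex i)) it.
have PhiG i : (i <= t)%N -> Phi (G i) = F i by move=> it; have [] := projT2 (cid (ex i)) it.
have rank_ge i : (i <= t)%N -> forall j, affine_rank (G i) j -> (i <= j)%N.
  elim: i => // i IHi lt_it j Gj; have le_it := ltnW lt_it.
  have [s Gs] := affine_rank_exists (G i).
  apply: leq_ltn_trans (IHi le_it s Gs) _.
  have [sub neq] := F_lt i lt_it.
  have subG : G i `<=` G i.+1.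
    by apply/(Phi_mono (QG i le_it) (QG _ lt_it)); rewrite !PhiG.
  apply: face_rank_lt (QG i le_it) subG (face_sub (QG _ lt_it)) _ Gs Gj.
  by move=> eqG; apply: neq; rewrite -!PhiG // eqG.
have [s Gs] := affine_rank_exists (G t).
exact: leq_trans (rank_ge t (leqnn t) s Gs) (affine_rank_sub (face_sub (QG t (leqnn t))) Gs Qr).
Qed.

End Invariants.

End FacetsAndExtensions.

(** * Explicit coordinates for simplices and pyramids *)

Section PyramidCoordinates.
Variable R : realType.
Local Notation dot x g := ((x *m g) 0 0).

Lemma dot_ones n (y : 'rV[R]_n) : dot y (const_mx 1 : 'cV_n) = \sum_i y 0 i.
Proof. by rewrite dotE; apply: eq_bigr => i _; rewrite mxE mulr1. Qed.

Lemma dot_row_col m n (y : 'rV[R]_m) (z : 'rV[R]_n) (g : 'cV[R]_m) (h : 'cV[R]_n) :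
  dot (row_mx y z) (col_mx g h) = dot y g + dot z h.
Proof. by rewrite mul_row_col mxE. Qed.

Lemma nneg_row_mx m n (y : 'rV[R]_m) (z : 'rV[R]_n) : nneg (row_mx y z) <-> nneg y /\ nneg z.
Proof.
split=> [yz|[yn zn] i].
  by split=> i; [have := yz (lshift n i); rewrite row_mxEl | have := yz (rshift m i); rewrite row_mxEr].
by case: (split_ordP i) => j ->; rewrite ?row_mxEl ?row_mxEr.
Qed.

Lemma simplexE n : @simplex R n = [set y | nneg y /\ dot y (const_mx 1 : 'cV_n.+1) = 1].
Proof.
rewrite /simplex convex_hull_range; apply/seteqP; split=> [x [a a0 /hull_weights[a1 ->]]|y [yn y1]].
  have E i : (\sum_t a t *: (delta_mx 0 t : 'rV[R]_n.+1)) 0 i = a i.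
    rewrite summxE (bigD1 i) //= big1 ?addr0 ?mxE ?eqxx ?mulr1 // => t ti.
    by rewrite !mxE [i == t]eq_sym (negPf ti) mulr0.
  by split=> [i|]; rewrite ?E // dot_ones -[RHS]a1; apply: eq_bigr => i _; rewrite E.
exists (fun i => y 0 i) => //; rewrite dot_ones in y1.
by rewrite -hmg_sum //; congr hmg; exact: row_sum_delta.
Qed.

Lemma convex_hull_sub_hull (T : finType) n (v : T -> 'rV[R]_n) A :
  A `<=` hull v -> convex_hull A `<=` hull v.
Proof.
move=> Av x [k [p [b [Ap b0 b1 ->]]]].
have ex i : exists a : T -> R, (forall t, 0 <= a t) /\ hmg (p i) = \sum_t a t *: hmg (v t).
  by have [a a0 aE] := Av _ (Ap i); exists a.
pose a i := projT1 (cid (ex i)).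
have a0 i t : 0 <= a i t by exact: (projT2 (cid (ex i))).1.
have aE i : hmg (p i) = \sum_t a i t *: hmg (v t) by exact: (projT2 (cid (ex i))).2.
exists (fun t => \sum_i b i * a i t) => [t|].
  by apply: sumr_ge0 => i _; rewrite mulr_ge0.
rewrite hmg_sum // (eq_bigr (fun i => \sum_t (b i * a i t) *: hmg (v t))) => [|i _].
  by rewrite exchange_big; apply: eq_bigr => t _; rewrite scaler_suml.
by rewrite aE scaler_sumr; apply: eq_bigr => t _; rewrite scalerA.
Qed.

Lemma convex_hull_mono n (A B : set 'rV[R]_n) : A `<=` B -> convex_hull A `<=` convex_hull B.
Proof. by move=> AB x [k [p [b [Ap b0 b1 xE]]]]; exists k, p, b; split=> // i; apply: AB. Qed.

Lemma big_option (T : finType) (V : nmodType) (F : option T -> V) :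
  \sum_o F o = F None + \sum_t F (Some t).
Proof.
rewrite (bigD1 None) //=; congr (_ + _).
by rewrite (reindex_omap Some id) => [|[]//] /=; apply: eq_bigl => t; rewrite eqxx.
Qed.

Lemma pyr1E n (B : set 'rV[R]_n) : polytope B -> B !=set0 ->
  polytope (pyr1 B) /\ forall w, pyr1 B w <-> exists (t : R) x, [/\ 0 <= t, t <= 1, B x &
    w = row_mx (const_mx t) ((1 - t) *: x)].
Proof.
move=> /polytopeP[N [v ->]] [x0 x0v].
pose v' (o : option 'I_N) : 'rV[R]_(1 + n) :=
  if o is Some i then row_mx 0 (v i) else row_mx (const_mx 1) 0.
have v'E (a : option 'I_N -> R) : \sum_o a o *: v' o =
    row_mx (const_mx (a None)) (\sum_i a (Some i) *: v i).
  rewrite big_option /=; transitivity (a None *: v' None + \sum_i row_mx 0 (a (Some i) *: v i)).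
    by congr (_ + _); apply: eq_bigr => i _; rewrite scale_row_mx scaler0.
  have -> : \sum_i row_mx 0 (a (Some i) *: v i) = row_mx (0 : 'rV_1) (\sum_i a (Some i) *: v i).
    rewrite -[LHS]hsubmxK !linear_sum /=; congr row_mx.
      by rewrite big1 // => i _; rewrite row_mxKl.
    by apply: eq_bigr => i _; rewrite row_mxKr.
  rewrite /v' scale_row_mx scaler0 add_row_mx addr0 add0r; congr row_mx.
  by apply/matrixP => i j; rewrite !mxE mulr1.
have pyrE : pyr1 (hull v) = hull v'.
  apply/seteqP; split.
    apply: convex_hull_sub_hull => _ [[x xv <-]|->]; last exact: (hull_mem v' None).
    have [a a0 xE] := xv; have [a1 xE'] := hull_weights xE.
    exists (fun o => if o is Some i then a i else 0) => [[]//|].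
    rewrite -hmg_sum ?v'E; last by rewrite big_option /= add0r.
    by congr hmg; rewrite xE'; congr row_mx; apply/matrixP => i j; rewrite !mxE.
  rewrite -convex_hull_range; apply: convex_hull_mono => _ [[i|] _ <-] /=.
    by left; exists (v i) => //; exact: hull_mem.
  by right.
split=> [|w]; first by rewrite pyrE; exact: polytope_hull.
rewrite pyrE; split=> [[a a0 /hull_weights[a1 wE]]|[t [x [t0 t1 xv wE]]]].
  rewrite big_option /= in a1; rewrite v'E in wE.
  have s0 : 0 <= \sum_i a (Some i) by exact: sumr_ge0.
  have sE : \sum_i a (Some i) = 1 - a None by rewrite -a1 addrAC subrr add0r.
  have [s_eq0|s_neq0] := eqVneq (\sum_i a (Some i)) 0.
    exists (a None), x0; split=> //; first by rewrite -subr_ge0 -sE.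
    rewrite wE -sE s_eq0 scale0r; congr row_mx; apply: big1 => i _.
    move/eqP: s_eq0; rewrite psumr_eq0 // => /allP /(_ i (mem_index_enum _)) /eqP ->.
    by rewrite scale0r.
  exists (a None), (\sum_i (a (Some i) / \sum_j a (Some j)) *: v i); split=> //.
  - by rewrite -subr_ge0 -sE.
  - exists (fun i => a (Some i) / \sum_j a (Some j)) => [i|]; first by rewrite divr_ge0.
    by rewrite hmg_sum // -mulr_suml divff.
  - rewrite wE -sE; congr row_mx; rewrite scaler_sumr; apply: eq_bigr => i _.
    by rewrite scalerA mulrCA divff // mulr1.
have [a a0 /hull_weights[a1 xE]] := xv.
pose b (o : option 'I_N) := if o is Some i then (1 - t) * a i else t.
have b1 : \sum_o b o = 1 by rewrite big_option /= -mulr_sumr a1 mulr1 addrC subrK.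
exists b => [[i|]//|]; first by rewrite mulr_ge0 // subr_ge0.
rewrite -hmg_sum // v'E wE xE; congr hmg; congr row_mx; rewrite scaler_sumr.
by apply: eq_bigr => i _; rewrite scalerA.
Qed.

(** The first k coordinates are the weights of the apexes, and the base point is scaled by the
    weight that they leave. *)
Lemma pyrE k n (B : set 'rV[R]_n) : polytope B -> B !=set0 ->
  [/\ polytope (pyr k B), pyr k B !=set0 & forall w, pyr k B w <->
    exists x, [/\ B x, forall i : 'I_k, 0 <= w 0 (lshift n i),
      \sum_(i < k) w 0 (lshift n i) <= 1 &
      forall j : 'I_n, w 0 (rshift k j) = (1 - \sum_(i < k) w 0 (lshift n i)) * x 0 j]].
Proof.
move=> Bpoly B0; elim: k => [|k [pyr_poly pyr_ne pyr_iff]].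
  split=> // w; split=> [Bw|[x [Bx _ _ wE]]].
    exists w; split=> //; first by case.
      by rewrite big_ord0 ler01.
    by move=> j; rewrite big_ord0 subr0 mul1r; congr (w 0 _); apply: val_inj.
  suff -> : (w : 'rV_n) = x by [].
  apply/rowP => j; have := wE j; rewrite big_ord0 subr0 mul1r => <-.
  by congr (w 0 _); apply: val_inj.
have [pyr_poly' iff'] := pyr1E pyr_poly pyr_ne.
have iffS (w : 'rV[R]_(1 + (k + n))) : pyr k.+1 B w <-> exists x, [/\ B x, forall i : 'I_k.+1, 0 <= w 0 (lshift n i),
      \sum_(i < k.+1) w 0 (lshift n i) <= 1 &
      forall j : 'I_n, w 0 (rshift k.+1 j) = (1 - \sum_(i < k.+1) w 0 (lshift n i)) * x 0 j].
  rewrite /= iff' {iff'}.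
  have e0 : lshift n (ord0 : 'I_k.+1) = lshift (k + n) (ord0 : 'I_1) :> 'I_(1 + (k + n)) by exact: val_inj.
  have eS (i : 'I_k) : lshift n (lift ord0 i) = rshift 1 (lshift n i) :> 'I_(1 + (k + n)) by exact: val_inj.
  have eR (j : 'I_n) : rshift k.+1 j = rshift 1 (rshift k j) :> 'I_(1 + (k + n)) by exact: val_inj.
  have sumE : \sum_(i < k.+1) w 0 (lshift n i) =
      w 0 (lshift (k + n) (ord0 : 'I_1)) + \sum_(i < k) w 0 (rshift 1 (lshift n i)).
    by rewrite big_ord_recl e0; congr (_ + _); apply: eq_bigr => i _; rewrite eS.
  rewrite sumE; split=> [[t [w' [t0 t1 /pyr_iff[x [Bx w'0 w's w'E]] wE]]]|[x [Bx w0 ws wE]]].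
    have w0E : w 0 (lshift (k + n) (ord0 : 'I_1)) = t by rewrite wE row_mxEl mxE.
    have wSE j : w 0 (rshift 1 j) = (1 - t) * w' 0 j by rewrite wE row_mxEr mxE.
    have sE : \sum_(i < k) w 0 (rshift 1 (lshift n i)) = (1 - t) * \sum_(i < k) w' 0 (lshift n i).
      by rewrite mulr_sumr; apply: eq_bigr => i _; rewrite wSE.
    exists x; split=> //.
    - move=> i; case: (unliftP ord0 i) => [j ->|->]; last by rewrite e0 w0E.
      by rewrite eS wSE mulr_ge0 // subr_ge0.
    - rewrite w0E sE -subr_ge0.
      have -> : 1 - (t + (1 - t) * \sum_(i < k) w' 0 (lshift n i)) =
        (1 - t) * (1 - \sum_(i < k) w' 0 (lshift n i)) by ring.
      by rewrite mulr_ge0 // subr_ge0.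
    - move=> j; rewrite eR wSE w'E w0E sE; ring.
  set t := w 0 (lshift (k + n) (ord0 : 'I_1)) in ws wE *.
  set s := \sum_(i < k) _ in ws wE *.
  have t0 : 0 <= t by rewrite /t -e0.
  have wS0 i : 0 <= w 0 (rshift 1 (lshift n i)) by rewrite -eS.
  have s0 : 0 <= s by apply: sumr_ge0.
  have t1 : t <= 1 by apply: le_trans ws; rewrite lerDl.
  (* At the new apex the lower pyramid has weight 0, and any of its points serves. *)
  have [t_eq1|t_neq1] := eqVneq t 1.
    have s_eq0 : s = 0.
      by apply/eqP; rewrite eq_le s0 andbT; move: ws; rewrite t_eq1 gerDl.
    have [w' w'pyr] := pyr_ne.
    exists t, w'; split=> //; rewrite t_eq1 subrr scale0r; apply/rowP => i.
    case: (split_ordP i) => j ->.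
      by rewrite row_mxEl mxE -t_eq1 /t; congr (w 0 _); apply: val_inj; rewrite /= (ord1 j).
    rewrite row_mxEr mxE; case: (split_ordP j) => [i' ->|j' ->].
      move/eqP: s_eq0; rewrite psumr_eq0 // => /allP /(_ i' (mem_index_enum _)) /eqP.
      exact.
    by rewrite -eR wE t_eq1 s_eq0 addr0 subrr mul0r.
  have t_lt1 : 0 < 1 - t by rewrite subr_gt0 lt_neqAle t_neq1.
  exists t, (\row_j (w 0 (rshift 1 j) / (1 - t))); split=> //.
    apply/pyr_iff; exists x.
    have -> : \sum_(i < k) (\row_j (w 0 (rshift 1 j) / (1 - t))) 0 (lshift n i) = s / (1 - t).
      by rewrite /s mulr_suml; apply: eq_bigr => i _; rewrite mxE.
    split=> //.
    - by move=> i; rewrite mxE divr_ge0 // ltW.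
    - by rewrite ler_pdivrMr // mul1r lerBrDl.
    - move=> j; rewrite mxE -eR wE; field.
      exact: lt0r_neq0.
  apply/rowP => i; case: (split_ordP i) => j ->.
    by rewrite row_mxEl mxE /t; congr (w 0 _); apply: val_inj; rewrite /= (ord1 j).
  by rewrite row_mxEr !mxE mulrCA divff ?mulr1 // lt0r_neq0.
split=> //; have [x Bx] := B0.
pose w : 'rV[R]_(k.+1 + n) := row_mx 0 x.
have E i : w 0 (lshift n i) = 0 by rewrite row_mxEl mxE.
have E' j : w 0 (rshift k.+1 j) = x 0 j by rewrite row_mxEr.
exists w; apply/iffS; exists x.
have -> : \sum_(i < k.+1) w 0 (lshift n i) = 0 by apply: big1 => i _; exact: E.
split=> [//|i||j].
- by rewrite E.
- by rewrite ler01.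
- by rewrite subr0 mul1r; exact: E'.
Qed.

End PyramidCoordinates.

(** * The pyramid over the prism as a slack set, and normal forms *)

Section StandardPyramids.
Variable R : realType.
Local Notation dot x g := ((x *m g) 0 0).

(** The cone over a product of two simplices consists of the pairs of nonnegative vectors with equal
    coordinate sums, and the common sum is the level. Apexes of pyramids are added as zeros of the
    equation. *)
Definition prism_eqn : 'cV[R]_(2 + 3) := col_mx (const_mx 1) (const_mx (- 1)).
Definition prism_level : 'cV[R]_(2 + 3) := col_mx (const_mx 1) 0.
Definition pyr_eqn k : 'cV[R]_(k + (2 + 3)) := col_mx 0 prism_eqn.
Definition pyr_level k : 'cV[R]_(k + (2 + 3)) := col_mx (const_mx 1) prism_level.

Lemma dot_ones_ge0 n (y : 'rV[R]_n) : nneg y -> 0 <= dot y (const_mx 1 : 'cV_n).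
Proof. by move=> yn; rewrite dot_ones sumr_ge0. Qed.

Lemma dot_ones_eq0 n (y : 'rV[R]_n) : nneg y -> dot y (const_mx 1 : 'cV_n) = 0 -> y = 0.
Proof.
move=> yn; rewrite dot_ones => /eqP; rewrite psumr_eq0 // => /allP y0.
by apply/rowP => i; rewrite mxE; apply/eqP; exact: y0 (mem_index_enum i).
Qed.

Lemma dot_prism_eqn (p : 'rV[R]_2) (q : 'rV[R]_3) :
  dot (row_mx p q) prism_eqn = dot p (const_mx 1 : 'cV_2) - dot q (const_mx 1 : 'cV_3).
Proof.
rewrite dot_row_col; congr (_ + _).
rewrite (_ : const_mx (- 1) = - const_mx 1 :> 'cV[R]_3) ?dotNr //.
by apply/matrixP => i j; rewrite !mxE.
Qed.

Lemma dot_prism_level (p : 'rV[R]_2) (q : 'rV[R]_3) :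
  dot (row_mx p q) prism_level = dot p (const_mx 1 : 'cV_2).
Proof. by rewrite dot_row_col dot0r addr0. Qed.

Lemma dot_pyr_eqn k (y : 'rV[R]_k) (z : 'rV[R]_(2 + 3)) :
  dot (row_mx y z) (pyr_eqn k) = dot z prism_eqn.
Proof. by rewrite dot_row_col dot0r add0r. Qed.

Lemma dot_pyr_level k (y : 'rV[R]_k) (z : 'rV[R]_(2 + 3)) :
  dot (row_mx y z) (pyr_level k) = dot y (const_mx 1 : 'cV_k) + dot z prism_level.
Proof. by rewrite dot_row_col. Qed.

Lemma triangular_prismE : @triangular_prism R = slack_set prism_eqn prism_level.
Proof.
rewrite /triangular_prism /product !simplexE; apply/seteqP; split.
  move=> _ [p [pn p1] [q [qn q1] <-]]; split; first exact/nneg_row_mx.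
    by rewrite dot_prism_eqn p1 q1 subrr.
  by rewrite dot_prism_level.
move=> w; rewrite -[w]hsubmxK; set p := lsubmx w; set q := rsubmx w.
move=> [/nneg_row_mx[pn qn]]; rewrite dot_prism_eqn dot_prism_level => /eqP.
rewrite subr_eq0 => /eqP pq p1; exists p; first by [].
by exists q => //; split=> //; rewrite -pq.
Qed.

Lemma prism_eqn_cone_eq0 (z : 'rV[R]_(2 + 3)) : nneg z -> dot z prism_eqn = 0 ->
  0 <= dot z prism_level /\ (dot z prism_level = 0 -> z = 0).
Proof.
rewrite -[z]hsubmxK => /nneg_row_mx[pn qn].
rewrite dot_prism_eqn dot_prism_level => /eqP; rewrite subr_eq0 => /eqP pq.
split=> [|p0]; first exact: dot_ones_ge0.
have := p0; rewrite pq => /(dot_ones_eq0 qn) ->.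
by rewrite (dot_ones_eq0 pn p0) row_mx0.
Qed.

Lemma rep_neq0 k (c l : 'cV[R]_k) n (M : 'M[R]_(k, n)) P :
  (0 < k)%N -> rep c l M P -> P !=set0.
Proof.
move=> k0 [pos -> [y [yp yc]]].
have yl : 0 < dot y l.
  apply: pos => // [i|]; first exact: ltW.
  by apply/eqP => /rowP /(_ (Ordinal k0)) /eqP; rewrite mxE gt_eqF.
exists (((dot y l)^-1 *: y) *m M), ((dot y l)^-1 *: y) => //; split.
- by apply: nnegZ => [|i]; rewrite ?invr_ge0 ltW.
- by rewrite dotZl yc mulr0.
- by rewrite dotZl mulVf // gt_eqF.
Qed.

Lemma prism_positive : exists z : 'rV[R]_(2 + 3), (forall i, 0 < z 0 i) /\ dot z prism_eqn = 0.
Proof.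
(* Two coordinates equal to 3 balance three coordinates equal to 2. *)
exists (row_mx (const_mx 3%:R) (const_mx 2%:R)); split=> [i|].
  by case: (split_ordP i) => j ->; rewrite ?row_mxEl ?row_mxEr mxE ltr0n.
rewrite dot_prism_eqn !dot_ones (eq_bigr (fun=> 3%:R)) => [|i _]; last by rewrite mxE.
rewrite [X in _ - X](eq_bigr (fun=> 2%:R)) => [|i _]; last by rewrite mxE.
by rewrite !sumr_const !card_ord -!mulrnA subrr.
Qed.

Lemma prism_rep : rep prism_eqn prism_level 1%:M (@triangular_prism R).
Proof.
split; last exact: prism_positive.
  move=> z zn zc; have [l0 l0_eq0] := prism_eqn_cone_eq0 zn zc => zneq0.
  by rewrite lt_neqAle l0 andbT eq_sym; apply: contra zneq0 => /eqP /l0_eq0 ->.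
rewrite triangular_prismE; apply/seteqP; split=> [z zS|_ [z zS <-]].
  by exists z; rewrite ?mulmx1.
by rewrite mulmx1.
Qed.

Lemma pyr_prismE k : pyr k (@triangular_prism R) = slack_set (pyr_eqn k) (pyr_level k).
Proof.
have prism0 : @triangular_prism R !=set0 by apply: rep_neq0 prism_rep.
have [_ _ pyr_iff] := pyrE k (rep_polytope prism_rep) prism0.
apply/seteqP; split=> [w /pyr_iff[x [xprism w0 ws wE]]|w].
  move: xprism; rewrite triangular_prismE => -[xn xc xl].
  have sE : \sum_(i < k) w 0 (lshift (2 + 3) i) = dot (lsubmx w) (const_mx 1 : 'cV_k).
    by rewrite dot_ones; apply: eq_bigr => i _; rewrite mxE.
  rewrite sE in ws wE.
  have zE : rsubmx w = (1 - dot (lsubmx w) (const_mx 1 : 'cV_k)) *: x.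
    by apply/rowP => j; rewrite mxE wE [RHS]mxE.
  rewrite -[w]hsubmxK zE; split.
  - apply/nneg_row_mx; split=> [i|]; first by rewrite mxE.
    by apply: nnegZ => //; rewrite subr_ge0.
  - by rewrite dot_pyr_eqn dotZl xc mulr0.
  - by rewrite dot_pyr_level dotZl xl mulr1 addrC subrK.
rewrite -[w]hsubmxK; move: (lsubmx w) (rsubmx w) => y z [/nneg_row_mx[yn zn]].
rewrite dot_pyr_eqn dot_pyr_level => zc zl; apply/pyr_iff.
have [l0 l0_eq0] := prism_eqn_cone_eq0 zn zc.
have sE : \sum_(i < k) row_mx y z 0 (lshift (2 + 3) i) = 1 - dot z prism_level.
  rewrite -zl addrK dot_ones; apply: eq_bigr => i _; by rewrite row_mxEl.
have [zl0|zl_neq0] := eqVneq (dot z prism_level) 0.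
  have [x xprism] := prism0; exists x; split=> // [i||j].
  - by rewrite row_mxEl.
  - by rewrite sE zl0 subr0.
  - by rewrite row_mxEr sE zl0 subr0 subrr mul0r (l0_eq0 zl0) mxE.
exists ((dot z prism_level)^-1 *: z); split=> [|i||j].
- rewrite triangular_prismE; split.
  + by apply: nnegZ; rewrite // invr_ge0.
  + by rewrite dotZl zc mulr0.
  + by rewrite dotZl mulVf.
- by rewrite row_mxEl.
- by rewrite sE gerBl.
- by rewrite row_mxEr sE subKr [X in _ * X]mxE mulrA divff // mul1r.
Qed.

Lemma pyr_rep k : rep (pyr_eqn k) (pyr_level k) 1%:M (pyr k (@triangular_prism R)).
Proof.
split.
- move=> w; rewrite -[w]hsubmxK; move: (lsubmx w) (rsubmx w) => y z /nneg_row_mx[yn zn].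
  rewrite dot_pyr_eqn dot_pyr_level => zc yzneq0.
  have [l0 l0_eq0] := prism_eqn_cone_eq0 zn zc.
  have y0 := dot_ones_ge0 yn; rewrite lt_neqAle addr_ge0 // andbT eq_sym.
  apply: contra yzneq0; rewrite paddr_eq0 // => /andP[/eqP /(dot_ones_eq0 yn) -> /eqP /l0_eq0 ->].
  by rewrite row_mx0.
- rewrite pyr_prismE; apply/seteqP; split=> [z zS|_ [z zS <-]].
    by exists z; rewrite ?mulmx1.
  by rewrite mulmx1.
- have [z [zp zc]] := prism_positive; exists (row_mx (const_mx 1) z); split=> [i|].
    by case: (split_ordP i) => j ->; rewrite ?row_mxEl ?row_mxEr ?mxE ?ltr01.
  by rewrite dot_pyr_eqn.
Qed.

Lemma card_pset_col m n (a : 'cV[R]_m) (b : 'cV[R]_n) : #|pset (col_mx a b)| = (#|pset a| + #|pset b|)%N.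
Proof.
rewrite -!sum1_card [LHS]big_mkcond [X in _ = (X + _)%N]big_mkcond [X in _ = (_ + X)%N]big_mkcond big_split_ord.
by congr addn; apply: eq_bigr => i _; rewrite !inE ?col_mxEu ?col_mxEd.
Qed.

Lemma card_nset_col m n (a : 'cV[R]_m) (b : 'cV[R]_n) : #|nset (col_mx a b)| = (#|nset a| + #|nset b|)%N.
Proof.
rewrite -!sum1_card [LHS]big_mkcond [X in _ = (X + _)%N]big_mkcond [X in _ = (_ + X)%N]big_mkcond big_split_ord.
by congr addn; apply: eq_bigr => i _; rewrite !inE ?col_mxEu ?col_mxEd.
Qed.

Lemma card_pset_const n (a : R) : #|pset (const_mx a : 'cV[R]_n)| = (if (0 < a)%R then n else 0)%N.
Proof.
case: ifP => a0; last by apply: eq_card0 => i; rewrite !inE mxE a0.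
by rewrite -[RHS]card_ord; apply: eq_card => i; rewrite !inE mxE a0.
Qed.

Lemma card_nset_const n (a : R) : #|nset (const_mx a : 'cV[R]_n)| = (if (a < 0)%R then n else 0)%N.
Proof.
case: ifP => a0; last by apply: eq_card0 => i; rewrite !inE mxE a0.
by rewrite -[RHS]card_ord; apply: eq_card => i; rewrite !inE mxE a0.
Qed.

Lemma card_pset_prism : #|pset prism_eqn| = 2%N.
Proof.
by rewrite card_pset_col !card_pset_const ltr01 ltNge ltW ?ltrN10.
Qed.

Lemma card_nset_prism : #|nset prism_eqn| = 3%N.
Proof.
by rewrite card_nset_col !card_nset_const ltrN10 ltNge ler01.
Qed.

Lemma card_pset_pyr k : #|pset (pyr_eqn k)| = 2%N.
Proof. by rewrite card_pset_col card_pset_prism; have [_ [-> _]] := card_signs0 R k. Qed.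

Lemma card_nset_pyr k : #|nset (pyr_eqn k)| = 3%N.
Proof. by rewrite card_nset_col card_nset_prism; have [_ [_ ->]] := card_signs0 R k. Qed.

Lemma card_ray_index_pyr k : #|ray_index (pyr_eqn k)| = (k + 6)%N.
Proof.
have := card_signs (pyr_eqn k).
rewrite card_ray_index card_pset_pyr card_nset_pyr; lia.
Qed.

Lemma card_ray_index_prism : #|ray_index prism_eqn| = 6%N.
Proof.
have := card_signs prism_eqn.
rewrite card_ray_index card_pset_prism card_nset_prism; lia.
Qed.

Lemma rank_kermx_row k (c : 'cV[R]_k) : c != 0 -> \rank (kermx c) = k.-1.
Proof.
move=> c0; rewrite mxrank_ker; suff -> : \rank c = 1%N by rewrite subn1.
by apply/eqP; rewrite eqn_leq rank_leq_col lt0n mxrank_eq0.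
Qed.

Lemma pset_neq0 k (c : 'cV[R]_k) : (0 < #|pset c|)%N -> c != 0.
Proof.
by apply: contraTneq => ->; have [_ [-> _]] := card_signs0 R k.
Qed.

Lemma perm_of_fibers k (T : eqType) (f g : 'I_k -> T) :
  (forall x, #|[pred i | f i == x]| = #|[pred i | g i == x]|) ->
  exists s : 'S_k, forall i, f (s i) = g i.
Proof.
move=> fg; have /tuple_permP[s sE] : perm_eq [tuple g i | i < k] [tuple f i | i < k].
  apply/allP => x _ /=; apply/eqP.
  have cE (h : 'I_k -> T) : count_mem x [tuple h i | i < k] = #|[pred i | h i == x]|.
    rewrite /= count_map cardE /enum_mem size_filter count_filter.
    by apply: eq_count => i; rewrite /= !inE andbT.
  by rewrite !cE fg.
exists s => i; have := congr1 (fun t => nth (g i) t i) sE.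
by rewrite !nth_mktuple tnth_mktuple => ->.
Qed.

(** Permutations and positive scalings of the coordinates preserve the orthant. *)
Lemma rep_monomial k (c c' l : 'cV[R]_k) n (M : 'M[R]_(k, n)) P (s : 'S_k) (w : 'I_k -> R) :
  rep c l M P -> (forall i, 0 < w i) -> (forall i, w i * c (s i) 0 = c' i 0) ->
  exists l' (M' : 'M[R]_(k, n)), rep c' l' M' P.
Proof.
move=> P_rep w0 wc.
pose E : 'M[R]_k := \matrix_(i, j) (w i * (j == s i)%:R).
have EE (y : 'rV[R]_k) i : (y *m E) 0 (s i) = y 0 i * w i.
  rewrite mxE (bigD1 i) //= big1 ?addr0 => [|j ji]; first by rewrite mxE eqxx mulr1.
  by rewrite mxE (inj_eq perm_inj) eq_sym (negPf ji) !mulr0.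
have EE' (y : 'rV[R]_k) j : (y *m E) 0 j = y 0 ((s^-1)%g j) * w ((s^-1)%g j).
  by rewrite -{1}[j](permKV s) EE.
have Ec (y : 'rV[R]_k) : dot (y *m E) c = dot y c'.
  rewrite !dotE (reindex_inj (@perm_inj _ s)) /=; apply: eq_bigr => i _.
  by rewrite EE -mulrA wc.
exists (E *m l), (E *m M); apply: (rep_change P_rep).
- move=> y yn yc'; split; first by move=> j; rewrite EE' mulr_ge0 // ltW.
    by rewrite Ec.
  apply: contraNneq => yE0; apply/eqP/rowP => i; rewrite [RHS]mxE.
  have := EE y i; rewrite yE0 mxE => /esym/eqP; rewrite mulf_eq0 (gt_eqF (w0 i)) orbF.
  by move/eqP.
- move=> y [yn yc yl]; pose y' : 'rV[R]_k := \row_i (y 0 (s i) / w i).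
  have y'E : y' *m E = y.
    by apply/rowP => j; rewrite EE' mxE permKV divfK // gt_eqF.
  exists y'; split=> [i||]; last by rewrite y'E.
    by rewrite mxE divr_ge0 // ltW.
  by rewrite -Ec y'E.
- have [_ _ [y [yp yc]]] := P_rep; pose y' : 'rV[R]_k := \row_i (y 0 (s i) / w i).
  have y'E : y' *m E = y.
    by apply/rowP => j; rewrite EE' mxE permKV divfK // gt_eqF.
  exists y'; split=> [i|]; last by rewrite -Ec y'E.
  by rewrite mxE divr_gt0.
Qed.

(** A permutation matches the signs of [c] and [c'], after which the quotients of their nonzero
    coefficients are positive scaling factors. *)
Lemma rep_normal_form k (c c' l : 'cV[R]_k) n (M : 'M[R]_(k, n)) P :
  rep c l M P -> #|pset c| = #|pset c'| -> #|nset c| = #|nset c'| ->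
  exists l' (M' : 'M[R]_(k, n)), rep c' l' M' P.
Proof.
move=> P_rep cp cn.
have cz : #|zset c| = #|zset c'|.
  by have := card_signs c; have := card_signs c'; rewrite cp cn; lia.
have fibers (x : R) : #|[pred i | Num.sg (c i 0) == x]| = #|[pred i | Num.sg (c' i 0) == x]|.
  have setE (A B : {set 'I_k}) (p q : pred 'I_k) : #|A| = #|B| -> p =i A -> q =i B -> #|p| = #|q|.
    by move=> AB pA qB; rewrite (eq_card pA) (eq_card qB).
  have [->|x0] := eqVneq x 0.
    by apply: (setE _ _ _ _ cz) => i; rewrite !inE sgr_eq0.
  have [->|x1] := eqVneq x 1.
    by apply: (setE _ _ _ _ cp) => i; rewrite !inE sgr_cp0.
  have [->|xN1] := eqVneq x (- 1).
    by apply: (setE _ _ _ _ cn) => i; rewrite !inE sgr_cp0.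
  have none (a : R) : (Num.sg a == x) = false.
    by apply/negP => /eqP ax; move: x0 x1 xN1; rewrite -ax; case: sgrP; rewrite eqxx.
  by rewrite !eq_card0 // => i; rewrite !inE none.
have [s sE] := perm_of_fibers fibers.
pose w i := if c' i 0 == 0 then 1 else c' i 0 / c (s i) 0.
have c0 i : (c (s i) 0 == 0) = (c' i 0 == 0) by rewrite -sgr_eq0 sE sgr_eq0.
apply: (rep_monomial P_rep (s := s) (w := w)) => i; rewrite /w; case: eqVneq => [ci|ci].
- by rewrite ltr01.
- rewrite -sgr_gt0 sgrM sgrV sE -expr2 sqr_sg ci; exact: ltr01.
- by rewrite ci mul1r; apply/eqP; rewrite c0 ci.
- by rewrite divfK // c0.
Qed.

(** Both polytopes are sections of one pointed cone, at the levels [l] and [l']; rescaling along the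
    rays of the cone is the projective map. *)
Lemma rep_proj_equiv k (c l l' : 'cV[R]_k) m n (M : 'M[R]_(k, m)) (M' : 'M[R]_(k, n)) P P' :
  rep c l M P -> rep c l' M' P' -> rep_kernel c l M 0 -> rep_kernel c l' M' 0 -> proj_equiv P P'.
Proof.
move=> P_rep P'_rep ker ker'.
have factor k1 k2 (A : 'M[R]_(k, k1)) (B : 'M[R]_(k, k2)) :
    (forall y : 'rV[R]_k, dot y c = 0 -> y *m A = 0 -> exists t, y = t *: 0) ->
    exists C, forall y : 'rV[R]_k, dot y c = 0 -> y *m B = y *m A *m C.
  move=> A_inj; have [|C CE] := @mx_factor _ _ _ _ (kermx c *m A) (kermx c *m B).
    move=> a; rewrite (mulmxA a (kermx c) A) (mulmxA a (kermx c) B) => /A_inj [|t ->].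
      by rewrite -mulmxA mulmx_ker mulmx0 mxE.
    by rewrite scaler0 mul0mx.
  by exists C => y /sub_kermx_dot /submxP[a ->]; rewrite -(mulmxA a) CE -!mulmxA.
have [_ _ inj] := ker; have [_ _ inj'] := ker'.
have [A AE] := factor _ _ _ (row_mx l' M') inj.
have [B BE] := factor _ _ _ (row_mx l M) inj'.
have half m' n' (l1 l2 : 'cV[R]_k) (M1 : 'M[R]_(k, m')) (M2 : 'M[R]_(k, n')) Q1 Q2 A1 B1 :
    rep c l1 M1 Q1 -> rep c l2 M2 Q2 ->
    (forall y : 'rV[R]_k, dot y c = 0 -> y *m row_mx l2 M2 = y *m row_mx l1 M1 *m A1) ->
    (forall y : 'rV[R]_k, dot y c = 0 -> y *m row_mx l1 M1 = y *m row_mx l2 M2 *m B1) ->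
    forall x, Q1 x -> exists2 z, Q2 z & proj_rel A1 B1 x z.
  move=> [_ Q1E _] [pos2 Q2E _] AE1 BE1 x; rewrite Q1E => -[y [yn yc yl1] <-].
  have y0 : y != 0 by apply: contra_eqN yl1 => /eqP ->; rewrite dot0l eq_sym oner_eq0.
  have yl2 := pos2 y yn yc y0.
  have yS : slack_set c l2 ((dot y l2)^-1 *: y).
    split; [by apply: nnegZ; rewrite ?invr_ge0 // ltW | by rewrite dotZl yc mulr0 |].
    by rewrite dotZl mulVf // gt_eqF.
  exists (((dot y l2)^-1 *: y) *m M2); first by rewrite Q2E; exists ((dot y l2)^-1 *: y).
  exists (dot y l2) => //; have [_ _ yl'] := yS.
  rewrite (hmg_row_mx M1 yl1) (hmg_row_mx M2 yl') -AE1 // -!scalemxAl -BE1 //.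
  by rewrite scalerA divff ?scale1r // gt_eqF.
exists A, B; split=> [x|x P'x]; first exact: half P_rep P'_rep AE BE x.
by have [y Py /proj_rel_sym xy] := half _ _ _ _ _ _ _ _ _ _ P'_rep P_rep BE AE x P'x; exists y.
Qed.

(** The extension at level [l] is a projective image of the standard pyramid, which
    [proj_equiv_comb] turns into the combinatorial equivalence that is asked for. *)
Lemma rep_projection_of_pyramid k (l : 'cV[R]_(k + (2 + 3))) n (M : 'M[R]_(_, n)) P :
  rep (pyr_eqn k) l M P -> projection_of_pyramid_over_prism (k + 2) P.
Proof.
move=> P_rep; exists (k + (2 + 3))%N, (slack_set (pyr_eqn k) l), (mulmx^~ M); split.
- exact: rep_polytope (rep_slack_set P_rep).
- rewrite addnK; apply: proj_equiv_comb; apply: rep_proj_equiv (slack_set_kernel _ _) (slack_set_kernel _ _).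
    exact: rep_slack_set P_rep.
  exact: pyr_rep.
- by exists M, 0 => y; rewrite addr0.
- by have [_ -> _] := P_rep.
Qed.

Lemma pyr_eqnE k (j : 'I_(k + (2 + 3))) :
  pyr_eqn k j 0 = if (j < k)%N then 0 else if (j < k + 2)%N then 1 else - 1.
Proof.
case: (split_ordP j) => i ->.
  by rewrite col_mxEu mxE.
rewrite col_mxEd (_ : (rshift k i < k + 2)%N = (i < 2)%N); last by rewrite /= ltn_add2l.
case: (split_ordP i) => i' ->.
  by rewrite col_mxEu mxE.
by rewrite col_mxEd mxE.
Qed.

(* The chain sets to 0 the coordinates 0, ..., k, k + 2, k + 3, k + 4, one at a time. *)
Lemma pyr_chain k : exists F : nat -> set 'rV[R]_(k + (2 + 3)),
  (forall i, (i <= k + 4)%N -> face (pyr k (@triangular_prism R)) (F i)) /\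
  (forall i, (i < k + 4)%N -> F i `<=` F i.+1 /\ F i <> F i.+1).
Proof.
have S_rep := pyr_rep k; set c := pyr_eqn k in S_rep *; set l := pyr_level k in S_rep *.
set S := pyr k _ in S_rep *.
have SE : S = slack_set c l by exact: pyr_prismE.
(* Coordinate k + 1 is never killed, hence the shift by one after it. Once the k + 4 others are 0,
   the equation makes it 0 too and the face is empty. *)
pose killed t (j : 'I_(k + (2 + 3))) := (if j <= k then j < t else (k.+1 < j) && (j <= t))%N.
pose Z t : set 'rV[R]_(k + (2 + 3)) := [set y | S y /\ forall j, killed t j -> y 0 j = 0].
have Z_face t : face S (Z t).
  pose g : 'cV[R]_(k + (2 + 3)) := \col_j (killed t j)%:R.
  have g0 (y : 'rV[R]_(k + (2 + 3))) i : nneg y -> 0 <= y 0 i * g i 0.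
    by move=> yn; rewrite mxE mulr_ge0 ?ler0n.
  have := rep_face S_rep (slack_set_kernel c l) (dot0l g).
  rewrite (_ : [set _ | _ in _] = Z t); first by apply=> y [yn _ _]; rewrite dotE sumr_ge0 // => i _; exact: g0.
  apply/seteqP; split=> [_ [y [yS yg] <-]|y [yS y0]].
    rewrite mulmx1; split; first by rewrite SE.
    have [yn _ _] := yS; move/eqP: yg; rewrite dotE psumr_eq0 => [/allP yg j kj|i _]; last exact: g0.
    by have := yg j (mem_index_enum _); rewrite mxE kj mulr1 => /eqP.
  exists y; last by rewrite mulmx1.
  split; first by rewrite -SE.
  by rewrite dotE big1 // => j _; rewrite mxE; case: (boolP (killed t j)) => [/y0 ->|_]; rewrite ?mul0r ?mulr0.
have Zdec t : Z t.+1 `<=` Z t.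
  move=> y [Sy y0]; split=> // j kj; apply: y0; move: kj; rewrite /killed; case: ifP => _; first exact: ltnW.
  by case/andP=> -> /leqW.
have Zstrict t : (t < k + 4)%N -> Z t.+1 <> Z t.
  move=> lt_t.
  (* A ray that survives the first t steps but not the next: the apex t, then a pair with the
     positive coordinate k, then pairs with the positive coordinate k + 1. *)
  have [p [pI p0 [j [kj pj]]]] : exists p, [/\ p \in ray_index c,
      forall j, killed t j -> (j != p.1) && (j != p.2) &
      exists j, killed t.+1 j /\ (j == p.1) || (j == p.2)].
    have lt1 : (t < k + (2 + 3))%N by lia.
    have [lt_tk|le_kt] := ltnP t k.
      exists (Ordinal lt1, Ordinal lt1); split.
      - by rewrite inE /= pyr_eqnE /= lt_tk !eqxx.
      - move=> j; rewrite -!val_eqE /= /killed; case: ifP; lia.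
      - exists (Ordinal lt1); rewrite eqxx /killed /= ltnW // ltnSn //.
    have lt2 : (k + 4 < k + (2 + 3))%N by lia.
    have [eq_tk|lt_kt] := eqVneq t k.
      exists (Ordinal lt1, Ordinal lt2); split.
      - rewrite inE /= !pyr_eqnE /=; apply/orP; right.
        have -> : (t < k)%N = false by lia.
        have -> : (t < k + 2)%N = true by lia.
        have -> : (k + 4 < k)%N = false by lia.
        have -> : (k + 4 < k + 2)%N = false by lia.
        by rewrite ltr01 ltrN10.
      - move=> j; rewrite -!val_eqE /= /killed; case: ifP; lia.
      - exists (Ordinal lt1); have tk : (t <= k)%N by lia.
        by rewrite eqxx /killed /= tk ltnSn.
    have lt3 : (k.+1 < k + (2 + 3))%N by lia.
    have lt4 : (t.+1 < k + (2 + 3))%N by lia.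
    exists (Ordinal lt3, Ordinal lt4); split.
    - rewrite inE /= !pyr_eqnE /=; apply/orP; right.
      have -> : (k.+1 < k)%N = false by lia.
      have -> : (k.+1 < k + 2)%N = true by lia.
      have -> : (t.+1 < k)%N = false by lia.
      have -> : (t.+1 < k + 2)%N = false by lia.
      by rewrite ltr01 ltrN10.
    - move=> j; rewrite -!val_eqE /= /killed; case: ifP; lia.
    - exists (Ordinal lt4); rewrite eqxx orbT /killed /=; split=> //.
      case: ifP; lia.
  pose q : ray_type c := exist _ p pI.
  move=> eqZ; suff /(_ j kj) : forall j, killed t.+1 j -> nray l q 0 j = 0.
    by move/eqP; rewrite (nray_eq0 S_rep) ray_eq0 // -negb_or pj.
  suff [] : Z t.+1 (nray l q) by [].
  rewrite eqZ; split; first by rewrite SE; exact: nray_slack S_rep q.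
  by move=> i ki; apply/eqP; rewrite (nray_eq0 S_rep) ray_eq0 // p0.
(* The sets [Z t] decrease, so the chain is read backwards. *)
exists (fun i => Z (k + 4 - i)%N); split=> [i _|i lt_i]; first exact: Z_face.
have -> : (k + 4 - i = (k + 4 - i.+1).+1)%N by lia.
split; first exact: Zdec.
by apply: Zstrict; lia.
Qed.

End StandardPyramids.

(** * Projections of the pyramid: Desarguian hexagon or embedded prism *)

Section ProjectionsOfStandardPyramids.
Variable R : realType.
Local Notation dot x g := ((x *m g) 0 0).

Section Dichotomy.

(** If z + a + b = 4 then z + ab <= 4, so four slack coordinates cannot produce six vertices. *)
Lemma hexagon_facets_neq4 n (H : set 'rV[R]_n) : hexagon H -> ~ (facets H #= `I_4).
Proof.
move=> [Hpoly Hdim HV] H4.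
have H0 := affine_rank_neq0 (isT : (0 < 3)%N) Hdim.
have [_ [//|c [l [M [H_rep _]]]]] := rep_exists Hpoly H0 H4 Hdim.
have := rep_card_vertices H_rep HV; have := card_signs c; rewrite card_ray_index.
by move: #|_| #|_| #|_| => a b e; nia.
Qed.

Lemma rep_kernel1_rank k (c l : 'cV[R]_k) n (M : 'M[R]_(k, n)) P u r :
  rep c l M P -> rep_kernel c l M u -> u != 0 -> \rank (kermx c) = r.+1 -> affine_rank P r.
Proof.
move=> P_rep [uc uM uall] u0 cr; have := rep_rank P_rep.
suff -> : \rank (kermx c *m row_mx l M) = r by [].
have := mxrank_mul_ker (kermx c) (row_mx l M); rewrite cr.
suff -> : \rank (kermx c :&: kermx (row_mx l M))%MS = 1%N by rewrite addn1 => -[].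
apply/eqP; rewrite eqn_leq; apply/andP; split.
  apply: (@leq_trans (\rank u)); last exact: rank_leq_row.
  apply/mxrankS/row_subP => i.
  have := row_sub i (kermx c :&: kermx (row_mx l M))%MS.
  rewrite {2}/kermx sub_capmx => /andP[/sub_kermx_dot yc /sub_kermxP yM].
  by apply/sub_rVP; exact: uall.
rewrite lt0n mxrank_eq0; apply: contraNneq u0 => cap0.
rewrite -submx0 -cap0 sub_capmx; apply/andP; split; last exact/sub_kermxP.
exact/sub_kermx_dot.
Qed.

Variables (k : nat) (l : 'cV[R]_(k + (2 + 3))) (n : nat) (M : 'M[R]_(k + (2 + 3), n)).
Variable P : set 'rV[R]_n.
Hypothesis P_rep : rep (pyr_eqn R k) l M P.

(** The suffix [C] stands for the coordinates of the apexes, and [B] for those of the base prism. *)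
Let lC := usubmx l.
Let lB := dsubmx l.
Let MC := usubmx M.
Let MB := dsubmx M.
Let H : set 'rV[R]_n := [set z *m MB | z in slack_set (prism_eqn R) lB].

Let dot_l (y : 'rV[R]_k) (z : 'rV[R]_(2 + 3)) : dot (row_mx y z) l = dot y lC + dot z lB.
Proof. by rewrite -[l]vsubmxK dot_row_col. Qed.

Let mul_M (y : 'rV[R]_k) (z : 'rV[R]_(2 + 3)) : row_mx y z *m M = y *m MC + z *m MB.
Proof. by rewrite -[M]vsubmxK mul_row_col. Qed.

Let slackE (y : 'rV[R]_k) (z : 'rV[R]_(2 + 3)) : slack_set (pyr_eqn R k) l (row_mx y z) <->
  [/\ nneg y, nneg z, dot z (prism_eqn R) = 0 & dot y lC + dot z lB = 1].
Proof.
split=> [[/nneg_row_mx[yn zn]]|[yn zn zc zl]].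
  by rewrite dot_pyr_eqn dot_l.
by split; rewrite ?dot_pyr_eqn ?dot_l //; exact/nneg_row_mx.
Qed.

Let base_slack z : slack_set (prism_eqn R) lB z -> slack_set (pyr_eqn R k) l (row_mx 0 z).
Proof.
by move=> [zn zc zl]; apply/slackE; split=> //; [move=> i; rewrite mxE | rewrite dot0l add0r].
Qed.

Let base_pos z : nneg z -> dot z (prism_eqn R) = 0 -> z != 0 -> 0 < dot z lB.
Proof.
move=> zn zc z0; have [pos _ _] := P_rep.
have := pos (row_mx 0 z); rewrite dot_l dot0l add0r; apply.
- by apply/nneg_row_mx; split=> // i; rewrite mxE.
- by rewrite dot_pyr_eqn.
- by rewrite row_mx_eq0 negb_and z0 orbT.
Qed.

Let base_ge0 z : nneg z -> dot z (prism_eqn R) = 0 -> 0 <= dot z lB.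
Proof.
move=> zn zc; have [->|z0] := eqVneq z 0; first by rewrite dot0l.
by rewrite ltW // base_pos.
Qed.

Let base_rep : rep (prism_eqn R) lB MB H.
Proof. by split; [exact: base_pos | | exact: prism_positive]. Qed.

Let base_sub : H `<=` P.
Proof.
have [_ PE _] := P_rep; move=> _ [z zS <-]; rewrite PE; exists (row_mx 0 z).
  exact: base_slack.
by rewrite mul_M mul0mx add0r.
Qed.

Let apex_pos i : 0 < lC i 0.
Proof.
have [pos _ _] := P_rep.
have := pos (row_mx (delta_mx 0 i) 0); rewrite dot_l dot0l addr0 dot_delta; apply.
- by apply/nneg_row_mx; split=> j; rewrite mxE //= ler0n.
- by rewrite dot_pyr_eqn dot0l.
- rewrite row_mx_eq0 negb_and; apply/orP; left; apply/eqP => /rowP /(_ i) /eqP.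
  by rewrite !mxE !eqxx oner_eq0.
Qed.

Lemma base_ray_index (p : ray_type (prism_eqn R)) :
  (rshift k (val p).1, rshift k (val p).2) \in ray_index (pyr_eqn R k).
Proof.
have := valP p; rewrite !inE /= !col_mxEd => /orP[/andP[-> /eqP ->]|->]; first by rewrite eqxx.
by rewrite orbT.
Qed.

Definition base_ray (p : ray_type (prism_eqn R)) : ray_type (pyr_eqn R k) :=
  exist (fun q => q \in ray_index (pyr_eqn R k)) _ (base_ray_index p).

Let base_ray_inj : injective base_ray.
Proof.
move=> p q /(congr1 val) [/addnI e1 /addnI e2].
by apply: val_inj; apply: injective_projections; apply: val_inj.
Qed.

Let nray_base p : nray l (base_ray p) *m M = nray lB p *m MB.
Proof.
have rE : ray (pyr_eqn R k) (val (base_ray p)) = row_mx 0 (ray (prism_eqn R) (val p)).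
  apply/rowP => j; rewrite rayE /=; case: (split_ordP j) => i ->.
    by rewrite row_mxEl !eq_lrshift [RHS]mxE; case: ifP => _; rewrite ?mulr0 ?addr0.
  by rewrite row_mxEr rayE !col_mxEd !eq_rshift.
by rewrite /nray rE dot_l dot0l add0r -!scalemxAl mul_M mul0mx add0r.
Qed.

Hypothesis P_rank : affine_rank P (k + 3).
Hypothesis P_vertices : vertices P #= `I_(k + 6).

(** There are exactly as many rays as vertices, so the projection neither loses nor identifies any
    of them. *)
Let P_nray : injective (fun p : ray_type (pyr_eqn R k) => nray l p *m M) /\ range (fun p : ray_type (pyr_eqn R k) => nray l p *m M) = vertices P.
Proof.
apply: card_eq_range; first exact: rep_vertices P_rep.
by rewrite card_ray_type card_ray_index_pyr.
Qed.

Let base_nray_inj : injective (fun p : ray_type (prism_eqn R) => nray lB p *m MB).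
Proof.
have [inj _] := P_nray; move=> p q /=; rewrite -!nray_base => eqpq.
exact/base_ray_inj/inj.
Qed.

Let base_vertices_sub : range (fun p : ray_type (prism_eqn R) => nray lB p *m MB) `<=` vertices P.
Proof.
by have [_ <-] := P_nray; move=> _ [p _ <-]; exists (base_ray p).
Qed.

Let card_base_vertices : range (fun p : ray_type (prism_eqn R) => nray lB p *m MB) #= `I_6.
Proof. by have := card_range base_nray_inj; rewrite card_ray_type card_ray_index_prism. Qed.

Let prism_rank : \rank (kermx (prism_eqn R)) = 4%N.
Proof. by rewrite rank_kermx_row // pset_neq0 // card_pset_prism. Qed.

Let pyr_rank : \rank (kermx (pyr_eqn R k)) = (k + 3).+1.
Proof. by rewrite rank_kermx_row ?pset_neq0 ?card_pset_pyr //; lia. Qed.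

Section Kernel.
Variable u : 'rV[R]_(k + (2 + 3)).
Hypothesis u_ker : rep_kernel (pyr_eqn R k) l M u.

Let base_kernel z : dot z (prism_eqn R) = 0 -> z *m row_mx lB MB = 0 ->
  exists t, row_mx 0 z = t *: u.
Proof.
move=> zc; rewrite mul_mx_row -[X in _ = X]row_mx0 => /eq_row_mx[zl zM].
have [_ _ uall] := u_ker; apply: uall; first by rewrite dot_pyr_eqn.
rewrite mul_mx_row mul_M mul0mx add0r zM.
have -> : row_mx (0 : 'rV_k) z *m l = 0.
  by apply/matrixP => i j; rewrite !ord1 dot_l dot0l add0r zl mxE.
by rewrite row_mx0.
Qed.

(** A nonzero apex coordinate of [u] keeps its multiples out of the span of the base, on which the
    projection is then injective. *)
Lemma prism_of_kernel : lsubmx u != 0 -> has_prism_on_vertices P.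
Proof.
move=> uC; exists (range (fun p : ray_type (prism_eqn R) => nray lB p *m MB)); split=> //.
have <- : H = convex_hull (range (fun p : ray_type (prism_eqn R) => nray lB p *m MB)).
  by rewrite convex_hull_range; exact: rep_hull base_rep.
apply: proj_equiv_comb; apply: rep_proj_equiv base_rep (prism_rep R) _ _.
  split; rewrite ?dot0l ?mul0mx // => z zc /(base_kernel zc)[t zE].
  exists 0; rewrite scaler0.
  have /eqP : t *: lsubmx u = 0 by rewrite -linearZ /= -zE row_mxKl.
  rewrite scaler_eq0 (negPf uC) orbF => /eqP t0; move/eqP: zE.
  by rewrite t0 scale0r row_mx_eq0 => /andP[_ /eqP].
exact: slack_set_kernel.
Qed.

Hypothesis u_neq0 : u != 0.
Hypothesis uC : lsubmx u = 0.

Let uB := rsubmx u.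
Let uE : u = row_mx 0 uB.
Proof. by rewrite -uC hsubmxK. Qed.

Let uB_ker : rep_kernel (prism_eqn R) lB MB uB.
Proof.
have [uc uM uall] := u_ker; split.
- by rewrite -(dot_pyr_eqn (lsubmx u)) hsubmxK.
- have : row_mx (u *m l) (uB *m MB) = row_mx 0 0.
    by rewrite row_mx0 -uM mul_mx_row {3}uE mul_M mul0mx add0r.
  case/eq_row_mx => ul uMB; rewrite mul_mx_row uMB -[RHS]row_mx0; congr row_mx.
  apply/matrixP => i j; rewrite !ord1.
  by have := congr1 (fun A : 'M_1 => A 0 0) ul; rewrite {1}uE dot_l dot0l add0r.
- move=> z zc /(base_kernel zc)[t zE]; exists t.
  by rewrite -[z](row_mxKr (0 : 'rV[R]_k)) zE linearZ.
Qed.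

Let base_hexagon : hexagon H.
Proof.
split.
- exact: rep_polytope base_rep.
- apply: (rep_kernel1_rank base_rep uB_ker _ prism_rank).
  by apply: contraNneq u_neq0 => uB0; rewrite uE uB0 row_mx0.
suff -> : vertices H = range (fun p : ray_type (prism_eqn R) => nray lB p *m MB) by [].
apply/seteqP; split; first exact: rep_vertices base_rep.
move=> v Bv; have /faceP[g g0 vE] := base_vertices_sub Bv.
have Hv : H v by have [p _ <-] := Bv; rewrite (rep_hull base_rep); exact: (hull_mem (fun p : ray_type (prism_eqn R) => nray lB p *m MB)).
apply/faceP; exists g => [x /base_sub|]; first exact: g0.
apply/seteqP; split=> [_ ->|x [/base_sub Px xg]]; last by rewrite vE.
by split=> //; have [] : (P `&` [set x | dot (hmg x) g = 0]) v by rewrite -vE.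
Qed.

(** The prism gives an extension with at most five facets. By [extension_cases] for d = 2, fewer
    would mean that the hexagon has four facets. *)
Let base_desarguian : desarguian_hexagon H.
Proof.
split; first exact: base_hexagon.
have [Hpoly Hdim HV] := base_hexagon.
have [j le_j Hj] : exists2 j, (j <= 2 + 3)%N & has_extension H j.
  by apply: rep_extension base_rep _; rewrite prism_rank.
have [Hxc minxc] := xcP Hj.
have le5 : (xc H <= 5)%N by apply: leq_trans (minxc j Hj) le_j.
have [ge4 cases] := extension_cases Hdim (HV : vertices H #= `I_(2 + 4)) Hxc le5.
case: cases => [H4|[]//]; apply/eqP; rewrite eqn_leq le5 ltn_neqAle ge4 andbT.
by apply/eqP => xc4; apply: (hexagon_facets_neq4 base_hexagon); move: H4; rewrite -xc4.
Qed.

(* The coordinates of the apexes vanish on the kernel: they descend to [P] as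
   barycentric coordinates of a pyramid over the image [H] of the prism. *)
Lemma pyramid_of_kernel : pyramid_over_desarguian_hexagon P.
Proof.
exists k, n, H; split; first exact: base_desarguian.
have [_ PE _] := P_rep; have [uc uM uall] := u_ker.
have [H_poly [h0 Hh0]] : polytope H /\ H !=set0.
  by split; [exact: rep_polytope base_rep | exact: rep_neq0 base_rep].
have [_ _ pyr_iff] := pyrE k H_poly (ex_intro _ h0 Hh0).
(* In a point (y, z) at level 1, apex i has weight [y i * lC i], and [dot z lB] is the weight left
   to the base. *)
pose G : 'M[R]_(k + (2 + 3), k + n) := block_mx (diag_mx lC^T) 0 0 MB.
have GE y z : row_mx y z *m G = row_mx (\row_i (y 0 i * lC i 0)) (z *m MB).
  rewrite mul_row_block !mulmx0 addr0 add0r; congr row_mx.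
  by apply/rowP => i; rewrite mul_mx_diag !mxE.
have uG : u *m G = 0.
  have [_ uBM _] := uB_ker; move: uBM; rewrite mul_mx_row -[X in _ = X]row_mx0 => /eq_row_mx[_ uBM].
  rewrite uE GE uBM -[RHS]row_mx0; congr row_mx.
  by apply/rowP => i; rewrite !mxE mul0r.
have [N GN] : exists N, forall y : 'rV[R]_(k + (2 + 3)), dot y (pyr_eqn R k) = 0 ->
    y *m G = y *m row_mx l M *m N.
  have [|N NE] := @mx_factor _ _ _ _ (kermx (pyr_eqn R k) *m row_mx l M) (kermx (pyr_eqn R k) *m G).
    move=> a; rewrite (mulmxA a (kermx _) (row_mx l M)) (mulmxA a (kermx _) G) => /uall[|t ->].
      by rewrite -mulmxA mulmx_ker mulmx0 mxE.
    by rewrite -scalemxAl uG scaler0.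
  by exists N => y /sub_kermx_dot /submxP[a ->]; rewrite -(mulmxA a) NE -!mulmxA.
pose f x := hmg x *m N.
have fE y z : slack_set (pyr_eqn R k) l (row_mx y z) -> f (row_mx y z *m M) =
    row_mx (\row_i (y 0 i * lC i 0)) (z *m MB).
  by move=> [_ yc yl]; rewrite /f (hmg_row_mx M yl) -GN // GE.
have sumE (y : 'rV_k) : \sum_i y 0 i * lC i 0 = dot y lC by rewrite dotE.
exists f; split.
  exists (dsubmx N), (usubmx N) => x.
  by rewrite /f -{1}[N]vsubmxK /hmg mul_row_col mul1mx addrC.
have P_elim x : P x -> exists y z, slack_set (pyr_eqn R k) l (row_mx y z) /\ x = row_mx y z *m M.
  by rewrite PE => -[w wS <-]; exists (lsubmx w), (rsubmx w); rewrite hsubmxK.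
split.
- move=> _ /P_elim[y [z [yzS ->]]]; rewrite /= fE //; apply/pyr_iff.
  have /slackE[yn zn zc zl] := yzS.
  have sE : \sum_(i < k) row_mx (\row_i (y 0 i * lC i 0)) (z *m MB) 0 (lshift n i) = dot y lC.
    by rewrite -sumE; apply: eq_bigr => i _; rewrite row_mxEl mxE.
  have zlE : 1 - dot y lC = dot z lB by rewrite -zl addrAC subrr add0r.
  have pos i : 0 <= row_mx (\row_i (y 0 i * lC i 0)) (z *m MB) 0 (lshift n i).
    by rewrite row_mxEl mxE mulr_ge0 // ltW.
  have le1 : dot y lC <= 1 by rewrite -subr_ge0 zlE base_ge0.
  have [z0|z_neq0] := eqVneq z 0.
    exists h0; rewrite sE; split=> // j.
    by rewrite row_mxEr zlE z0 dot0l mul0mx mul0r mxE.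
  have zl0 := base_pos zn zc z_neq0.
  exists (((dot z lB)^-1 *: z) *m MB); rewrite sE; split=> //.
    exists ((dot z lB)^-1 *: z) => //; split.
    + by apply: nnegZ => //; rewrite invr_ge0 ltW.
    + by rewrite dotZl zc mulr0.
    + by rewrite dotZl mulVf // gt_eqF.
  by move=> j; rewrite row_mxEr zlE -scalemxAl [X in _ * X]mxE mulrA divff ?mul1r // gt_eqF.
- move=> x x' /set_mem /P_elim[y [z [yzS ->]]] /set_mem /P_elim[y' [z' [yzS' ->]]].
  rewrite !fE // => /eq_row_mx[/rowP eqy eqz]; rewrite !mul_M eqz; congr (_ *m _ + _).
  apply/rowP => i; have e (v : 'rV[R]_k) : (\row_i (v 0 i * lC i 0)) 0 i = v 0 i * lC i 0.
    by rewrite mxE.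
  have := eqy i; rewrite !e; apply: mulIf.
  by rewrite gt_eqF.
move=> w /pyr_iff[x [[z [zn zc zl] <-] w0 ws wE]].
pose s := \sum_(i < k) w 0 (lshift n i).
pose y : 'rV[R]_k := \row_i (w 0 (lshift n i) / lC i 0).
have yl : dot y lC = s.
  by rewrite -sumE; apply: eq_bigr => i _; rewrite mxE divfK // gt_eqF.
have yzS : slack_set (pyr_eqn R k) l (row_mx y ((1 - s) *: z)).
  apply/slackE; split.
  - by move=> i; rewrite mxE divr_ge0 // ltW.
  - by apply: nnegZ => //; rewrite subr_ge0.
  - by rewrite dotZl zc mulr0.
  - by rewrite yl dotZl zl mulr1 addrC subrK.
exists (row_mx y ((1 - s) *: z) *m M); first by rewrite PE; exists (row_mx y ((1 - s) *: z)).
rewrite fE //; apply/rowP => i; case: (split_ordP i) => j ->.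
  by rewrite row_mxEl [LHS]mxE [X in X * _]mxE divfK // gt_eqF.
by rewrite row_mxEr wE -scalemxAl [LHS]mxE.
Qed.

End Kernel.

Lemma pyramid_or_prism : pyramid_over_desarguian_hexagon P \/ has_prism_on_vertices P.
Proof.
have [u u0 u_ker] := rep_kernel1 P_rep pyr_rank P_rank.
have [uC|uC] := eqVneq (lsubmx u) 0; last by right; exact: prism_of_kernel u_ker uC.
by left; exact: pyramid_of_kernel u_ker u0 uC.
Qed.

End Dichotomy.

End ProjectionsOfStandardPyramids.

(** * Replacing an extension that loses a ray; the bound d >= 2 *)

Section LostRays.
Variable R : realType.
Local Notation dot x g := ((x *m g) 0 0).

Lemma card_pset_opp k (c : 'cV[R]_k) : #|pset (- c)| = #|nset c|.
Proof. by apply: eq_card => i; rewrite !inE mxE oppr_gt0. Qed.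

Lemma card_nset_opp k (c : 'cV[R]_k) : #|nset (- c)| = #|pset c|.
Proof. by apply: eq_card => i; rewrite !inE mxE oppr_lt0. Qed.

Lemma rep_projection k0 k (c l : 'cV[R]_k) n (M : 'M[R]_(k, n)) P :
  rep c l M P -> k = (k0 + (2 + 3))%N ->
  (#|pset c| = 2 /\ #|nset c| = 3)%N \/ (#|pset c| = 3 /\ #|nset c| = 2)%N ->
  exists (l' : 'cV[R]_(k0 + (2 + 3))) (M' : 'M[R]_(k0 + (2 + 3), n)), rep (pyr_eqn R k0) l' M' P.
Proof.
move=> P_rep kE; subst k; case=> [[cp cn]|[cp cn]].
  by apply: (rep_normal_form P_rep); rewrite ?card_pset_pyr ?card_nset_pyr.
by apply: (rep_normal_form (rep_opp P_rep)); rewrite ?card_pset_opp ?card_nset_opp ?card_pset_pyr ?card_nset_pyr.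
Qed.

Lemma positive_point k (c : 'cV[R]_k) : (0 < #|pset c|)%N -> (0 < #|nset c|)%N ->
  exists y : 'rV[R]_k, (forall i, 0 < y 0 i) /\ dot y c = 0.
Proof.
move=> /card_gt0P[i0]; rewrite inE => ci0 /card_gt0P[j0]; rewrite inE => cj0.
pose A := \sum_(i | 0 < c i 0) c i 0; pose B := \sum_(i | c i 0 < 0) - c i 0.
have A0 : 0 < A.
  by rewrite /A (bigD1 i0) //= ltr_pwDl // sumr_ge0 // => i /andP[/ltW].
have B0 : 0 < B.
  by rewrite /B (bigD1 j0) //= ltr_pwDl ?oppr_gt0 // sumr_ge0 // => i /andP[/ltW]; rewrite oppr_ge0.
(* Each sign gets the total mass of the other one, so that both contributions are [A * B] up to
   sign. *)
exists (\row_i (if 0 < c i 0 then B else if c i 0 < 0 then A else 1)); split=> [i|].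
  by rewrite mxE; case: ifP => // _; case: ifP => // _; rewrite ltr01.
rewrite dotE (bigID (fun i => 0 < c i 0)) /=.
rewrite (eq_bigr (fun i => B * c i 0)) => [|i ci]; last by rewrite mxE ci.
rewrite -mulr_sumr -/A (bigID (fun i => c i 0 < 0)) /= [X in _ + (_ + X)]big1 ?addr0.
  rewrite (eq_bigr (fun i => - A * - c i 0)) => [|i /andP[ci ci']]; last first.
    by rewrite mxE (negPf ci) ci' mulrNN.
  rewrite -mulr_sumr (eq_bigl (fun i => c i 0 < 0)) -/B ?mulNr 1?[B * A]mulrC ?subrr //.
  by move=> i /=; rewrite -leNgt; apply/andb_idl; exact: ltW.
by move=> i; rewrite -!leNgt -eq_le => /eqP->; rewrite mulr0.
Qed.

(* If the only ray lost in the projection is [(i, j)], its coordinate [j] turns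
   into an apex: the part of the cone beyond [c i' * y i' = - c j * y j] is
   redundant. *)
Lemma rep_lost_ray k (c l : 'cV[R]_k) n (M : 'M[R]_(k, n)) P u i j :
  rep c l M P -> rep_kernel c l M u -> #|pset c| = 2%N -> (1 < #|nset c|)%N ->
  0 < c i 0 -> c j 0 < 0 -> 0 < u 0 j -> (forall m, m != i -> m != j -> u 0 m <= 0) ->
  exists (c' l' : 'cV[R]_k) (M' : 'M[R]_(k, n)),
    [/\ rep c' l' M' P, #|pset c'| = 2%N & #|nset c'| = #|nset c|.-1].
Proof.
move=> P_rep u_ker cp cn ci cj uj uN.
have [i' [ci' i'i psetE]] : exists i', [/\ 0 < c i' 0, i' != i & forall m, 0 < c m 0 -> m = i \/ m = i'].
  have : #|pset c :\ i| = 1%N by have := cardsD1 i (pset c); rewrite inE ci cp => -[].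
  case/eqP/cards1P => i' pE; exists i'.
  have : i' \in pset c :\ i by rewrite pE inE.
  rewrite !inE => /andP[ne ci']; split=> // m cm.
  have [->|mi] := eqVneq m i; [by left | right].
  by have : m \in pset c :\ i; [rewrite !inE mi | rewrite pE inE => /eqP].
have i'j : i' != j by apply: contraTneq ci' => ->; rewrite -leNgt ltW.
have ij : i != j by apply: contraTneq ci => ->; rewrite -leNgt ltW.
have [a a0 aE] : exists2 a, 0 < a & a * c i' 0 = - c j 0.
  by exists (- c j 0 / c i' 0); rewrite ?divfK ?divr_gt0 ?oppr_gt0 // gt_eqF.
pose c' : 'cV[R]_k := \col_m (if m == j then 0 else c m 0).
have c'p : #|pset c'| = 2%N.
  rewrite -cp; apply: eq_card => m; rewrite !inE mxE; case: eqP => // ->.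
  by rewrite ltxx ltNge ltW.
have c'n : #|nset c'| = #|nset c|.-1.
  rewrite (cardsD1 j (nset c)) inE cj add1n /=; apply: eq_card => m; rewrite !inE mxE.
  by case: eqP => //=; rewrite ltxx.
(* The unit vector at j, a ray of the new cone, goes to a positive multiple of the ray (i', j) of
   the old one; the other rays are unchanged, and only (i, j) disappears. *)
pose E : 'M[R]_k := 1%:M + a *: delta_mx j i'.
have EE (y : 'rV[R]_k) m : (y *m E) 0 m = y 0 m + a * y 0 j * (m == i')%:R.
  rewrite mulmxDr mulmx1 [LHS]mxE -scalemxAr [X in _ + X]mxE; congr (_ + _).
  rewrite -mulrA; congr (_ * _); rewrite mxE (bigD1 j) //= big1 ?addr0 ?mxE ?eqxx // => q qj.
  by rewrite mxE (negPf qj) mulr0.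
have Ec (y : 'rV[R]_k) : dot (y *m E) c = dot y c'.
  rewrite -mulmxA; congr ((y *m _) _ _); apply/colP => m.
  rewrite mulmxDl mul1mx -scalemxAl [LHS]mxE [X in _ + X]mxE [RHS]mxE.
  have -> : (delta_mx j i' *m c) m 0 = (m == j)%:R * c i' 0.
    rewrite mxE (bigD1 i') //= big1 ?addr0 => [|q /negPf qi']; first by rewrite mxE eqxx andbT.
    by rewrite mxE qi' andbF mul0r.
  by case: eqP => [->|_]; rewrite ?mul0r ?mulr0 ?addr0 // mul1r aE subrr.
exists c', (E *m l), (E *m M); split=> //; apply: (rep_change P_rep).
- move=> y yn yc'; split; last 1 first.
  + apply: contraNneq => /rowP yE0; apply/eqP/rowP => m; rewrite [RHS]mxE.
    have := yE0 m; rewrite EE mxE => /eqP.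
    by rewrite paddr_eq0 ?mulr_ge0 ?ler0n // 1?ltW // => /andP[/eqP].
  + by move=> m; rewrite EE addr_ge0 // mulr_ge0 ?ler0n // mulr_ge0 // ltW.
  + by rewrite Ec.
- have [uc uM _] := u_ker.
  (* The image of [E] is the part of the cone where [a * x j <= x i']. *)
  have lift (x : 'rV[R]_k) : nneg x -> dot x c = 0 -> a * x 0 j <= x 0 i' ->
      exists y : 'rV[R]_k, [/\ nneg y, dot y c' = 0 & y *m E = x].
    move=> xn xc ax; pose y := x - (a * x 0 j) *: delta_mx 0 i'.
    have yE m : y 0 m = x 0 m - a * x 0 j * (m == i')%:R.
      by rewrite 3!mxE [X in _ * X]mxE eqxx.
    have yEx : y *m E = x.
      by apply/rowP => m; rewrite EE !yE [j == i']eq_sym (negPf i'j) mulr0 subr0 subrK.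
    exists y; split=> //; last by rewrite -Ec yEx.
    by move=> m; rewrite yE; case: eqP => [->|_]; [rewrite mulr1 subr_ge0 | rewrite mulr0 subr0].
  move=> x [xn xc xl]; have [ax|ax] := leP (a * x 0 j) (x 0 i').
    by have [y [yn yc' yE]] := lift x xn xc ax; exists y; split=> //; rewrite yE.
  (* A point x beyond the wall is moved along [- u], which does not change its image in P, until it
     meets the wall. The denominator is positive since u j > 0 >= u i'. *)
  pose den := a * u 0 j - u 0 i'.
  have den0 : 0 < den by rewrite subr_gt0; apply: le_lt_trans (uN i' i'i i'j) _; rewrite mulr_gt0.
  have [t t0 tden] : exists2 t, 0 < t & t * (a * u 0 j - u 0 i') = a * x 0 j - x 0 i'.
    exists ((a * x 0 j - x 0 i') / den); first by rewrite divr_gt0 // subr_gt0.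
    by rewrite divfK // gt_eqF.
  pose x' := x - t *: u.
  have x'E m : x' 0 m = x 0 m - t * u 0 m by rewrite 3!mxE.
  have eqx' : x' 0 i' = a * x' 0 j.
    by rewrite !x'E; move: tden; lra.
  have x'n0 m : m != i -> m != j -> 0 <= x' 0 m.
    by move=> mi mj; rewrite x'E subr_ge0; apply: le_trans (xn m); rewrite mulr_ge0_le0 ?uN // ltW.
  have x'j : 0 <= x' 0 j by have := x'n0 i' i'i i'j; rewrite eqx' pmulr_rge0.
  have x'c : dot x' c = 0 by rewrite dotBl dotZl xc uc mulr0 subrr.
  (* At the wall the terms of i' and j cancel in the equation [c]. The remaining coefficients other
     than that of i are nonpositive, so the term of i is nonnegative. *)
  have x'i : 0 <= x' 0 i.
    move: x'c; rewrite dotE (bigD1 i) //= (bigD1 i') //= (bigD1 j) /=; last by rewrite eq_sym ij eq_sym i'j.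
    have -> : x' 0 i' * c i' 0 = - (x' 0 j * c j 0) by rewrite eqx' mulrAC aE mulNr mulrC.
    set S := \sum_(q | _) _ => x'c.
    have S0 : S <= 0.
      apply: sumr_le0 => q /andP[/andP[qi qi'] qj]; rewrite mulr_ge0_le0 ?x'n0 // leNgt.
      by apply/negP => /psetE[] qE; move: qi qi'; rewrite qE eqxx.
    have : x' 0 i * c i 0 = - S by move: x'c; lra.
    by move=> E'; rewrite -(pmulr_lge0 _ ci) E' oppr_ge0.
  have x'n : nneg x'.
    by move=> m; have [->//|mi] := eqVneq m i; have [->//|mj] := eqVneq m j; exact: x'n0.
  have [|y [yn yc' yE]] := lift x' x'n x'c; first by rewrite eqx'.
  exists y; split=> //; rewrite yE /x' mulmxBl -scalemxAl uM scaler0 subr0 //.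
- by apply: positive_point; rewrite ?c'p // c'n -subn1 subn_gt0.
Qed.

Lemma two_signs (a b g h : R) : 0 < g -> 0 < h -> a * g + b * h = 0 -> a = 0 /\ b = 0 \/ a * b < 0.
Proof.
move=> g0 h0 ab; have [a0|a0] := eqVneq a 0.
  left; split=> //; move/eqP: ab; rewrite a0 mul0r add0r mulf_eq0 (gt_eqF h0) orbF.
  by move/eqP.
right; have bE : b = - (a * g / h).
  by apply: (mulIf (lt0r_neq0 h0)); rewrite mulNr divfK ?gt_eqF //; apply/eqP; rewrite -addr_eq0 addrC ab.
rewrite bE mulrN oppr_lt0 mulrA mulrA -expr2 -mulrA mulr_gt0 ?divr_gt0 //.
by rewrite exprn_even_gt0.
Qed.

(** In dimension at most 1 three vertices satisfy a nontrivial linear relation. Evaluated at the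
    functional exposing one of them, it shows that the other two coefficients vanish or have
    opposite signs; three numbers cannot have pairwise opposite signs. *)
Lemma dimension_ge2 n (P : set 'rV[R]_n) d N :
  dimension P d -> vertices P #= `I_N -> (3 <= N)%N -> (2 <= d)%N.
Proof.
move=> Pd PN N3; rewrite leqNgt; apply/negP => d2.
have [v v_inj vE] := card_ordP PN.
pose w (i : 'I_3) := v (widen_ord N3 i).
have w_inj : injective w by move=> i j /v_inj /(congr1 (@nat_of_ord N)) eq_ij; exact: val_inj.
have w_vert i : vertices P (w i) by rewrite -vE; exists (widen_ord N3 i).
have ex i : exists g : 'cV[R]_(1 + n), forall j, (j == i -> dot (hmg (w j)) g = 0) /\
    (j != i -> 0 < dot (hmg (w j)) g).
  have /faceP[g g0 wE] := w_vert i; exists g => j.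
  have Pwj : P (w j) by exact: face_sub (w_vert j) _ erefl.
  split=> [/eqP ->|ji]; first by have [] : (P `&` [set x | dot (hmg x) g = 0]) (w i) by rewrite -wE.
  rewrite lt_neqAle g0 // andbT eq_sym; apply: contra ji => /eqP gj; apply/eqP/w_inj.
  by have : [set w i] (w j) by rewrite wE.
have /affine_rankP[q [_ /eqP rq qspan]] := Pd.
have [a a0 aw] : exists2 a : 'rV[R]_3, a != 0 & a *m hmg_mx w = 0.
  have : kermx (hmg_mx w) != 0.
    rewrite -mxrank_eq0 mxrank_ker -lt0n subn_gt0.
    apply: (@leq_ltn_trans d.+1); last by rewrite ltnS.
    rewrite -rq; apply: mxrankS; apply/row_subP => i; rewrite rowK; apply: qspan.
    exact: face_sub (w_vert i) _ erefl.
  by rewrite -nz_row_eq0 => nz; exists (nz_row (kermx (hmg_mx w))) => //; apply/sub_kermxP; exact: nz_row_sub.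
have [g gP] : exists g : 'I_3 -> 'cV[R]_(1 + n), forall i j,
    (j == i -> dot (hmg (w j)) (g i) = 0) /\ (j != i -> 0 < dot (hmg (w j)) (g i)).
  by exists (fun i => projT1 (cid (ex i))) => i; exact: projT2 (cid (ex i)).
have rel i : \sum_(j | j != i) a 0 j * dot (hmg (w j)) (g i) = 0.
  have : dot (a *m hmg_mx w) (g i) = 0 by rewrite aw dot0l.
  rewrite (mulmx_sum_row a) dot_suml (bigD1 i) //= dotZl rowK.
  rewrite ((gP i i).1 _) // mulr0 add0r => sum0; rewrite -[RHS]sum0.
  by apply: eq_bigr => j _; rewrite dotZl rowK.
have pos i j : j != i -> 0 < dot (hmg (w j)) (g i) by exact: (gP i j).2.
pose i0 : 'I_3 := inord 0; pose i1 : 'I_3 := inord 1; pose i2 : 'I_3 := inord 2.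
have all3 (i : 'I_3) : [|| i == i0, i == i1 | i == i2].
  by rewrite -!val_eqE /= !inordK //; case: i => [[|[|[|]]]].
have [n01 n02 n12] : [/\ i0 != i1, i0 != i2 & i1 != i2].
  by split; rewrite -val_eqE /= !inordK.
have pair i j m : i != j -> i != m -> j != m -> (forall q, [|| q == i, q == j | q == m]) ->
    a 0 j = 0 /\ a 0 m = 0 \/ a 0 j * a 0 m < 0.
  move=> nij nim njm all; have := rel i; rewrite (bigD1 j) 1?eq_sym //= (bigD1 m); last first.
    by rewrite eq_sym nim eq_sym njm.
  rewrite big1 /= => [|s /andP[/andP[/negPf si /negPf sj] /negPf sm]]; last first.
    by have := all s; rewrite si sj sm.
  by rewrite addr0; apply: two_signs; apply: pos; rewrite eq_sym.
have c0 := pair i0 i1 i2 n01 n02 n12 all3.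
have c1 : a 0 i0 = 0 /\ a 0 i2 = 0 \/ a 0 i0 * a 0 i2 < 0.
  by apply: (pair i1); rewrite // 1?eq_sym // => s; have := all3 s; rewrite orbCA.
have c2 : a 0 i0 = 0 /\ a 0 i1 = 0 \/ a 0 i0 * a 0 i1 < 0.
  by apply: (pair i2); rewrite // 1?eq_sym // => s; have := all3 s; rewrite orbA orbC.
have [z0 z1 z2] : [/\ a 0 i0 = 0, a 0 i1 = 0 & a 0 i2 = 0].
  move: c0 c1 c2; set x := a 0 i0; set y := a 0 i1; set z := a 0 i2.
  case=> [[-> ->]|yz]; first by rewrite mulr0 ltxx => -[[]|].
  case=> [[_ z0]|xz]; first by rewrite z0 mulr0 ltxx in yz.
  case=> [[_ y0]|xy]; first by rewrite y0 mul0r ltxx in yz.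
  exfalso; have : 0 < (x * y) * (x * z) by rewrite nmulr_rgt0.
  rewrite mulrACA -expr2 => xyz; have : x ^+ 2 * (y * z) <= 0 by rewrite mulr_ge0_le0 ?sqr_ge0 // ltW.
  by rewrite leNgt xyz.
move/eqP: a0; apply; apply/rowP => i; rewrite mxE.
by have /or3P[/eqP->|/eqP->|/eqP->] := all3 i.
Qed.

End LostRays.

(** * From facet and vertex counts to projections of the pyramid, and back *)

Section ProjectionsOfSlackCones.
Variable R : realType.
Local Notation dot x g := ((x *m g) 0 0).

Lemma projection_of_rep k d (c l : 'cV[R]_k) n (M : 'M[R]_(k, n)) P :
  rep c l M P -> k = (d + 3)%N ->
  (#|pset c| = 2 /\ #|nset c| = 3)%N \/ (#|pset c| = 3 /\ #|nset c| = 2)%N ->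
  projection_of_pyramid_over_prism d P.
Proof.
move=> P_rep kd cpn.
have kE : k = (d - 2 + (2 + 3))%N by have := card_signs c; lia.
have [l' [M' P_rep']] := rep_projection P_rep kE cpn.
have := rep_projection_of_pyramid P_rep'.
by have -> : (d - 2 + 2 = d)%N by lia.
Qed.

Definition ray_support k (c : 'cV[R]_k) (p : ray_type c) : {set 'I_k} := [set (val p).1; (val p).2].

Lemma ray_support_sub k (c : 'cV[R]_k) (p : ray_type c) (A : {set 'I_k}) :
  (forall i, i \in A -> ray c (val p) 0 i <> 0) -> A \subset ray_support p.
Proof.
move=> Ap; apply/fintype.subsetP => i /Ap /eqP; rewrite ray_eq0 ?(valP p) // negb_and !negbK.
by rewrite !inE.
Qed.

(** The equation is (a - 1)(b - 1) = 2; it expresses that there is one ray more than coordinates. *)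
Lemma factor_succ a b : (a * b = a + b + 1)%N -> (a = 2 /\ b = 3)%N \/ (a = 3 /\ b = 2)%N.
Proof.
case: a => [|[|[|[|a]]]]; try lia.
case: b => [|[|b]]; nia.
Qed.

(** The equation is (a - 1)(b - 1) = 3; it expresses that there are two rays more than
    coordinates. *)
Lemma factor_succ2 a b : (a * b = a + b + 2)%N -> (a = 2 /\ b = 4)%N \/ (a = 4 /\ b = 2)%N.
Proof.
case: a => [|[|[|[|[|a]]]]]; try lia.
case: b => [|[|b]]; nia.
Qed.

(** A support has at most two elements, so it misses a negative coordinate of [u]. It contains all
    the positive ones only if they are two and form the support, which leaves a single candidate for
    a lost ray. *)
Lemma rep_many_negative k d (c l : 'cV[R]_k) n (M : 'M[R]_(k, n)) P u :
  rep c l M P -> rep_kernel c l M u -> k = (d + 3)%N -> vertices P #= `I_(d + 4) ->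
  (1 < #|pset u^T|)%N -> (2 < #|nset u^T|)%N -> projection_of_pyramid_over_prism d P.
Proof.
move=> P_rep u_ker kd PV u2 u3.
have PI := rep_card_vertices P_rep PV.
have supp2 (p : ray_type c) : (#|ray_support p| <= 2)%N by rewrite cards2; case: eqP.
have neg (p : ray_type c) : exists2 i, u 0 i < 0 & ray c (val p) 0 i = 0.
  apply: contrapT => no; have /subset_leq_card : nset u^T \subset ray_support p.
    apply: ray_support_sub => i; rewrite inE mxE => ui ri; apply: no.
    by exists i.
  by rewrite leqNgt (leq_ltn_trans _ u3).
pose lost (p : ray_type c) := pset u^T \subset ray_support p.
have kept p : ~~ lost p -> vertices P (nray l p *m M) /\
    forall q : ray_type c, nray l q *m M = nray l p *m M -> q = p.
  move=> nlost; apply: (ray_vertex P_rep u_ker); right; split; last exact: neg.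
  apply: contrapT => no; move/negP: nlost; apply; apply: ray_support_sub => i.
  by rewrite inE mxE => ui ri; apply: no; exists i.
have Ic := card_ray_index c; have kc := card_signs c.
have standard : #|ray_index c| = (d + 4)%N -> projection_of_pyramid_over_prism d P.
  move=> cI; apply: (projection_of_rep P_rep kd); apply: factor_succ.
  by move: Ic kc kd; rewrite cI; move: #|zset _| #|pset _| #|nset _| => z a b; clear; lia.
have [/existsP[p0 p0lost]|/existsPn nolost] := boolP [exists p, lost p]; last first.
  apply: standard; apply/eqP; rewrite eqn_leq PI andbT -card_ray_type.
  apply: (card_sup_range (f := fun p : ray_type c => nray l p *m M)) PV.
    by move=> p q; apply: (kept q (nolost q)).2.
  by move=> _ [p _ <-]; exact: (kept p (nolost p)).1.
have suppE (p : ray_type c) : lost p -> ray_support p = pset u^T.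
  move=> pl; apply/esym/eqP; rewrite eqEcard; apply/andP; split=> //.
  exact: leq_trans (supp2 p) u2.
have lostE p : lost p -> p = p0.
  move=> pl; apply: val_inj; apply: (ray_inj (valP p) (valP p0)) => i.
  have eqs : ray_support p = ray_support p0 by rewrite !suppE.
  move/eqP; rewrite ray_eq0 ?(valP p) // => ip; apply/eqP; rewrite ray_eq0 ?(valP p0) //.
  move: ip; rewrite -!negb_or.
  have E (q : ray_type c) : (i == (val q).1) || (i == (val q).2) = (i \in ray_support q) by rewrite !inE.
  by rewrite !E eqs.
(* The rays other than [p0] have distinct vertices of P as images. *)
have le5 : (#|ray_index c| <= d + 5)%N.
  have le4 : (#|{: {p : ray_type c | p != p0}}| <= d + 4)%N.
    apply: (card_sup_range (f := fun p : {p : ray_type c | p != p0} => nray l (val p) *m M)) PV.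
      move=> p q /= eqpq; apply: val_inj; apply: (kept (val q) _).2 => //.
      by apply: contra (valP q) => /lostE/eqP.
    move=> _ [p _ <-]; apply: (kept (val p) _).1.
    by apply: contra (valP p) => /lostE/eqP.
  have cE : #|{: {p : ray_type c | p != p0}}| = #|ray_index c|.-1.
    by rewrite -card_ray_type -(cardC1 p0) card_sig.
  by move: le4; rewrite cE; case: #|ray_index c| => [|x] //=; rewrite [(d + 5)%N]addnS ltnS.
have [/standard//|neq4] := eqVneq #|ray_index c| (d + 4)%N.
have eq5 : #|ray_index c| = (d + 5)%N by move: PI le5 neq4; lia.
have supp0 := suppE p0 p0lost.
have ne12 : (val p0).1 != (val p0).2.
  by have := u2; rewrite -supp0 cards2; case: eqP.
have [cp1 cp2] : 0 < c (val p0).1 0 /\ c (val p0).2 0 < 0.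
  by have := valP p0; rewrite inE (negPf ne12) andbF => /andP.
have usign i : (0 < u 0 i) = (i == (val p0).1) || (i == (val p0).2).
  have <- : (i \in pset u^T) = (0 < u 0 i) by rewrite inE mxE.
  by rewrite -supp0 !inE.
have u1 : 0 < u 0 (val p0).1 by rewrite usign eqxx.
have u2' : 0 < u 0 (val p0).2 by rewrite usign eqxx orbT.
have uN m : m != (val p0).1 -> m != (val p0).2 -> u 0 m <= 0.
  by move=> m1 m2; rewrite leNgt usign negb_or m1.
have : (#|pset c| = 2 /\ #|nset c| = 4)%N \/ (#|pset c| = 4 /\ #|nset c| = 2)%N.
  apply: factor_succ2; move: Ic kc kd; rewrite eq5.
  by move: #|zset _| #|pset _| #|nset _| => z a b; clear; lia.
case=> [[cp cn]|[cp cn]].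
  have [|c' [l' [M' [P_rep' c'p c'n]]]] := rep_lost_ray P_rep u_ker cp _ cp1 cp2 u2' uN.
    by rewrite cn.
  by apply: (projection_of_rep P_rep' kd); left; rewrite c'p c'n cn.
(* Here it is the positive coefficients that are four; for [- c] the two coordinates of [p0]
   exchange their roles. *)
have u_ker' : rep_kernel (- c) l M u.
  have [uc uM uall] := u_ker; split=> //; first by rewrite dotNr uc oppr0.
  by move=> y; rewrite dotNr => /eqP; rewrite oppr_eq0 => /eqP; exact: uall.
have [|||||c' [l' [M' [P_rep' c'p c'n]]]] :=
    rep_lost_ray (i := (val p0).2) (j := (val p0).1) (rep_opp P_rep) u_ker' _ _ _ _ u1 _.
- by rewrite card_pset_opp cn.
- by rewrite card_nset_opp cp.
- by rewrite mxE oppr_gt0.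
- by rewrite mxE oppr_lt0.
- by move=> m m2 m1; exact: uN.
by apply: (projection_of_rep P_rep' kd); left; rewrite c'p c'n card_nset_opp cp.
Qed.

Lemma rep_kernel_opp k (c l : 'cV[R]_k) n (M : 'M[R]_(k, n)) u :
  rep_kernel c l M u -> rep_kernel c l M (- u).
Proof.
case=> uc uM uall; split; rewrite ?dotNl ?mulNmx ?uc ?uM ?oppr0 // => y yc yM.
by have [t ->] := uall y yc yM; exists (- t); rewrite scalerN scaleNr opprK.
Qed.

(** With p positive and q negative coordinates of [u], the condition pq <= p + q is what bounds the
    facet count of [rep_facets] by the number of coordinates. *)
Lemma rep_facets_or_projection k d (c l : 'cV[R]_k) n (M : 'M[R]_(k, n)) P :
  rep c l M P -> \rank (kermx c) = (d + 2)%N -> k = (d + 3)%N -> (1 <= d)%N ->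
  dimension P d -> vertices P #= `I_(d + 4) ->
  (exists2 j, (j <= d + 3)%N & facets P #= `I_j) \/ projection_of_pyramid_over_prism d P.
Proof.
move=> P_rep cr kd d1 Pd PV.
have [u u0 u_ker] := rep_kernel1 P_rep (etrans cr (addn2 d)) Pd.
have [[i ui] [j uj]] := rep_kernel_signs P_rep u_ker u0.
have up : (0 < #|pset u^T|)%N by apply/card_gt0P; exists i; rewrite inE mxE.
have un : (0 < #|nset u^T|)%N by apply/card_gt0P; exists j; rewrite inE mxE.
have uc := card_signs u^T.
have [le_prod|lt_prod] := leqP (#|pset u^T| * #|nset u^T|) (#|pset u^T| + #|nset u^T|).
  left; have [q le_q Pq] := rep_facets P_rep u_ker Pd d1.
  exists q => //; apply: leq_trans le_q _; rewrite -kd.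
  by move: uc le_prod; move: #|zset _| #|pset _| #|nset _| => a b e; lia.
(* Now (p - 1)(q - 1) >= 2. After replacing [u] by its opposite if needed, there are at least three
   negative and two positive coordinates. *)
right; have [un3|un2] := ltnP 2 #|nset u^T|.
  apply: (rep_many_negative P_rep u_ker kd PV) => //.
  by move: lt_prod; case: #|pset u^T| up => [|[|a]]; lia.
have opT : (- u)^T = - u^T by apply/matrixP => a b; rewrite !mxE.
apply: (rep_many_negative P_rep (rep_kernel_opp u_ker) kd PV); rewrite opT ?card_pset_opp ?card_nset_opp.
  by move: lt_prod; case: #|nset u^T| un => [|[|a]]; lia.
by move: lt_prod un un2; move: #|pset u^T| #|nset u^T| => a b; nia.
Qed.

(** With d = k + 2, the isomorphism gives Q rank r >= k + 4, at most k + 5 facets and at most k + 6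
    vertices, while P requires k + 6 of them. All bounds are therefore attained, and [factor_succ]
    identifies the slack cone of Q. *)
Lemma projection_extension n (P : set 'rV[R]_n) d :
  dimension P d -> vertices P #= `I_(d + 4) -> projection_of_pyramid_over_prism d P ->
  (exists2 j, (j <= d + 3)%N & has_extension P j) /\
  (pyramid_over_desarguian_hexagon P \/ has_prism_on_vertices P).
Proof.
move=> Pd PV; have d2 : (2 <= d)%N by apply: dimension_ge2 Pd PV _; lia.
have [k dk] : exists k, d = (k + 2)%N by exists (d - 2)%N; lia.
subst d; move=> [m [Q [f [Qpoly Qcomb f_aff PE]]]].
rewrite addnK in Qcomb; have [Phi [Phi_bij Phi_mono]] := Qcomb.
have S_rep := pyr_rep R k; have S_ker := slack_set_kernel (pyr_eqn R k) (pyr_level R k).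
have [r Qr] := affine_rank_exists Q.
have le_r : (k + 4 <= r)%N.
  have [F [F_face F_lt]] := pyr_chain R k.
  exact: (comb_equiv_rank Phi_bij Phi_mono F_face F_lt Qr).
have r2 : (2 <= r)%N by lia.
have [j le_j Qj] := comb_equiv_facets Phi_bij Phi_mono S_rep S_ker Qr r2.
have [v le_v Qv] := comb_equiv_vertices Phi_bij Phi_mono S_rep S_ker.
rewrite card_ray_index_pyr in le_v.
split.
  by exists j; [lia | exists m, Q, f].
have Q0 : Q !=set0 by apply: affine_rank_neq0 Qr; lia.
have [le_rj Q_rep_ex] := rep_exists Qpoly Q0 Qj Qr.
have [|c [l [M [Q_rep cr]]]] := Q_rep_ex; first by lia.
have [M' [P_rep _]] := rep_affine Q_rep f_aff; rewrite -PE in P_rep.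
have PI := rep_card_vertices P_rep PV.
(* A simplex with at most k + 5 vertices has too few of them. *)
have [rj|rj] := eqVneq r j.
  have c0 : c = 0 by apply: rank_kermx_full; rewrite cr.
  by move: PI; rewrite c0 card_ray_index0; lia.
have jE : j = (k + (2 + 3))%N by lia.
have Q_ker := rep_kernel0 Q_rep cr Qr.
(* Over Q itself the kernel is 0, so every ray is a vertex of Q. *)
have Iv : (#|ray_index c| <= v)%N.
  have vert (p : ray_type c) := ray_vertex Q_rep Q_ker
    (or_introl erefl : 0 = 0 \/ (exists2 i, 0 < (0 : 'rV_j) 0 i & ray c (val p) 0 i = 0) /\
       (exists2 i, (0 : 'rV_j) 0 i < 0 & ray c (val p) 0 i = 0)).
  rewrite -card_ray_type; apply: (card_sup_range (f := fun p : ray_type c => nray l p *m M)) Qv.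
    by move=> p q; apply: (vert q).2.
  by move=> _ [p _ <-]; exact: (vert p).1.
have [|l' [M'' P_rep']] := rep_projection P_rep jE.
  apply: factor_succ; have := card_ray_index c; have := card_signs c; lia.
apply: (pyramid_or_prism P_rep').
  by move: Pd; rewrite /dimension -addnS.
by move: PV; rewrite -addnA.
Qed.

End ProjectionsOfSlackCones.

End ExtensionComplexity.

(** * The three values of the extension complexity *)

Theorem theorem1 (R : realType) (n d : nat) (P : set 'rV[R]_n)
    (P_polytope : polytope P) (P_dim : dimension P d)
    (P_vertices : vertices P #= `I_(d + 4)) :
  (* (1) *)
  (xc P = d + 2 <-> facets P #= `I_(d + 2)) /\
  (* (2), for the polytopes not covered by (1) *)
  (xc P = d + 3 <->
     ~ (facets P #= `I_(d + 2)) /\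
     (facets P #= `I_(d + 3) \/ projection_of_pyramid_over_prism d P)) /\
  (projection_of_pyramid_over_prism d P ->
     pyramid_over_desarguian_hexagon P \/ has_prism_on_vertices P) /\
  (* (3) *)
  (~ (facets P #= `I_(d + 2)) ->
   ~ (facets P #= `I_(d + 3) \/ projection_of_pyramid_over_prism d P) ->
   xc P = d + 4).
Proof.
have d2 : (2 <= d)%N by apply: dimension_ge2 P_dim P_vertices _; lia.
have [j le_j Pj] : exists2 j, (j <= d + 4)%N & has_extension P j.
  by apply: simplex_extension P_polytope P_vertices _; lia.
have [Pxc minxc] := xcP Pj.
have le_xc : (xc P <= d + 4)%N := leq_trans (minxc j Pj) le_j.
have facets_xc k : facets P #= `I_k -> (xc P <= k)%N.
  by move=> Pk; apply/minxc/has_extension_self.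
have cases := extension_cases P_dim P_vertices Pxc.
have ge_xc : (d + 2 <= xc P)%N.
  by have [/cases[]//|] := leqP (xc P) (d + 3); lia.
have part1 : xc P = d + 2 <-> facets P #= `I_(d + 2).
  split=> [xcE|/facets_xc]; last by lia.
  by have [|_ [|[]]] := cases; rewrite xcE //; lia.
have part22 (proj : projection_of_pyramid_over_prism d P) := projection_extension P_dim P_vertices proj.
have part2 : xc P = d + 3 <->
    ~ (facets P #= `I_(d + 2)) /\ (facets P #= `I_(d + 3) \/ projection_of_pyramid_over_prism d P).
  split=> [xcE|[/part1 xcN le3]]; last first.
    suff : (xc P <= d + 3)%N by lia.
    case: le3 => [/facets_xc //|/part22[[i le_i /minxc le_xci] _]].
    exact: leq_trans le_xci le_i.
  split; first by move/part1; lia.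
  have [|_ [|[_ [c [l [M [P_rep cr]]]]]]] := cases; rewrite ?xcE //; first by left.
  have [[i le_i Pi]|] := rep_facets_or_projection P_rep cr xcE (ltnW d2) P_dim P_vertices; last by right.
  (* P is an extension of itself, so its number of facets is at least [xc P], which is d + 3. *)
  by left; have := facets_xc i Pi; rewrite xcE => ge_i; have <- : i = d + 3 by lia.
split=> //; split=> //; split=> [/part22[]//|nfacets notcase2].
have neq2 : xc P <> d + 2 by move/part1.
have neq3 : xc P <> d + 3 by move/part2 => [].
lia.
Qed.
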